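(* Let $k$ be an algebraically closed field of characteristic $p\ge 3$ and let $\mathcal{U}$ be a unipotent finite group scheme over $k$. Then $\mathcal{L}:=\mathrm{H}^1(k\mathcal{U},k\mathcal{U})$ is a simple Lie algebra if and only if $\mathcal{U}$ is elementary abelian.
   Context: For a finite group scheme $\mathcal{U}$ over $k$, $k\mathcal{U}:=k[\mathcal{U}]^*$ is its group algebra (dual of the coordinate ring). $\mathcal{U}$ is unipotent if $k\mathcal{U}$ is a local algebra. An abelian finite group scheme $\mathcal{E}$ is elementary abelian if there exist subgroup schemes $\mathcal{E}_1,\dots,\mathcal{E}_n\subseteq\mathcal{E}$ with $\mathcal{E}=\mathcal{E}_1\cdots\mathcal{E}_n$ and each $\mathcal{E}_i$ isomorphic to some $\mathbb{G}_{a(r_i)}$ or to $\mathbb{Z}/(p)$. Here $\mathbb{G}_{a(r)}$ is the $r$-th Frobenius kernel of the additive group $\mathbb{G}_a$, and $\mathbb{Z}/(p)$ is the reduced (constant) group scheme whose group of $k$-rational points is cyclic of order $p$. For a finite-dimensional algebra $A$, $\mathrm{H}^1(A,A)=\mathrm{Der}(A)/\mathrm{IDer}(A)$ (derivations modulo inner derivations), with Lie bracket induced by the commutator. *)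

(* Defs.v *)
From HB Require Import structures.
From mathcomp Require Import all_boot all_order all_fingroup all_algebra all_solvable all_field.

Set Implicit Arguments.
Unset Strict Implicit.
Unset Printing Implicit Defensive.

Import GRing.Theory.
Local Open Scope ring_scope.
Local Open Scope quotient_scope.

Reserved Notation "a *t b" (at level 40, left associativity).

Section Tensor.
Variable k : fieldType.

(* The tensor product of finite-dimensional spaces: a tensor is the matrix of
   its coordinates in the basis formed by the products of basis vectors. *)
Definition tens (A B : vectType k) : Type := 'M[k]_(\dim {:A}, \dim {:B}).

HB.instance Definition _ (A B : vectType k) :=
  Vector.copy (tens A B) 'M[k]_(\dim {:A}, \dim {:B}).

Definition ptens (A B : vectType k) (a : A) (b : B) : tens A B :=
  \matrix_(i, j) (coord (vbasis {:A}) i a * coord (vbasis {:B}) j b).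

Local Notation "a *t b" := (ptens a b) : ring_scope.

(* The linear map on A (x) B induced by a bilinear map f; see tens_liftE. *)
Definition tens_lift (A B V : vectType k) (f : A -> B -> V) (t : tens A B) : V :=
  \sum_i \sum_j (t : 'M_(_, _)) i j *: f (vbasis {:A})`_i (vbasis {:B})`_j.

Lemma tens_lift_is_linear (A B V : vectType k) (f : A -> B -> V) :
  linear (tens_lift f).
Proof.
move=> c s t; rewrite /tens_lift scaler_sumr -big_split; apply: eq_bigr => i _.
rewrite scaler_sumr -big_split; apply: eq_bigr => j _.
by rewrite !mxE scalerDl scalerA.
Qed.

HB.instance Definition _ (A B V : vectType k) (f : A -> B -> V) :=
  GRing.isLinear.Build k (tens A B) V _ (tens_lift f) (tens_lift_is_linear f).

Definition bilin (A B V : vectType k) (f : A -> B -> V) : Prop :=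
  (forall b, linear (f^~ b)) /\ (forall a, linear (f a)).

Lemma lin_sum (V W : vectType k) (f : V -> W) I (r : seq I) (F : I -> V) c :
  linear f -> f (\sum_(i <- r) c i *: F i) = \sum_(i <- r) c i *: f (F i).
Proof.
move=> lf; pose g := GRing.isLinear.Build k V W _ f lf.
pose F0 : {linear V -> W} := HB.pack f g.
by rewrite -[f]/(F0 : V -> W) linear_sum; apply: eq_bigr => i _; rewrite linearZ.
Qed.

Lemma lin_sum1 (V W : vectType k) (f : V -> W) I (r : seq I) (F : I -> V) :
  linear f -> f (\sum_(i <- r) F i) = \sum_(i <- r) f (F i).
Proof.
move=> lf; under eq_bigr => i _ do rewrite -[F i]scale1r.
by rewrite (lin_sum _ _ _ lf); apply: eq_bigr => i _; rewrite scale1r.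
Qed.

Lemma tens_liftE (A B V : vectType k) (f : A -> B -> V) a b :
  bilin f -> tens_lift f (a *t b) = f a b.
Proof.
case=> fl fr; rewrite [in RHS](coord_vbasis (memvf a)).
rewrite (lin_sum _ _ _ (fl b)); apply: eq_bigr => i _.
rewrite [in RHS](coord_vbasis (memvf b)) (lin_sum _ _ _ (fr _)) scaler_sumr.
by apply: eq_bigr => j _; rewrite mxE scalerA.
Qed.

Lemma bilin_ptens (A B : vectType k) : bilin (@ptens A B).
Proof.
split=> [b|a] c u v; apply/matrixP => i j; rewrite !mxE linearP /=.
  by rewrite mulrDl mulrA.
by rewrite mulrDr mulrCA.
Qed.

Lemma tens_lift_ptens (A B : vectType k) (t : tens A B) :
  t = tens_lift (@ptens A B) t.
Proof.
apply/matrixP => i j; rewrite /tens_lift summxE (bigD1 i) //= summxE (bigD1 j) //=.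
rewrite !mxE !coord_free ?(basis_free (vbasisP _)) // !eqxx !mulr1.
rewrite big1 ?addr0; last first.
  by move=> j' /negPf nj; rewrite !mxE !coord_free ?(basis_free (vbasisP _)) //
    nj !mulr0.
rewrite big1 ?addr0 // => i' /negPf ni; rewrite summxE big1 // => j' _.
by rewrite !mxE !coord_free ?(basis_free (vbasisP _)) // ni mul0r mulr0.
Qed.

Lemma tens_ext (A B V : vectType k) (f g : tens A B -> V) :
  linear f -> linear g -> (forall a b, f (a *t b) = g (a *t b)) -> f =1 g.
Proof.
move=> lf lg fg t; rewrite (tens_lift_ptens t) /tens_lift.
have E (h : tens A B -> V) : linear h ->
  h (\sum_i \sum_j (t : 'M_(_, _)) i j *: ((vbasis {:A})`_i *t (vbasis {:B})`_j)) =
  \sum_i \sum_j (t : 'M_(_, _)) i j *: h ((vbasis {:A})`_i *t (vbasis {:B})`_j).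
  move=> lh; rewrite (lin_sum1 _ _ lh); apply: eq_bigr => i _.
  by rewrite (lin_sum _ _ _ lh).
by rewrite !E //; do 2!(apply: eq_bigr => ? _); rewrite fg.
Qed.

Lemma tens_ind (A B : vectType k) (P : tens A B -> Prop) :
  (forall a b, P (a *t b)) -> (forall c u v, P u -> P v -> P (c *: u + v)) ->
  forall t, P t.
Proof.
move=> Pp Pl t; have P0 : P 0 by rewrite -(addNr (0 *t 0)) -scaleN1r; apply: Pl.
have PD u v : P u -> P v -> P (u + v) by move=> Pu Pv; rewrite -[u]scale1r; apply: Pl.
rewrite (tens_lift_ptens t) /tens_lift.
apply: big_ind => // i _; apply: big_ind => // j _.
by rewrite -[X in P X]addr0; apply: Pl.
Qed.

Lemma tens_lift_param (A B V W : vectType k) (f : W -> A -> B -> V) t :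
  (forall a b, linear (fun w => f w a b)) -> linear (fun w => tens_lift (f w) t).
Proof.
move=> lf c u v; rewrite /tens_lift scaler_sumr -big_split; apply: eq_bigr => i _.
rewrite scaler_sumr -big_split; apply: eq_bigr => j _.
by rewrite lf scalerDr !scalerA mulrC.
Qed.

Lemma eq_tens_lift (A B V : vectType k) (f g : A -> B -> V) t :
  (forall a b, f a b = g a b) -> tens_lift f t = tens_lift g t.
Proof. by move=> fg; rewrite /tens_lift; do 2!apply: eq_bigr => ? _; rewrite fg. Qed.

Lemma tens_liftD (A B V : vectType k) (f g : A -> B -> V) t :
  tens_lift (fun a b => f a b + g a b) t = tens_lift f t + tens_lift g t.
Proof.
rewrite /tens_lift -big_split; apply: eq_bigr => i _.
by rewrite -big_split; apply: eq_bigr => j _; rewrite scalerDr.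
Qed.

Lemma tens_liftZ (A B V : vectType k) c (f : A -> B -> V) t :
  tens_lift (fun a b => c *: f a b) t = c *: tens_lift f t.
Proof.
rewrite /tens_lift scaler_sumr; apply: eq_bigr => i _; rewrite scaler_sumr.
by apply: eq_bigr => j _; rewrite !scalerA mulrC.
Qed.

Lemma lin_tens_lift (A B V W : vectType k) (f : V -> W) (g : A -> B -> V) t :
  linear f -> f (tens_lift g t) = tens_lift (fun a b => f (g a b)) t.
Proof.
move=> lf; rewrite /tens_lift (lin_sum1 _ _ lf); apply: eq_bigr => i _.
by rewrite (lin_sum _ _ _ lf).
Qed.

Definition tmap (A B A' B' : vectType k) (f : A -> A') (g : B -> B') :
  tens A B -> tens A' B' := tens_lift (fun a b => f a *t g b).

Lemma tmapE (A B A' B' : vectType k) (f : A -> A') (g : B -> B') a b :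
  linear f -> linear g -> tmap f g (a *t b) = f a *t g b.
Proof.
have [pl pr] := bilin_ptens A' B'; move=> lf lg.
by apply: tens_liftE; split=> z c u v /=; rewrite (lf, lg) (pl, pr).
Qed.

Lemma tmap_linear (A B A' B' : vectType k) (f : A -> A') (g : B -> B') :
  linear (tmap f g).
Proof. by move=> c u v; rewrite /tmap linearP. Qed.

Lemma tens_lift_tmap (A B A' B' V : vectType k) (h : A' -> B' -> V)
    (f : A -> A') (g : B -> B') t : bilin h -> linear f -> linear g ->
  tens_lift h (tmap f g t) = tens_lift (fun a b => h (f a) (g b)) t.
Proof.
move=> hb lf lg; have [hl hr] := hb; elim/tens_ind: t => [a b|c u v Hu Hv].
  by rewrite tmapE // !tens_liftE //; split=> z c u v /=; rewrite (lf, lg) (hl, hr).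
by rewrite tmap_linear !linearP /= Hu Hv.
Qed.

Definition tassoc (A B C : vectType k) :
  tens (tens A B) C -> tens A (tens B C) :=
  tens_lift (fun ab c => tens_lift (fun a b => a *t (b *t c)) ab).

Lemma tassoc_linear (A B C : vectType k) : linear (@tassoc A B C).
Proof. by move=> c u v; rewrite /tassoc linearP. Qed.

Lemma tassocE (A B C : vectType k) (a : A) (b : B) (c : C) :
  tassoc (a *t b *t c) = a *t (b *t c).
Proof.
have [pl pr] := bilin_ptens B C; have [ql qr] := bilin_ptens A (tens B C).
rewrite /tassoc !tens_liftE //; split=> z d u v /=.
- by rewrite ql.
- by rewrite pl qr.
- by rewrite linearP.
- rewrite -tens_liftZ -tens_liftD; apply: eq_tens_lift => x y; by rewrite pr qr.
Qed.

Definition tswap (A B : vectType k) : tens A B -> tens B A :=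
  tens_lift (fun a b => b *t a).

Definition tensv (A B : vectType k) (U : {vspace A}) (V : {vspace B}) :
    {vspace tens A B} :=
  <<[seq u *t v | u <- vbasis U, v <- vbasis V]>>%VS.


End Tensor.

Notation "a *t b" := (ptens a b) : ring_scope.

Section TensorAlgebra.
Variables (k : fieldType) (A B : falgType k).

(* (a (x) b) * (a' (x) b') = (a * a') (x) (b * b'), see tmulE. *)
Definition tmul (s t : tens A B) : tens A B :=
  tens_lift (fun a b => tens_lift (fun a' b' => (a * a') *t (b * b')) t) s.

Lemma tmul_linl t : linear (tmul^~ t).
Proof. by move=> c u v; rewrite /tmul linearP. Qed.

Lemma tmul_linr s : linear (tmul s).
Proof. by apply: tens_lift_param => a b c u v; rewrite linearP. Qed.

Lemma tmulE a b a' b' : tmul (a *t b) (a' *t b') = (a * a') *t (b * b').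
Proof.
have [pl pr] := bilin_ptens A B.
have tE x y : bilin (fun a' b' => (x * a') *t (y * b') : tens A B).
  by split=> z c u v /=; rewrite mulrDr -scalerAr (pl, pr).
rewrite /tmul tens_liftE ?tens_liftE //; split=> z c u v /=.
  rewrite /tens_lift scaler_sumr -big_split; apply: eq_bigr => i _.
  rewrite scaler_sumr -big_split; apply: eq_bigr => j _.
  by rewrite mulrDl -scalerAl pl scalerDr !scalerA mulrC.
rewrite /tens_lift scaler_sumr -big_split; apply: eq_bigr => i _.
rewrite scaler_sumr -big_split; apply: eq_bigr => j _.
by rewrite mulrDl -scalerAl pr scalerDr !scalerA mulrC.
Qed.

Fact tmulA : associative tmul.
Proof.
elim/tens_ind=> [a b|c s s' Hs Hs'] t u; last by rewrite !tmul_linl Hs Hs'.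
elim/tens_ind: t => [a' b'|c t t' Ht Ht']; last first.
  by rewrite tmul_linr !tmul_linl tmul_linr Ht Ht'.
elim/tens_ind: u => [a'' b''|c u u' Hu Hu']; last by rewrite !tmul_linr Hu Hu'.
by rewrite !tmulE !mulrA.
Qed.

Fact tmul1l : left_id (1 *t 1) tmul.
Proof.
elim/tens_ind=> [a b|c u u' Hu Hu']; first by rewrite tmulE !mul1r.
by rewrite tmul_linr Hu Hu'.
Qed.

Fact tmul1r : right_id (1 *t 1) tmul.
Proof.
elim/tens_ind=> [a b|c u u' Hu Hu']; first by rewrite tmulE !mulr1.
by rewrite tmul_linl Hu Hu'.
Qed.

Fact tmulDl : left_distributive tmul +%R.
Proof. by move=> s t u; rewrite -[s]scale1r tmul_linl !scale1r. Qed.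

Fact tmulDr : right_distributive tmul +%R.
Proof. by move=> s t u; rewrite -[t]scale1r tmul_linr !scale1r. Qed.

Fact tens1_neq0 : 1 *t 1 != 0 :> tens A B.
Proof.
have nz (C : falgType k) : exists i, coord (vbasis {:C}) i 1 != 0.
  apply/existsP; apply: contraT; rewrite negb_exists => /forallP n0.
  suff /eqP : 1 = 0 :> C by rewrite oner_eq0.
  rewrite (coord_vbasis (memvf 1)) big1 // => i _.
  by move/negPn/eqP: (n0 i) => ->; rewrite scale0r.
have [i ni] := nz A; have [j nj] := nz B.
apply: contraNneq ni => /matrixP/(_ i j); rewrite !mxE => /eqP.
by rewrite mulf_eq0 (negPf nj) orbF.
Qed.

HB.instance Definition _ := GRing.Zmodule_isNzRing.Build (tens A B)
  tmulA tmul1l tmul1r tmulDl tmulDr tens1_neq0.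

Fact tens_scaleAl (c : k) (s t : tens A B) : c *: (s * t) = (c *: s) * t.
Proof.
have /= := tmul_linl t c s 0.
by rewrite addr0 -[tmul 0 t]/(0 * t) mul0r addr0 => <-.
Qed.

Fact tens_scaleAr (c : k) (s t : tens A B) : c *: (s * t) = s * (c *: t).
Proof.
have /= := tmul_linr s c t 0.
by rewrite addr0 -[tmul s 0]/(s * 0) mulr0 addr0 => <-.
Qed.

HB.instance Definition _ := GRing.Lmodule_isLalgebra.Build k (tens A B) tens_scaleAl.
HB.instance Definition _ := GRing.Lalgebra_isAlgebra.Build k (tens A B) tens_scaleAr.
HB.instance Definition _ := Algebra_isFalgebra.Build k (tens A B).

Lemma ptensM (a a' : A) (b b' : B) :
  (a *t b) * (a' *t b') = (a * a') *t (b * b') :> tens A B.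
Proof. exact: tmulE. Qed.

Lemma ptens1 : 1 *t 1 = 1 :> tens A B. Proof. by []. Qed.

End TensorAlgebra.

(* A finite group scheme is represented by its coordinate ring: a finite-dimensional
   commutative Hopf algebra. *)
HB.mixin Record Falgebra_isGroupScheme (k : fieldType) A of Falgebra k A := {
  coord_mulC : commutative (@GRing.mul A);
  comul : 'AHom(A, tens A A);
  counit : 'AHom(A, k^o);
  antipode : 'AEnd(A);
  comulA : forall a : A,
    tassoc (tmap comul id (comul a)) = tmap id comul (comul a);
  counitl : forall a : A, tens_lift (fun x y => counit x *: y) (comul a) = a;
  counitr : forall a : A, tens_lift (fun x y => counit y *: x) (comul a) = a;
  antipodel : forall a : A,
    tens_lift (fun x y => antipode x * y) (comul a) = counit a *: 1;
  antipoder : forall a : A,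
    tens_lift (fun x y => x * antipode y) (comul a) = counit a *: 1
}.

#[short(type="finGroupScheme")]
HB.structure Definition FinGroupScheme (k : fieldType) :=
  { A of Falgebra_isGroupScheme k A & Falgebra k A }.

Section GroupAlgebra.
Variables (k : fieldType) (U : finGroupScheme k).

(* kU = k[U]^*, with the convolution product dual to the comultiplication. *)
Definition groupAlg : Type := 'Hom(U, k^o).

HB.instance Definition _ := Vector.copy groupAlg 'Hom(U, k^o).

Definition gapp (phi : groupAlg) : 'Hom(U, k^o) := phi.

Definition conv_pair (phi psi : groupAlg) (x y : U) : k^o := gapp phi x * gapp psi y.

Definition gmul (phi psi : groupAlg) : groupAlg :=
  linfun (tens_lift (conv_pair phi psi) \o comul).

Definition gone : groupAlg := counit.

Lemma gmulE phi psi (a : U) :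
  gapp (gmul phi psi) a = tens_lift (conv_pair phi psi) (comul a).
Proof. by rewrite /gapp lfunE. Qed.

Lemma gextP (phi psi : groupAlg) : gapp phi =1 gapp psi -> phi = psi.
Proof. by move=> e; apply/lfunP. Qed.

Lemma gappD phi psi a : gapp (phi + psi) a = gapp phi a + gapp psi a.
Proof. by rewrite /gapp lfunE. Qed.

Lemma gappZ c phi a : gapp (c *: phi) a = c *: gapp phi a.
Proof. by rewrite /gapp lfunE. Qed.

Fact bilin_conv phi psi : bilin (conv_pair phi psi).
Proof.
split=> [y|x] c u v; rewrite /conv_pair linearP.
  by rewrite mulrDl -scalerAl.
by rewrite mulrDr -scalerAr.
Qed.

Fact gmulA : associative gmul.
Proof.
move=> phi psi chi; apply: gextP => a.
pose T (w : tens (tens U U) U) : k^o :=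
  tens_lift (fun xy z => tens_lift (conv_pair phi psi) xy * gapp chi z) w.
pose T' (w : tens U (tens U U)) : k^o :=
  tens_lift (fun x yz => gapp phi x * tens_lift (conv_pair psi chi) yz) w.
have bT : bilin (fun (xy : tens U U) z => tens_lift (conv_pair phi psi) xy * gapp chi z : k^o).
  by split=> [z|z] c u v; rewrite linearP ?mulrDl -?scalerAl // mulrDr -scalerAr.
have bT' : bilin (fun x (yz : tens U U) => gapp phi x * tens_lift (conv_pair psi chi) yz : k^o).
  by split=> [z|z] c u v; rewrite linearP ?mulrDl -?scalerAl // mulrDr -scalerAr.
have -> : gapp (gmul (gmul phi psi) chi) a = T (tmap comul id (comul a)).
  rewrite /T tens_lift_tmap //; try exact: linearP; rewrite gmulE; apply: eq_tens_lift => x y.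
  by rewrite /conv_pair gmulE.
have -> : gapp (gmul phi (gmul psi chi)) a = T' (tmap id comul (comul a)).
  rewrite /T' tens_lift_tmap //; try exact: linearP; rewrite gmulE; apply: eq_tens_lift => x y.
  by rewrite /conv_pair gmulE.
have lT : linear T by exact: linearP.
have lT' : linear T' by exact: linearP.
rewrite -comulA; move: (tmap _ _ _) => w.
elim/tens_ind: w => [xy z|c u v Hu Hv]; last first.
  by rewrite tassoc_linear lT lT' Hu Hv.
elim/tens_ind: xy => [x y|c u v Hu Hv].
  rewrite /T tens_liftE // tassocE /T' !tens_liftE //; try exact: bilin_conv.
  by rewrite /conv_pair mulrA.
have [pl _] := bilin_ptens (tens U U) U.
by rewrite pl tassoc_linear lT lT' Hu Hv.
Qed.

Fact gmul1l : left_id gone gmul.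
Proof.
move=> phi; apply: gextP => a; rewrite gmulE -[in RHS](counitl a).
rewrite (lin_tens_lift (f := gapp phi)); last exact: linearP.
by apply: eq_tens_lift => x y; rewrite /conv_pair linearZ.
Qed.

Fact gmul1r : right_id gone gmul.
Proof.
move=> phi; apply: gextP => a; rewrite gmulE -[in RHS](counitr a).
rewrite (lin_tens_lift (f := gapp phi)); last exact: linearP.
by apply: eq_tens_lift => x y; rewrite /conv_pair linearZ mulrC.
Qed.

Fact gmulDl : left_distributive gmul +%R.
Proof.
move=> phi psi chi; apply: gextP => a; rewrite gappD !gmulE.
rewrite -tens_liftD; apply: eq_tens_lift => x y.
by rewrite /conv_pair gappD mulrDl.
Qed.

Fact gmulDr : right_distributive gmul +%R.
Proof.
move=> phi psi chi; apply: gextP => a; rewrite gappD !gmulE.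
rewrite -tens_liftD; apply: eq_tens_lift => x y.
by rewrite /conv_pair gappD mulrDr.
Qed.

Fact gone_neq0 : gone != 0.
Proof.
apply/eqP => /lfunP/(_ 1)/eqP; rewrite lfunE /gone /= rmorph1.
by rewrite oner_eq0.
Qed.

HB.instance Definition _ := GRing.Zmodule_isNzRing.Build groupAlg
  gmulA gmul1l gmul1r gmulDl gmulDr gone_neq0.

Fact gscaleAl (c : k) (phi psi : groupAlg) : c *: (phi * psi) = (c *: phi) * psi.
Proof.
apply: gextP => a; rewrite gappZ !gmulE -tens_liftZ.
by apply: eq_tens_lift => x y; rewrite /conv_pair gappZ scalerAl.
Qed.

Fact gscaleAr (c : k) (phi psi : groupAlg) : c *: (phi * psi) = phi * (c *: psi).
Proof.
apply: gextP => a; rewrite gappZ !gmulE -tens_liftZ.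
by apply: eq_tens_lift => x y; rewrite /conv_pair gappZ scalerAr.
Qed.

HB.instance Definition _ := GRing.Lmodule_isLalgebra.Build k groupAlg gscaleAl.
HB.instance Definition _ := GRing.Lalgebra_isAlgebra.Build k groupAlg gscaleAr.
HB.instance Definition _ := Algebra_isFalgebra.Build k groupAlg.

End GroupAlgebra.

Section QuotientSpace.
Variables (k : fieldType) (V : vectType k) (W : {vspace V}).

Definition quotv : Type := Quotient.quot (pred_of_vspace W).

HB.instance Definition _ := GRing.Zmodule.on quotv.
HB.instance Definition _ := EqQuotient.on quotv.

Definition qproj (v : V) : quotv := \pi_quotv v.
Definition qrepr (x : quotv) : V := generic_quotient.repr x.

Lemma qreprK : cancel qrepr qproj.
Proof. by move=> x; rewrite /qproj /qrepr reprK. Qed.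

Lemma qproj_eq u v : (qproj u == qproj v) = (u - v \in W).
Proof. by rewrite /qproj (Quotient.idealrBE (pred_of_vspace W)). Qed.

Lemma qprojD u v : qproj (u + v) = qproj u + qproj v.
Proof. exact: (Quotient.pi_add (pred_of_vspace W)). Qed.

Definition qscale (c : k) (x : quotv) : quotv := qproj (c *: qrepr x).

Lemma qprojZ c v : qscale c (qproj v) = qproj (c *: v).
Proof. by apply/eqP; rewrite qproj_eq -scalerBr memvZ // -qproj_eq qreprK. Qed.

Fact qscaleA b c x : qscale b (qscale c x) = qscale (b * c) x.
Proof. by rewrite -[x]qreprK !qprojZ scalerA. Qed.
Fact qscale1 : left_id 1 qscale.
Proof. by move=> x; rewrite -[x]qreprK qprojZ scale1r. Qed.
Fact qscaleDr : right_distributive qscale +%R.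
Proof. 
by move=> c x y; rewrite -[x]qreprK -[y]qreprK -qprojD !qprojZ scalerDr qprojD.
Qed.
Fact qscaleDl x : {morph qscale^~ x : b c / b + c}.
Proof. by move=> b c; rewrite -[x]qreprK !qprojZ scalerDl qprojD. Qed.

HB.instance Definition _ :=
  GRing.Zmodule_isLmodule.Build k quotv qscaleA qscale1 qscaleDr qscaleDl.

Fact qproj_is_linear : linear qproj.
Proof. by move=> c u v; rewrite qprojD -qprojZ. Qed.

HB.instance Definition _ := GRing.isLinear.Build k V quotv _ qproj qproj_is_linear.

Fact quotv_vect_iso : Vector.axiom (\dim W^C) quotv.
Proof.
pose g v : 'rV[k]_(\dim W^C) := \row_i coord (vbasis W^C) i (v - projv W v).
pose h (r : 'rV[k]_(\dim W^C)) := \sum_i r 0 i *: (vbasis W^C)`_i.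
have lg : linear g.
  move=> c u v; apply/rowP => i; rewrite !mxE -linearP /=; congr (coord _ _ _).
  by rewrite linearP scalerBr opprD addrACA.
have gW u v : u - v \in W -> g u = g v.
  move=> uvW; apply/rowP => i; rewrite !mxE; congr (coord _ _ _).
  have pE : projv W u - projv W v = u - v by rewrite -[RHS](projv_id uvW) linearB.
  apply/eqP; rewrite -subr_eq0 opprD opprK addrACA -pE.
  by rewrite addrACA subrr addNr addr0.
have gq v : g (qrepr (qproj v)) = g v by apply: gW; rewrite -qproj_eq qreprK.
exists (fun x => g (qrepr x)).
  by move=> c x y; rewrite -[x]qreprK -[y]qreprK -linearP !gq lg.
exists (fun r => qproj (h r)) => [x|r].
  rewrite -[RHS]qreprK; apply/eqP; rewrite qproj_eq.
  have -> : h (g (qrepr x)) = qrepr x - projv W (qrepr x).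
    rewrite [RHS](coord_vbasis (memv_projC _ _)).
    by apply: eq_bigr => i _; rewrite mxE.
  by rewrite addrAC subrr sub0r memvN memv_proj.
have hW : h r \in (W^C)%VS.
  by apply: memv_suml => i _; rewrite memvZ // vbasis_mem // mem_nth // size_tuple.
rewrite gq; apply/rowP => i; rewrite mxE.
have -> : projv W (h r) = 0 by apply/eqP; rewrite -memv_ker lker_proj.
rewrite subr0 /h linear_sum (bigD1 i) //= linearZ /= coord_free ?(basis_free (vbasisP _)) //.
rewrite eqxx mulr1 big1 ?addr0 // => j /negPf ji.
by rewrite linearZ /= coord_free ?(basis_free (vbasisP _)) // ji mulr0.
Qed.

HB.instance Definition _ := Lmodule_hasFinDim.Build k quotv quotv_vect_iso.

End QuotientSpace.

HB.mixin Record Vector_isLieAlgebra (k : fieldType) L of Vector k L := {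
  lieb : L -> L -> L;
  lieb_linl : forall y : L, linear (lieb^~ y);
  lieb_linr : forall x : L, linear (lieb x);
  liebxx : forall x : L, lieb x x = 0;
  lieb_jacobi : forall x y z : L,
    lieb x (lieb y z) + lieb y (lieb z x) + lieb z (lieb x y) = 0
}.

#[short(type="lieAlgType")]
HB.structure Definition LieAlgebra (k : fieldType) :=
  { L of Vector_isLieAlgebra k L & Vector k L }.

Record lieIdeal (k : fieldType) (L : lieAlgType k) := LieIdeal {
  lie_ideal_space :> {vspace L};
  lie_idealP : forall x y : L, y \in lie_ideal_space -> lieb x y \in lie_ideal_space
}.

Definition simple_lie (k : fieldType) (L : lieAlgType k) : Prop :=
  (exists x y : L, lieb x y <> 0) /\
  (forall I : lieIdeal L, I = 0%VS :> {vspace L} \/ I = fullv :> {vspace L}).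

Section LieTheory.
Variables (k : fieldType) (L : lieAlgType k).

Lemma liebDl (x y z : L) : lieb (x + y) z = lieb x z + lieb y z.
Proof. by rewrite -[x in LHS]scale1r lieb_linl scale1r. Qed.
Lemma liebDr (x y z : L) : lieb z (x + y) = lieb z x + lieb z y.
Proof. by rewrite -[x in LHS]scale1r lieb_linr scale1r. Qed.
Lemma liebC (x y : L) : lieb x y = - lieb y x.
Proof.
apply/eqP; rewrite -addr_eq0; have := liebxx (x + y).
by rewrite liebDl !liebDr !liebxx add0r addr0 => ->.
Qed.
Lemma lieb0l (z : L) : lieb 0 z = 0.
Proof.
by have := lieb_linl z (-1) 0 0; rewrite scaleN1r oppr0 addr0 scaleN1r addNr.
Qed.
Lemma liebNl (x z : L) : lieb (- x) z = - lieb x z.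
Proof. by apply/eqP; rewrite -addr_eq0 -liebDl addNr lieb0l. Qed.
Lemma liebBl (x y z : L) : lieb (x - y) z = lieb x z - lieb y z.
Proof. by rewrite liebDl liebNl. Qed.
Lemma liebBr (x y z : L) : lieb z (x - y) = lieb z x - lieb z y.
Proof. by rewrite liebC liebBl opprB (liebC z x) (liebC z y) opprK addrC. Qed.

End LieTheory.

Section LieQuotient.
Variables (k : fieldType) (L : lieAlgType k) (I : lieIdeal L).

Definition lieQuot : Type := quotv I.

HB.instance Definition _ := Vector.on lieQuot.

Definition lqproj (x : L) : lieQuot := qproj I x.
Definition lqrepr (x : lieQuot) : L := qrepr x.

Definition lieQuot_lieb (x y : lieQuot) : lieQuot := lqproj (lieb (lqrepr x) (lqrepr y)).

Lemma lqreprK : cancel lqrepr lqproj. Proof. exact: qreprK. Qed.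

Lemma lqproj_linear : linear lqproj. Proof. exact: qproj_is_linear. Qed.

Lemma lqproj_lieb x y : lieQuot_lieb (lqproj x) (lqproj y) = lqproj (lieb x y).
Proof.
have reprB z : lqrepr (lqproj z) - z \in lie_ideal_space I.
  by rewrite -qproj_eq; apply/eqP; apply: qreprK.
apply/eqP; rewrite /lieQuot_lieb /lqproj qproj_eq.
set x' := lqrepr _; set y' := lqrepr _.
have -> : lieb x' y' - lieb x y = lieb (x' - x) y' + lieb x (y' - y).
  by rewrite liebBl liebBr addrA subrK.
rewrite memvD //; last by apply: lie_idealP; apply: reprB.
by rewrite liebC memvN; apply: lie_idealP; apply: reprB.
Qed.

Fact lieQuot_linl y : linear (lieQuot_lieb^~ y).
Proof.
move=> c u v; rewrite -[u]lqreprK -[v]lqreprK -[y]lqreprK -lqproj_linear.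
by rewrite !lqproj_lieb lieb_linl lqproj_linear.
Qed.
Fact lieQuot_linr x : linear (lieQuot_lieb x).
Proof.
move=> c u v; rewrite -[u]lqreprK -[v]lqreprK -[x]lqreprK -lqproj_linear.
by rewrite !lqproj_lieb lieb_linr lqproj_linear.
Qed.
Fact lieQuotxx x : lieQuot_lieb x x = 0.
Proof.
by rewrite -[x]lqreprK lqproj_lieb liebxx; apply: (linear0 (qproj I)).
Qed.
Fact lieQuot_jacobi x y z :
  lieQuot_lieb x (lieQuot_lieb y z) + lieQuot_lieb y (lieQuot_lieb z x)
    + lieQuot_lieb z (lieQuot_lieb x y) = 0.
Proof.
rewrite -[x]lqreprK -[y]lqreprK -[z]lqreprK !lqproj_lieb -!qprojD.
by rewrite lieb_jacobi; apply: (linear0 (qproj I)).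
Qed.

HB.instance Definition _ := Vector_isLieAlgebra.Build k lieQuot
  lieQuot_linl lieQuot_linr lieQuotxx lieQuot_jacobi.

End LieQuotient.

Section Hochschild.
Variables (k : fieldType) (A : falgType k).

Definition leibniz_defect (x y : A) (d : 'End(A)) : A :=
  d (x * y) - (d x * y + x * d y).

Fact leibniz_defect_is_linear x y : linear (leibniz_defect x y).
Proof.
move=> c d e; rewrite /leibniz_defect !lfunE /= !lfunE /= mulrDl mulrDr.
rewrite -scalerAl -scalerAr addrACA -scalerDr opprD addrACA -scalerN.
by rewrite -scalerDr.
Qed.
HB.instance Definition _ x y :=
  GRing.isLinear.Build k 'End(A) A _ (leibniz_defect x y) (leibniz_defect_is_linear x y).

(* The space of derivations; see dervP. *)
Definition derv : {vspace 'End(A)} :=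
  (\bigcap_(i < \dim {:A}) \bigcap_(j < \dim {:A})
     lker (linfun (leibniz_defect (vbasis {:A})`_i (vbasis {:A})`_j)))%VS.

Lemma dervP (d : 'End(A)) :
  (d \in derv) <-> (forall x y, d (x * y) = d x * y + x * d y).
Proof.
have kerE x y : (d \in lker (linfun (leibniz_defect x y))) = (leibniz_defect x y d == 0).
  by rewrite memv_ker lfunE.
split=> [dA x y|dA]; last first.
  apply: (big_ind (fun U : {vspace 'End(A)} => d \in U)) => [|U V dU dV|i _].
  - exact: memvf.
  - by rewrite memv_cap dU.
  apply: (big_ind (fun U : {vspace 'End(A)} => d \in U)) => [|U V dU dV|j _].
  - exact: memvf.
  - by rewrite memv_cap dU.
  by rewrite kerE /leibniz_defect dA subrr.
have de (i j : 'I_(\dim {:A})) :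
    leibniz_defect (vbasis {:A})`_i (vbasis {:A})`_j d = 0.
  apply/eqP; rewrite -kerE; move: dA; rewrite /derv (bigD1 i) //= memv_cap => /andP[+ _].
  by rewrite (bigD1 j) //= memv_cap => /andP[].
pose D (u v : A) := leibniz_defect u v d.
have linB (f g : A -> A) : linear f -> linear g -> linear (fun u => f u - g u).
  by move=> lf lg c u v; rewrite lf lg opprD addrACA scalerBr.
have linD (f g : A -> A) : linear f -> linear g -> linear (fun u => f u + g u).
  by move=> lf lg c u v; rewrite lf lg addrACA scalerDr.
have Dl v : linear (D^~ v).
  apply: linB => [c u u'|]; first by rewrite mulrDl -scalerAl linearP.
  apply: linD => c u u'; last by rewrite mulrDl -scalerAl.
  by rewrite linearP mulrDl -scalerAl.
have Dr u : linear (D u).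
  apply: linB => [c v v'|]; first by rewrite mulrDr -scalerAr linearP.
  apply: linD => c v v'; first by rewrite mulrDr -scalerAr.
  by rewrite linearP mulrDr -scalerAr.
have : D x y = 0.
  rewrite (coord_vbasis (memvf x)) (lin_sum _ _ _ (Dl _)) big1 // => i _.
  rewrite (coord_vbasis (memvf y)) (lin_sum _ _ _ (Dr _)) big1 ?scaler0 // => j _.
  by rewrite /D de scaler0.
by rewrite /D /leibniz_defect => /eqP; rewrite subr_eq0 => /eqP.
Qed.

Definition Der : Type := subvs_of derv.
HB.instance Definition _ := Vector.on Der.

Definition der_fun (d : Der) : 'End(A) := vsval d.

Lemma der_ext (d e : Der) : der_fun d =1 der_fun e -> d = e.
Proof. by move=> de; apply: val_inj; apply/lfunP. Qed.

Lemma der_funM (d : Der) x y : der_fun d (x * y) = der_fun d x * y + x * der_fun d y.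
Proof. by have /dervP := subvsP d; apply. Qed.

Lemma der_funP c (d e : Der) x :
  der_fun (c *: d + e) x = c *: der_fun d x + der_fun e x.
Proof. by rewrite /der_fun linearP !lfunE /= lfunE. Qed.

Lemma der_funD (d e : Der) x : der_fun (d + e) x = der_fun d x + der_fun e x.
Proof. by rewrite /der_fun linearD lfunE. Qed.

Lemma der_fun0 x : der_fun 0 x = 0.
Proof. by rewrite /der_fun linear0 lfunE. Qed.

Fact der_commP (d e : Der) :
  ((der_fun d \o der_fun e) - (der_fun e \o der_fun d))%VF \in derv.
Proof.
have cE z : ((der_fun d \o der_fun e) - (der_fun e \o der_fun d))%VF z =
    der_fun d (der_fun e z) - der_fun e (der_fun d z).
  by rewrite add_lfunE opp_lfunE !comp_lfunE.
apply/dervP => x y; rewrite !cE der_funM (der_funM d x) !linearD /= !der_funM.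
rewrite mulrBl mulrBr.
set a := der_fun d (der_fun e x) * y; set b := der_fun e x * der_fun d y.
set a' := der_fun d x * der_fun e y; set b' := x * der_fun d (der_fun e y).
set c := der_fun e (der_fun d x) * y; set c' := x * der_fun e (der_fun d y).
rewrite !opprD (AC ((2*2)*(2*2)) ((1*5)*(4*8)*(2*7)*(3*6)))/=.
by rewrite !subrr !addr0.
Qed.

Definition der_lieb (d e : Der) : Der := Subvs (der_commP d e).

Lemma der_liebE d e x :
  der_fun (der_lieb d e) x = der_fun d (der_fun e x) - der_fun e (der_fun d x).
Proof. by rewrite {1}/der_fun /= !(add_lfunE, opp_lfunE, comp_lfunE). Qed.

Fact der_linl e : linear (der_lieb^~ e).
Proof.
move=> c d d'; apply: der_ext => x; rewrite der_funP !der_liebE !der_funP linearP /=.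
by rewrite scalerBr opprD addrACA.
Qed.
Fact der_linr e : linear (der_lieb e).
Proof.
move=> c d d'; apply: der_ext => x; rewrite der_funP !der_liebE !der_funP linearP /=.
by rewrite scalerBr opprD addrACA.
Qed.
Fact derxx d : der_lieb d d = 0.
Proof. by apply: der_ext => x; rewrite der_liebE der_fun0 subrr. Qed.
Fact der_jacobi x y z :
  der_lieb x (der_lieb y z) + der_lieb y (der_lieb z x) + der_lieb z (der_lieb x y) = 0.
Proof.
apply: der_ext => a; rewrite !der_funD !der_liebE !linearB /= der_fun0 !opprK.
rewrite (AC ((2*2)*(2*2)*(2*2)) ((1*11)*(8*2)*(4*10)*(5*3)*(12*6)*(9*7)))/=.
by rewrite !subrr !addr0.
Qed.

HB.instance Definition _ := Vector_isLieAlgebra.Build k Der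
  der_linl der_linr derxx der_jacobi.

Fact inner_derv (a : A) : amull a - amulr a \in derv.
Proof.
apply/dervP => x y; rewrite !(add_lfunE, opp_lfunE) !lfunE /=.
by rewrite mulrBl mulrBr !mulrA addrA subrK.
Qed.

Definition inner_der (a : A) : Der := Subvs (inner_derv a).

Lemma inner_derE a x : der_fun (inner_der a) x = a * x - x * a.
Proof. by rewrite /der_fun /= !(add_lfunE, opp_lfunE) !lfunE. Qed.

Fact inner_der_is_linear : linear inner_der.
Proof.
move=> c a b; apply: der_ext => x; rewrite der_funP !inner_derE.
by rewrite mulrDl mulrDr -scalerAl -scalerAr opprD addrACA scalerBr.
Qed.
HB.instance Definition _ :=
  GRing.isLinear.Build k A Der _ inner_der inner_der_is_linear.

Definition ider_space : {vspace Der} := limg (linfun inner_der).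

Fact ider_ideal (d e : Der) : e \in ider_space -> lieb d e \in ider_space.
Proof.
case/memv_imgP => a _ ->; rewrite lfunE /=.
have -> : lieb d (inner_der a) = linfun inner_der (der_fun d a); last first.
  by rewrite memv_img ?memvf.
rewrite lfunE; apply: der_ext => x; rewrite der_liebE !inner_derE linearB /= !der_funM.
rewrite !opprD opprK (AC (2*2*2) ((1*4)*(2*5)*(3*6)))/=.
by rewrite subrr addNr !addr0.
Qed.

Definition IDer : lieIdeal Der := LieIdeal ider_ideal.

Definition HH1 : lieAlgType k := lieQuot IDer.

End Hochschild.

Section AlgHom.
Variables (k : fieldType).

Lemma lin_add (V W : vectType k) (f : V -> W) u v : linear f -> f (u + v) = f u + f v.
Proof. by move=> lf; rewrite -[u in LHS]scale1r lf scale1r. Qed.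

Lemma tens_lift_alghom (A B C : falgType k) (f : A -> B -> C) :
    bilin f -> f 1 1 = 1 ->
    (forall a b a' b', f (a * a') (b * b') = f a b * f a' b') ->
  monoid_morphism (tens_lift f).
Proof.
move=> fb f1 fM; split; first by rewrite -ptens1 tens_liftE.
move=> s t; elim/tens_ind: s => [a b|c u v Hu Hv]; last first.
  by rewrite mulrDl -scalerAl !linearP /= mulrDl -scalerAl Hu Hv.
elim/tens_ind: t => [a' b'|c u v Hu Hv]; last first.
  by rewrite mulrDr -scalerAr !linearP /= mulrDr -scalerAr Hu Hv.
by rewrite ptensM !tens_liftE.
Qed.

Lemma monoid_comp (R S T : falgType k) (f : S -> T) (g : R -> S) :
  monoid_morphism f -> monoid_morphism g -> monoid_morphism (f \o g).
Proof. by move=> [f1 fM] [g1 gM]; split=> [|x y] /=; rewrite (g1, gM) (f1, fM). Qed.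

Lemma linear_comp (R S T : vectType k) (f : S -> T) (g : R -> S) :
  linear f -> linear g -> linear (f \o g).
Proof. by move=> lf lg c u v /=; rewrite lg lf. Qed.

Lemma tmap_alghom (A B C D : falgType k) (f : A -> C) (g : B -> D) :
  linear f -> linear g -> monoid_morphism f -> monoid_morphism g ->
  monoid_morphism (tmap f g).
Proof.
move=> lf lg [f1 fM] [g1 gM]; have [pl pr] := bilin_ptens C D.
apply: tens_lift_alghom => [||a b a' b']; last by rewrite fM gM ptensM.
  by split=> z c u v; rewrite (lf, lg) (pl, pr).
by rewrite f1 g1 ptens1.
Qed.

Lemma tassoc_alghom (A B C : falgType k) : monoid_morphism (@tassoc k A B C).
Proof.
have [pl pr] := bilin_ptens B C; have [ql qr] := bilin_ptens A (tens B C).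
have bt (c : C) : bilin (fun (a : A) (b : B) => a *t (b *t c)).
  by split=> z d u v /=; rewrite ?ql // pl qr.
apply: tens_lift_alghom => [||s c t c'].
- split=> z d u v /=; first by rewrite linearP.
  rewrite -tens_liftZ -tens_liftD; apply: eq_tens_lift => x y; by rewrite pr qr.
- by rewrite -[X in tens_lift _ X]ptens1 tens_liftE // !ptens1.
elim/tens_ind: s => [a b|d u v Hu Hv]; last first.
  by rewrite mulrDl -scalerAl !linearP /= mulrDl -scalerAl Hu Hv.
elim/tens_ind: t => [a' b'|d u v Hu Hv]; last first.
  by rewrite mulrDr -scalerAr !linearP /= mulrDr -scalerAr Hu Hv.
by rewrite ptensM !tens_liftE // !ptensM.
Qed.

End AlgHom.

Section TruncatedPoly.
Variables (k : fieldType) (N : nat).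

(* k[T]/(T^N) *)
Definition tpoly : Type := {poly %/ ('X^N : {poly k})}.
HB.instance Definition _ := GRing.UnitAlgebra.on tpoly.
HB.instance Definition _ := Vector.on tpoly.

Definition tvar : tpoly := in_qpoly 'X^N 'X.

Definition teval (B : falgType k) (t : B) (q : tpoly) : B :=
  horner_alg t (polyn q).

Fact teval_is_linear (B : falgType k) (t : B) : linear (teval t).
Proof.
move=> c u v; rewrite /teval [polyn _](_ : _ = c *: polyn u + polyn v) //.
by rewrite (linearP (horner_alg t)) /= mulr_algl.
Qed.
HB.instance Definition _ (B : falgType k) (t : B) :=
  GRing.isLinear.Build k tpoly B _ (teval t) (teval_is_linear t).

Lemma teval_in (B : falgType k) (t : B) (p : {poly k}) : (0 < N)%N -> t ^+ N = 0 ->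
  teval t (in_qpoly 'X^N p) = horner_alg t p.
Proof.
move=> N0 tN; rewrite /teval /=.
rewrite [in RHS](Pdiv.RingMonic.rdivp_eq (monic_mk_monic 'X^N) p).
by rewrite mk_monic_Xn prednK // rmorphD rmorphM rmorphXn /= horner_algX tN mulr0 add0r.
Qed.

Lemma teval_alghom (B : falgType k) (t : B) : (0 < N)%N -> t ^+ N = 0 ->
  monoid_morphism (teval t).
Proof.
move=> N0 tN; split.
  have -> : teval t 1 = horner_alg t 1 by [].
  exact: rmorph1.
move=> u v; rewrite -[u * v]/(in_qpoly 'X^N (polyn u * polyn v)) teval_in //.
by rewrite rmorphM.
Qed.

Lemma teval_var (B : falgType k) (t : B) : (0 < N)%N -> t ^+ N = 0 -> teval t tvar = t.
Proof. by move=> N0 tN; rewrite teval_in // horner_algX. Qed.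

Lemma alghom_tpolyE (B : falgType k) (f : tpoly -> B) p :
  linear f -> monoid_morphism f -> f (in_qpoly 'X^N p) = horner_alg (f tvar) p.
Proof.
move=> lf [f1 fM]; have fD u v : f (u + v) = f u + f v.
  by rewrite -[u]scale1r lf !scale1r.
have f0 : f 0 = 0 by have := fD 0 0; rewrite addr0 -[LHS]addr0 => /addrI.
have fZ c u : f (c *: u) = c *: f u by rewrite -[c *: u]addr0 lf f0 addr0.
elim/poly_ind: p => [|s c IH]; first by rewrite in_qpoly0 f0 rmorph0.
rewrite in_qpolyD in_qpolyM fD fM IH rmorphD rmorphM /= horner_algX horner_algC.
congr (_ + _); rewrite -alg_polyC in_qpolyZ.
by rewrite -[in RHS]f1 -fZ; congr (f (_ *: _)); exact: in_qpoly1.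
Qed.

Lemma tpoly_ext (B : falgType k) (f g : tpoly -> B) :
  linear f -> linear g -> monoid_morphism f -> monoid_morphism g ->
  f tvar = g tvar -> f =1 g.
Proof.
move=> lf lg mf mg fg q.
have -> : q = in_qpoly 'X^N (polyn q).
  by apply: val_inj; apply/esym/in_qpoly_small/size_mk_monic.
by rewrite (alghom_tpolyE _ lf mf) (alghom_tpolyE _ lg mg) fg.
Qed.

Lemma tvarN : (0 < N)%N -> tvar ^+ N = 0.
Proof.
move=> N0; rewrite -[LHS](rmorphXn (in_qpoly 'X^N)) /=; apply: val_inj => /=.
by rewrite mk_monic_Xn prednK // Pdiv.RingMonic.rmodpp ?monicXn.
Qed.

Definition teval_ahom (B : falgType k) (t : B) (N0 : (0 < N)%N) (tN : t ^+ N = 0) :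
  'AHom(tpoly, B).
Proof.
exists (linfun (teval t)); apply/ahomP_tmp.
have [f1 fM] := teval_alghom N0 tN.
by split=> [|u v]; rewrite !lfunE; [exact: f1 | exact: fM].
Defined.

Lemma teval_ahomE (B : falgType k) (t : B) (N0 : (0 < N)%N) (tN : t ^+ N = 0) q :
  teval_ahom N0 tN q = teval t q.
Proof. by rewrite lfunE. Qed.

End TruncatedPoly.

Section AdditiveKernel.
Variable k : fieldType.

(* The r-th Frobenius kernel of G_a: k[T]/(T^(p^r)) with T primitive. *)
Definition Ga_ker (p : nat) (charkp : p \in [pchar k]) (r : nat) : Type :=
  tpoly k (p ^ r).

Variables (p : nat) (charkp : p \in [pchar k]) (r : nat).
Local Notation N := (p ^ r)%N.
Local Notation G := (Ga_ker charkp r).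

HB.instance Definition _ := Falgebra.on G.

Let T : G := tvar k N.

Fact Ga_N_gt0 : (0 < N)%N.
Proof. by rewrite expn_gt0 prime_gt0 ?(pcharf_prime charkp). Qed.

Let TN : T ^+ N = 0. Proof. exact: tvarN Ga_N_gt0. Qed.

Fact expr_prim_pchar (B : falgType k) (x y : B) : GRing.comm x y ->
  x ^+ N = 0 -> y ^+ N = 0 -> (x + y) ^+ N = 0.
Proof.
move=> cxy xN yN; suff -> : (x + y) ^+ N = x ^+ N + y ^+ N by rewrite xN yN addr0.
have chB : p \in [pchar B] by rewrite pchar_lalg.
elim: r => // s IH; rewrite expnSr !exprM IH.
rewrite -!(pFrobenius_autE chB) pFrobenius_autD_comm //.
by apply: commrX; apply: commr_sym; apply: commrX; apply: commr_sym.
Qed.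

Lemma ptensX (A B : falgType k) (a : A) (b : B) n : (a *t b) ^+ n = (a ^+ n) *t (b ^+ n).
Proof. by elim: n => // n IH; rewrite !exprS IH ptensM. Qed.

Lemma ptens0l (A B : vectType k) (b : B) : (0 : A) *t b = 0.
Proof. by apply/matrixP => i j; rewrite !mxE linear0 mul0r. Qed.

Lemma ptens0r (A B : vectType k) (a : A) : a *t (0 : B) = 0.
Proof. by apply/matrixP => i j; rewrite !mxE linear0 mulr0. Qed.

Fact Ga_comul_nil : (T *t 1 + 1 *t T) ^+ N = 0 :> tens G G.
Proof.
by apply: expr_prim_pchar; rewrite /GRing.comm ?ptensM ?mul1r ?mulr1 // ptensX TN
  (ptens0l, ptens0r).
Qed.

Fact Ga_counit_nil : 0 ^+ N = 0 :> k^o.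
Proof. by rewrite expr0n eqn0Ngt Ga_N_gt0. Qed.

Fact Ga_antipode_nil : (- T) ^+ N = 0.
Proof. by rewrite exprNn TN mulr0. Qed.

Definition Ga_comul : 'AHom(G, tens G G) := teval_ahom Ga_N_gt0 Ga_comul_nil.
Definition Ga_counit : 'AHom(G, k^o) := teval_ahom Ga_N_gt0 Ga_counit_nil.
Definition Ga_antipode : 'AEnd(G) := teval_ahom Ga_N_gt0 Ga_antipode_nil.

Lemma ahom_lin (A B : falgType k) (f : 'AHom(A, B)) : linear f.
Proof. exact: linearP. Qed.
Lemma ahom_mon (A B : falgType k) (f : 'AHom(A, B)) : monoid_morphism f.
Proof. by split; [exact: rmorph1 | exact: rmorphM]. Qed.
Lemma id_lin (A : falgType k) : linear (@id A). Proof. by []. Qed.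
Lemma id_mon (A : falgType k) : monoid_morphism (@id A). Proof. by []. Qed.

Lemma Ga_comulT : Ga_comul T = T *t 1 + 1 *t T.
Proof. by rewrite teval_ahomE teval_var // (Ga_N_gt0, Ga_comul_nil). Qed.
Lemma Ga_counitT : Ga_counit T = 0.
Proof. by rewrite teval_ahomE teval_var // (Ga_N_gt0, Ga_counit_nil). Qed.
Lemma Ga_antipodeT : Ga_antipode T = - T.
Proof. by rewrite teval_ahomE teval_var // (Ga_N_gt0, Ga_antipode_nil). Qed.

Fact Ga_mulC : commutative (@GRing.mul G).
Proof. exact: (@qpoly_mulC k 'X^N). Qed.

Fact Ga_comulA (a : G) :
  tassoc (tmap Ga_comul id (Ga_comul a)) = tmap id Ga_comul (Ga_comul a).
Proof.
have lD := ahom_lin Ga_comul; have mD := ahom_mon Ga_comul.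
have li := @id_lin G; have mi := @id_mon G.
apply: (tpoly_ext (f := @tassoc _ G G G \o (tmap Ga_comul id \o Ga_comul))
                  (g := tmap id Ga_comul \o Ga_comul)) a.
- apply: linear_comp; first exact: tassoc_linear.
  by apply: linear_comp => //; exact: tmap_linear.
- by apply: linear_comp => //; exact: tmap_linear.
- apply: monoid_comp; first exact: tassoc_alghom.
  by apply: monoid_comp => //; exact: tmap_alghom.
- by apply: monoid_comp => //; exact: tmap_alghom.
rewrite /= Ga_comulT !(lin_add _ _ (tmap_linear _ _)).
rewrite !tmapE // !Ga_comulT (mD.1).
have [pl _] := bilin_ptens (tens G G) G; have [_ pr] := bilin_ptens G (tens G G).
rewrite (lin_add _ _ (pl _)) (lin_add _ _ (pr _)).
rewrite !(lin_add _ _ (@tassoc_linear _ G G G)).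
have e1 : (1 : tens G G) = 1 *t 1 by [].
by rewrite e1 !tassocE addrA.
Qed.

Fact Ga_counitl (a : G) :
  tens_lift (fun x y => Ga_counit x *: y) (Ga_comul a) = a.
Proof.
have lD := ahom_lin Ga_comul; have mD := ahom_mon Ga_comul.
have le := ahom_lin Ga_counit; have [e1 eM] := ahom_mon Ga_counit.
have bf : bilin (fun x y : G => Ga_counit x *: y).
  split=> z c u v; first by rewrite le scalerDl scalerA.
  by rewrite scalerDr !scalerA mulrC.
apply: (tpoly_ext (f := tens_lift _ \o Ga_comul) (g := id)) a => //.
- by apply: linear_comp => //; exact: linearP.
- apply: monoid_comp => //; apply: tens_lift_alghom => //.
    by rewrite e1 scale1r.
  by move=> a b a' b'; rewrite eM -scalerAl -scalerAr scalerA.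
rewrite /= Ga_comulT (lin_add _ _ (tens_lift_is_linear _)) !tens_liftE // e1 scale1r.
by rewrite Ga_counitT scale0r add0r.
Qed.

Fact Ga_counitr (a : G) :
  tens_lift (fun x y => Ga_counit y *: x) (Ga_comul a) = a.
Proof.
have lD := ahom_lin Ga_comul; have mD := ahom_mon Ga_comul.
have le := ahom_lin Ga_counit; have [e1 eM] := ahom_mon Ga_counit.
have bf : bilin (fun x y : G => Ga_counit y *: x).
  split=> z c u v; last by rewrite le scalerDl scalerA.
  by rewrite scalerDr !scalerA mulrC.
apply: (tpoly_ext (f := tens_lift _ \o Ga_comul) (g := id)) a => //.
- by apply: linear_comp => //; exact: linearP.
- apply: monoid_comp => //; apply: tens_lift_alghom => //.
    by rewrite e1 scale1r.
  by move=> a b a' b'; rewrite eM -scalerAl -scalerAr scalerA.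
rewrite /= Ga_comulT (lin_add _ _ (tens_lift_is_linear _)) !tens_liftE // e1 scale1r.
by rewrite Ga_counitT scale0r addr0.
Qed.

Fact Ga_antipodel (a : G) :
  tens_lift (fun x y => Ga_antipode x * y) (Ga_comul a) = Ga_counit a *: 1.
Proof.
have lD := ahom_lin Ga_comul; have mD := ahom_mon Ga_comul.
have lS := ahom_lin Ga_antipode; have [S1 SM] := ahom_mon Ga_antipode.
have le := ahom_lin Ga_counit; have [e1 eM] := ahom_mon Ga_counit.
have bf : bilin (fun x y : G => Ga_antipode x * y).
  split=> z c u v; first by rewrite lS mulrDl -scalerAl.
  by rewrite mulrDr -scalerAr.
apply: (tpoly_ext (f := tens_lift _ \o Ga_comul) (g := fun a => Ga_counit a *: 1)) a.
- by apply: linear_comp => //; exact: linearP.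
- by move=> c u v; rewrite le scalerDl scalerA.
- apply: monoid_comp => //; apply: tens_lift_alghom => //.
    by rewrite S1 mulr1.
  move=> a b a' b'; rewrite SM -!mulrA; congr (_ * _).
  by rewrite !mulrA; congr (_ * _); exact: Ga_mulC.
- split=> [|u v]; first by rewrite e1 scale1r.
  by rewrite eM -scalerAl mul1r scalerA.
rewrite /= Ga_comulT (lin_add _ _ (tens_lift_is_linear _)) !tens_liftE // S1 mulr1 mul1r.
by rewrite Ga_counitT scale0r Ga_antipodeT addNr.
Qed.

Fact Ga_antipoder (a : G) :
  tens_lift (fun x y => x * Ga_antipode y) (Ga_comul a) = Ga_counit a *: 1.
Proof.
have lD := ahom_lin Ga_comul; have mD := ahom_mon Ga_comul.
have lS := ahom_lin Ga_antipode; have [S1 SM] := ahom_mon Ga_antipode.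
have le := ahom_lin Ga_counit; have [e1 eM] := ahom_mon Ga_counit.
have bf : bilin (fun x y : G => x * Ga_antipode y).
  split=> z c u v; first by rewrite mulrDl -scalerAl.
  by rewrite lS mulrDr -scalerAr.
apply: (tpoly_ext (f := tens_lift _ \o Ga_comul) (g := fun a => Ga_counit a *: 1)) a.
- by apply: linear_comp => //; exact: linearP.
- by move=> c u v; rewrite le scalerDl scalerA.
- apply: monoid_comp => //; apply: tens_lift_alghom => //.
    by rewrite S1 mulr1.
  move=> a b a' b'; rewrite SM -!mulrA; congr (_ * _).
  by rewrite !mulrA; congr (_ * _); exact: Ga_mulC.
- split=> [|u v]; first by rewrite e1 scale1r.
  by rewrite eM -scalerAl mul1r scalerA.
rewrite /= Ga_comulT (lin_add _ _ (tens_lift_is_linear _)) !tens_liftE // S1 mulr1 mul1r.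
by rewrite Ga_counitT scale0r Ga_antipodeT subrr.
Qed.

HB.instance Definition _ := Falgebra_isGroupScheme.Build k G
  Ga_mulC Ga_comulA Ga_counitl Ga_counitr Ga_antipodel Ga_antipoder.

End AdditiveKernel.

Section ConstantGroup.
Variables (k : fieldType) (gT : finGroupType).

(* The constant group scheme of gT: functions on gT, (comul f)(g, h) = f (g h). *)
Definition constGS : Type := {ffun gT -> k^o}.
HB.instance Definition _ := Vector.copy constGS {ffun gT -> k^o}.

Local Notation F := constGS.
Definition cval (f : F) : gT -> k := fun_of_fin f.
Definition cfun (f : gT -> k) : F := [ffun g => f g].

Lemma cvalE f g : cval (cfun f) g = f g. Proof. exact: ffunE. Qed.
Lemma cext (f f' : F) : cval f =1 cval f' -> f = f'.
Proof. by move=> e; apply/ffunP. Qed.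
Lemma cvalD f f' g : cval (f + f') g = cval f g + cval f' g.
Proof. exact: ffunE. Qed.
Lemma cvalZ c f g : cval (c *: f) g = c * cval f g.
Proof. exact: ffunE. Qed.
Lemma cval0 g : cval 0 g = 0.
Proof. exact: ffunE. Qed.

Definition cmul (f f' : F) : F := cfun (fun g => cval f g * cval f' g).
Definition cone : F := cfun (fun=> 1).

Lemma cmulE f f' g : cval (cmul f f') g = cval f g * cval f' g.
Proof. exact: cvalE. Qed.

Fact cmulA : associative cmul.
Proof. by move=> f f' f''; apply: cext => g; rewrite !cvalE mulrA. Qed.
Fact cmulC : commutative cmul.
Proof. by move=> f f'; apply: cext => g; rewrite !cvalE mulrC. Qed.
Fact cmul1l : left_id cone cmul.
Proof. by move=> f; apply: cext => g; rewrite !cvalE mul1r. Qed.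
Fact cmul1r : right_id cone cmul.
Proof. by move=> f; apply: cext => g; rewrite !cvalE mulr1. Qed.
Fact cmulDl : left_distributive cmul +%R.
Proof. by move=> f f' f''; apply: cext => g; rewrite cvalD !cmulE cvalD mulrDl. Qed.
Fact cmulDr : right_distributive cmul +%R.
Proof. by move=> f f' f''; apply: cext => g; rewrite cvalD !cmulE cvalD mulrDr. Qed.
Fact cone_neq0 : cone != 0.
Proof.
apply/eqP => /(congr1 (fun f => cval f 1%g)); rewrite cvalE cval0 => /eqP.
by rewrite oner_eq0.
Qed.
HB.instance Definition _ := GRing.Zmodule_isNzRing.Build F
  cmulA cmul1l cmul1r cmulDl cmulDr cone_neq0.
Fact cscaleAl (c : k) (f f' : F) : c *: (f * f') = (c *: f) * f'.
Proof. by apply: cext => g; rewrite cvalZ !cmulE cvalZ mulrA. Qed.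
Fact cscaleAr (c : k) (f f' : F) : c *: (f * f') = f * (c *: f').
Proof. by apply: cext => g; rewrite cvalZ !cmulE cvalZ mulrCA. Qed.
HB.instance Definition _ := GRing.Lmodule_isLalgebra.Build k F cscaleAl.
HB.instance Definition _ := GRing.Lalgebra_isAlgebra.Build k F cscaleAr.
HB.instance Definition _ := Algebra_isFalgebra.Build k F.

Lemma cvalM (f f' : F) g : cval (f * f') g = cval f g * cval f' g.
Proof. exact: cvalE. Qed.
Lemma cval1 g : cval 1 g = 1.
Proof. exact: cvalE. Qed.
Lemma cval_sum I (s : seq I) (f : I -> F) g :
  cval (\sum_(i <- s) f i) g = \sum_(i <- s) cval (f i) g.
Proof.
by elim: s => [|i s IH]; rewrite ?big_nil ?cval0 // !big_cons cvalD IH.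
Qed.

Definition cdelta (g : gT) : F := cfun (fun h => (h == g)%:R).

Lemma cdelta_sum f : f = \sum_g cval f g *: cdelta g.
Proof.
apply: cext => g; rewrite cval_sum (bigD1 g) //= cvalZ cvalE eqxx mulr1.
by rewrite big1 ?addr0 // => h /negPf hg; rewrite cvalZ cvalE eq_sym hg mulr0.
Qed.

Lemma cdeltaM g h : cdelta g * cdelta h = (g == h)%:R *: cdelta g.
Proof.
apply: cext => x; rewrite cvalM cvalZ !cvalE -!natrM !mulnb.
by case: (x =P g) => [->|_]; rewrite ?andbT ?andbF.
Qed.

Definition ccomul_fun (f : F) : tens F F :=
  \sum_g \sum_h cval f (g * h)%g *: (cdelta g *t cdelta h).

Definition ccounit_fun (f : F) : k^o := cval f 1%g.

Definition cantipode_fun (f : F) : F := cfun (fun g => cval f g^-1%g).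

Lemma cantipode_funE f g : cval (cantipode_fun f) g = cval f g^-1%g.
Proof. exact: cvalE. Qed.

Fact ccomul_is_linear : linear ccomul_fun.
Proof.
move=> c u v; rewrite /ccomul_fun scaler_sumr -big_split; apply: eq_bigr => g _.
rewrite scaler_sumr -big_split; apply: eq_bigr => h _.
by rewrite cvalD cvalZ scalerDl scalerA.
Qed.
HB.instance Definition _ :=
  GRing.isLinear.Build k F (tens F F) _ ccomul_fun ccomul_is_linear.

Fact ccounit_is_linear : linear ccounit_fun.
Proof. by move=> c u v; rewrite /ccounit_fun cvalD cvalZ. Qed.
HB.instance Definition _ :=
  GRing.isLinear.Build k F k^o _ ccounit_fun ccounit_is_linear.

Fact cantipode_is_linear : linear cantipode_fun.
Proof. by move=> c u v; apply: cext => g; rewrite cvalD cvalZ !cantipode_funE cvalD cvalZ. Qed.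
HB.instance Definition _ :=
  GRing.isLinear.Build k F F _ cantipode_fun cantipode_is_linear.

(* Evaluation of a tensor, seen as a function on gT x gT. *)
Definition ev2 g h (t : tens F F) : k^o :=
  tens_lift (fun a b : F => cval a g * cval b h : k^o) t.

Fact bilin_ev2 g h : bilin (fun a b : F => cval a g * cval b h : k^o).
Proof.
split=> [z|z] c u v; rewrite cvalD cvalZ.
  by rewrite mulrDl -mulrA.
by rewrite mulrDr mulrCA.
Qed.

Lemma ev2E g h a b : ev2 g h (a *t b) = cval a g * cval b h.
Proof. exact: tens_liftE (bilin_ev2 g h). Qed.

Lemma ev2_linear g h : linear (ev2 g h).
Proof. exact: tens_lift_is_linear. Qed.

Lemma ev2_sum (t : tens F F) : t = \sum_g \sum_h ev2 g h t *: (cdelta g *t cdelta h).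
Proof.
elim/tens_ind: t => [a b|c u v Hu Hv].
  have [pl pr] := bilin_ptens F F.
  rewrite {1}[a]cdelta_sum (lin_sum _ _ _ (pl b)); apply: eq_bigr => g _.
  rewrite {1}[b]cdelta_sum (lin_sum _ _ _ (pr _)) scaler_sumr; apply: eq_bigr => h _.
  by rewrite scalerA ev2E.
rewrite {1}Hu {1}Hv scaler_sumr -big_split; apply: eq_bigr => g _.
rewrite scaler_sumr -big_split; apply: eq_bigr => h _.
by rewrite ev2_linear scalerDl scalerA.
Qed.

Lemma ev2_ext (s t : tens F F) : (forall g h, ev2 g h s = ev2 g h t) -> s = t.
Proof.
by move=> e; rewrite (ev2_sum s) (ev2_sum t); do 2!apply: eq_bigr => ? _; rewrite e.
Qed.

Lemma ev2_comul g h f : ev2 g h (ccomul_fun f) = cval f (g * h)%g.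
Proof.
have le := ev2_linear g h.
rewrite /ccomul_fun (lin_sum1 _ _ le) (bigD1 g) //= (lin_sum _ _ _ le).
rewrite (bigD1 h) //= ev2E !cvalE !eqxx mulr1 [_ *: 1]mulr1.
rewrite !big1 ?addr0 // => [g' /negPf ng|h' /negPf nh].
  rewrite (lin_sum _ _ _ le) big1 // => h' _.
  by rewrite ev2E !cvalE [g == _]eq_sym ng mul0r scaler0.
by rewrite ev2E !cvalE [h == _]eq_sym nh mulr0 scaler0.
Qed.

Lemma ev2_mon g h : monoid_morphism (ev2 g h).
Proof.
apply: tens_lift_alghom; first exact: bilin_ev2.
  by rewrite !cval1 mulr1.
by move=> a b a' b'; rewrite !cvalM mulrACA.
Qed.

Fact ccomul_mon : monoid_morphism ccomul_fun.
Proof.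
split=> [|u v]; apply: ev2_ext => g h; have [e1 eM] := ev2_mon g h.
  by rewrite ev2_comul e1 cval1.
by rewrite eM !ev2_comul cvalM.
Qed.

Fact ccounit_mon : monoid_morphism ccounit_fun.
Proof. by split=> [|u v]; rewrite /ccounit_fun (cval1, cvalM). Qed.

Fact cantipode_mon : monoid_morphism cantipode_fun.
Proof.
split=> [|u v]; apply: cext => g; first by rewrite cantipode_funE !cval1.
by rewrite cvalM !cantipode_funE cvalM.
Qed.

Definition mk_ahom (A B : falgType k) (f : {linear A -> B}) (fm : monoid_morphism f) :
  'AHom(A, B).
Proof.
exists (linfun f); apply/ahomP_tmp; have [f1 fM] := fm.
by split=> [|u v]; rewrite !lfunE; [exact: f1 | exact: fM].
Defined.

Definition ccomul : 'AHom(F, tens F F) := mk_ahom ccomul_mon.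
Definition ccounit : 'AHom(F, k^o) := mk_ahom ccounit_mon.
Definition cantipode : 'AEnd(F) := mk_ahom cantipode_mon.

Lemma ccomulE f : ccomul f = ccomul_fun f. Proof. exact: lfunE. Qed.
Lemma ccounitE f : ccounit f = cval f 1%g. Proof. exact: lfunE. Qed.
Lemma cantipodeE f g : cval (cantipode f) g = cval f g^-1%g.
Proof. by rewrite lfunE cantipode_funE. Qed.

Lemma comul_delta x : ccomul (cdelta x) = 
  \sum_g cdelta g *t cdelta (g^-1 * x)%g.
Proof.
rewrite ccomulE; apply: eq_bigr => g _; rewrite (bigD1 (g^-1 * x)%g) //=.
rewrite cvalE mulKVg eqxx scale1r big1 ?addr0 // => h nh.
rewrite cvalE; case: eqP => [e|_]; last by rewrite scale0r.
by rewrite -e mulKg eqxx in nh.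
Qed.

Lemma comul_lift (V : vectType k) (q : F -> F -> V) f : bilin q ->
  tens_lift q (ccomul f) = \sum_g \sum_h cval f (g * h)%g *: q (cdelta g) (cdelta h).
Proof.
move=> qb; have lq := tens_lift_is_linear q.
rewrite ccomulE (lin_sum1 _ _ lq); apply: eq_bigr => g _.
by rewrite (lin_sum _ _ _ lq); apply: eq_bigr => h _; rewrite tens_liftE.
Qed.

Lemma cdelta_one : \sum_g cdelta g = 1.
Proof.
by rewrite [RHS]cdelta_sum; apply: eq_bigr => g _; rewrite cval1 scale1r.
Qed.

Fact ccomulA (f : F) :
  tassoc (tmap ccomul id (ccomul f)) = tmap id ccomul (ccomul f).
Proof.
have lD := ahom_lin ccomul; have li := @id_lin _ F.
have [pl pr] := bilin_ptens F F.
have [pl' pr'] := bilin_ptens (tens F F) F; have [ql qr] := bilin_ptens F (tens F F).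
have la := @tassoc_linear k F F F.
have b1 : bilin (fun a b : F => ccomul a *t b).
  by split=> z c u v; rewrite ?lD ?pl' ?pr'.
have b2 : bilin (fun a b : F => a *t ccomul b).
  by split=> z c u v; rewrite ?lD ?ql ?qr.
rewrite /tmap !comul_lift // (lin_sum1 _ _ la).
transitivity (\sum_g \sum_x \sum_h
    cval f (x * h)%g *: (cdelta g *t (cdelta (g^-1 * x)%g *t cdelta h))).
  rewrite [RHS]exchange_big; apply: eq_bigr => x _; rewrite [RHS]exchange_big.
  rewrite (lin_sum _ _ _ la); apply: eq_bigr => h _.
  rewrite comul_delta (lin_sum1 _ _ (pl' _)) (lin_sum1 _ _ la) scaler_sumr.
  by apply: eq_bigr => g _; rewrite tassocE.
apply: eq_bigr => g _.
rewrite (reindex_inj (mulgI g)) /=.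
under eq_bigr => x _ do under eq_bigr => h _ do rewrite mulKg -mulgA.
transitivity (\sum_x \sum_y
    cval f (g * y)%g *: (cdelta g *t (cdelta x *t cdelta (x^-1 * y)%g))).
  apply: eq_bigr => x _; rewrite [RHS](reindex_inj (mulgI x)) /=.
  by apply: eq_bigr => h _; rewrite mulKg.
rewrite exchange_big; apply: eq_bigr => y _.
by rewrite comul_delta (lin_sum1 _ _ (qr _)) scaler_sumr.
Qed.

Fact ccounitl (f : F) :
  tens_lift (fun x y => ccounit x *: y) (ccomul f) = f.
Proof.
have le := ahom_lin ccounit.
rewrite comul_lift; last first.
  split=> z c u v; first by rewrite le scalerDl scalerA.
  by rewrite scalerDr !scalerA mulrC.
rewrite (bigD1 1%g) //= [X in _ + X]big1 ?addr0 => [|g ng].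
  rewrite [RHS]cdelta_sum; apply: eq_bigr => h _.
  by rewrite mul1g ccounitE cvalE eqxx scale1r.
by rewrite big1 // => h _; rewrite ccounitE cvalE eq_sym (negPf ng) scale0r scaler0.
Qed.

Fact ccounitr (f : F) :
  tens_lift (fun x y => ccounit y *: x) (ccomul f) = f.
Proof.
have le := ahom_lin ccounit.
rewrite comul_lift; last first.
  split=> z c u v; last by rewrite le scalerDl scalerA.
  by rewrite scalerDr !scalerA mulrC.
rewrite [RHS]cdelta_sum; apply: eq_bigr => g _.
rewrite (bigD1 1%g) //= [X in _ + X]big1 ?addr0 => [|h nh].
  by rewrite mulg1 ccounitE cvalE eqxx scale1r.
by rewrite ccounitE cvalE eq_sym (negPf nh) scale0r scaler0.
Qed.

Lemma cantipode_delta g : cantipode (cdelta g) = cdelta g^-1%g.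
Proof. by apply: cext => h; rewrite cantipodeE !cvalE -(can2_eq invgK invgK). Qed.

Fact cantipodel (f : F) :
  tens_lift (fun x y => cantipode x * y) (ccomul f) = ccounit f *: 1.
Proof.
have lS := ahom_lin cantipode.
rewrite comul_lift; last first.
  split=> z c u v; first by rewrite lS mulrDl -scalerAl.
  by rewrite mulrDr -scalerAr.
rewrite -cdelta_one scaler_sumr (reindex_inj invg_inj) /=; apply: eq_bigr => g _.
rewrite cantipode_delta invgK (bigD1 g) //= big1 ?addr0 => [|h nh].
  by rewrite mulVg cdeltaM eqxx scale1r ccounitE.
by rewrite cdeltaM eq_sym (negPf nh) scale0r scaler0.
Qed.

Fact cantipoder (f : F) :
  tens_lift (fun x y => x * cantipode y) (ccomul f) = ccounit f *: 1.
Proof.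
have lS := ahom_lin cantipode.
rewrite comul_lift; last first.
  split=> z c u v; first by rewrite mulrDl -scalerAl.
  by rewrite lS mulrDr -scalerAr.
rewrite -cdelta_one scaler_sumr; apply: eq_bigr => g _.
rewrite (bigD1 g^-1%g) //= big1 ?addr0 => [|h nh].
  by rewrite mulgV cantipode_delta invgK cdeltaM eqxx scale1r ccounitE.
rewrite cantipode_delta cdeltaM; case: eqP => [e|_]; last by rewrite scale0r scaler0.
by rewrite e invgK eqxx in nh.
Qed.

Fact const_mulC : commutative (@GRing.mul F).
Proof. exact: cmulC. Qed.

HB.instance Definition _ := Falgebra_isGroupScheme.Build k F
  const_mulC ccomulA ccounitl ccounitr cantipodel cantipoder.

End ConstantGroup.

Section GroupSchemes.
Variable k : fieldType.
Implicit Types G H : finGroupScheme k.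

(* f : k[G] -> k[H] is the comorphism of a group homomorphism H -> G. *)
Definition is_gs_hom G H (f : 'AHom(G, H)) : Prop :=
  (forall a : G, comul (f a) = tmap f f (comul a)) /\
  (forall a : G, counit (f a) = counit a).

Definition gs_iso G H : Prop :=
  exists f : 'AHom(G, H), is_gs_hom f /\ bijective f.

(* Subgroup schemes as closed immersions sub_gs -> G, on coordinate rings. *)
Record subgroupScheme G := SubgroupScheme {
  sub_gs : finGroupScheme k;
  sub_res : 'AHom(G, sub_gs);
  sub_res_hom : is_gs_hom sub_res;
  sub_res_surj : limg sub_res = fullv
}.

(* The ideal of the scheme-theoretic image of X x Y under multiplication, for
   closed subschemes X, Y with ideals I, J: the kernel of
   k[G] -> k[G] (x) k[G] -> k[G]/I (x) k[G]/J. *)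
Definition mul_ideal G (I J : {vspace G}) : {vspace G} :=
  (comul @^-1: (tensv I fullv + tensv fullv J))%VS.

(* The ideal of the product E_1 ... E_n of subgroup schemes; the empty product
   is the trivial subgroup, with ideal lker counit. *)
Definition prod_ideal G (E : seq (subgroupScheme G)) : {vspace G} :=
  foldr (fun X J => mul_ideal (lker (sub_res X)) J) (lker counit) E.

Definition abelian_gs G : Prop := forall a : G, tswap (comul a) = comul a.

(* The product has at least one factor and r is positive, so the trivial group
   scheme is not elementary abelian. *)
Definition elementary_abelian_gs (p : nat) (charkp : p \in [pchar k]) G : Prop :=
  abelian_gs G /\
  exists (n : nat) (E : 'I_n.+1 -> subgroupScheme G),
    prod_ideal [seq E i | i <- enum 'I_n.+1] = 0%VS /\
    forall i, (exists r : nat, (0 < r)%N /\ gs_iso (sub_gs (E i)) (Ga_ker charkp r)) \/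
              gs_iso (sub_gs (E i)) (constGS k 'Z_p).

Definition left_ideal (A : falgType k) (M : {vspace A}) : Prop :=
  forall a x : A, x \in M -> a * x \in M.

Definition maximal_left_ideal (A : falgType k) (M : {vspace A}) : Prop :=
  [/\ left_ideal M, M <> fullv &
      forall N : {vspace A}, left_ideal N -> (M <= N)%VS -> N = M \/ N = fullv].

Definition local_algebra (A : falgType k) : Prop :=
  exists! M : {vspace A}, maximal_left_ideal M.

Definition unipotent_gs G : Prop := local_algebra (groupAlg G).

End GroupSchemes.

(* Main.v *)
From HB Require Import structures.
From Stdlib Require Import Classical_Prop.
Require Import Defs.
From mathcomp Require Import all_boot all_order all_fingroup all_algebra all_field.
From mathcomp Require Import ring zify.

Set Implicit Arguments.
Unset Strict Implicit.
Unset Printing Implicit Defensive.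

Import GRing.Theory.
Local Open Scope ring_scope.

(** Write O for k[U], A for kU = O^*, eps : A -> k for evaluation at 1 : O and
    J for the kernel of eps. As U is unipotent, every proper left ideal of A
    lies in J, and J is nilpotent. The algebra O acts on A by
    (o . a)(x) = a(o x), and eps(o . a) = a(o). A primitive element v of O, that
    is one with comul v = v (x) 1 + 1 (x) v, acts as a derivation. The primitive
    elements form the dual P of J/J^2, so every linear form on J/J^2 is
    eps o d for some derivation d of A ([gaug_translation]). The group structure
    enters through this action and through invariant integrals.

    Suppose that H^1(A, A) is simple. If M is a two-sided ideal of A inside J
    that every derivation preserves, then the derivations that are inner modulo M
    form a Lie ideal; it misses the derivations with eps o d <> 0, so it
    consists of inner derivations. Hence a derivation with values in M is inner
    ([simple_der_inner]).

    - A is commutative ([simple_mulC]). Otherwise the ideal generated by the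
      commutators contains some t <> 0 with J t = 0. A nonzero integral lam in O
      gives a nondegenerate form (a, b) |-> (a b)(lam), which is symmetric because
      A is local: its Nakayama automorphism commutes with the action of O and
      preserves eps ([integral_trace]). So t is also killed by J on the right and
      t(lam) <> 0. For a form f on J/J^2, the map x |-> f(x) t is a derivation
      into the commutator ideal, hence inner; then its values vanish at lam,
      as commutators do, a contradiction.
    - A has no ideals stable under derivations except 0 and A
      ([simple_dsimple]): with M as above, m in M and d a derivation with
      d x invertible, m d is inner, hence 0, so m = 0. The ideal A a^p is
      stable, so a^p = 0 for a in J ([dsimple_pth_power]). The annihilator in A
      of the subalgebra of O generated by P also generates a stable ideal,
      so P generates O ([dsimple_prim_generated]).
    - The last two properties, with J <> 0, make U elementary abelian
      ([prim_generated_elementary]). Let B be a maximal product of group algebras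
      kE_i, the E_i being subgroup schemes of the two allowed kinds. If B <> A,
      the primitive elements that vanish on B form a nonzero subspace of P
      closed under p-th powers. If it has a non-nilpotent element v, an
      algebra map g : O -> k with g(v) <> 0 satisfies g^p = 1 and defines a
      subgroup scheme Z/(p) on which v does not vanish ([Zp_quotient]).
      Otherwise it has an element v <> 0 with v^p = 0, and
      then v = u^(p^j) with j maximal, and u is the coordinate of a subgroup
      scheme G_a(j+1) on which v does not vanish ([Ga_quotient]). In both cases
      B can be enlarged.

    Conversely let U be elementary abelian. The ideal of a product of subgroup
    schemes is the annihilator of the product of their group algebras
    ([prod_ideal0P]), so A is the product of the kE_i. Therefore A is commutative and
    a^p = eps(a)^p ([elementary_abelian_pth]). The dimension of A is then
    at most p^n for n = dim J/J^2, and this makes A differentiably simple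
    ([pth_power_dsimple]); for p > 2 the derivations of a differentiably
    simple commutative local algebra form a simple Lie algebra by an argument of
    Jordan ([dsimple_simple]). *)

(** * Subspaces and linear forms *)

Section LinearAlgebra.
Variables (k : fieldType) (V : vectType k).

Lemma minimal_vspace (Q : {vspace V} -> Prop) (W0 : {vspace V}) : Q W0 ->
  exists W, [/\ (W <= W0)%VS, Q W & forall W', Q W' -> (W' <= W)%VS -> W' = W].
Proof.
have [n] := ubnP (\dim W0); elim: n W0 => // n IH W0 /ltnSE-dW QW0.
have [[W [QW sW nW]]|no] := classic (exists W, [/\ Q W, (W <= W0)%VS & W <> W0]).
  have ltd : (\dim W < n)%N.
    apply: leq_trans dW; rewrite ltn_neqAle dimvS // andbT.
    by apply/eqP => e; apply: nW; apply/eqP; rewrite eqEdim sW e leqnn.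
  have [X [sX QX mX]] := IH W ltd QW.
  by exists X; split=> //; apply: subv_trans sX sW.
exists W0; split=> // W' QW' sW'; apply: NNPP => nW.
by apply: no; exists W'.
Qed.

Lemma maximal_vspace (Q : {vspace V} -> Prop) (W0 : {vspace V}) : Q W0 ->
  exists W, [/\ (W0 <= W)%VS, Q W & forall W', Q W' -> (W <= W')%VS -> W' = W].
Proof.
have [n] := ubnP (\dim {:V} - \dim W0); elim: n W0 => // n IH W0 /ltnSE-dW QW0.
have [[W [QW sW nW]]|no] := classic (exists W, [/\ Q W, (W0 <= W)%VS & W <> W0]).
  have ltd : (\dim {:V} - \dim W < n)%N.
    apply: leq_trans dW; apply: ltn_sub2l.
      apply: leq_trans (dimvS (subvf W)); rewrite ltn_neqAle dimvS // andbT.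
      by apply/eqP => e; apply: nW; apply/esym/eqP; rewrite eqEdim sW e leqnn.
    rewrite ltn_neqAle dimvS // andbT.
    by apply/eqP => e; apply: nW; apply/esym/eqP; rewrite eqEdim sW e leqnn.
  have [X [sX QX mX]] := IH W ltd QW.
  by exists X; split=> //; apply: subv_trans sW sX.
exists W0; split=> // W' QW' sW'; apply: NNPP => nW.
by apply: no; exists W'.
Qed.

Lemma vspace_of_pred (Q : V -> Prop) : Q 0 ->
    (forall c u v, Q u -> Q v -> Q (c *: u + v)) ->
  exists W : {vspace V}, forall x, x \in W <-> Q x.
Proof.
move=> Q0 Ql.
have [|W [_ sW mW]] := @maximal_vspace (fun W => forall x, x \in W -> Q x) 0%VS.
  by move=> x; rewrite memv0 => /eqP ->.
exists W => x; split=> [|Qx]; first exact: sW.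
have <- : (W + <[x]>)%VS = W; last by apply: (subvP (addvSr _ _)); exact: memv_line.
apply: mW; last exact: addvSl.
move=> y /memv_addP[w ww [u /vlineP[c ->] ->]]; rewrite addrC.
by apply: Ql => //; apply: sW.
Qed.

Lemma functional_sep (W : {vspace V}) (x : V) : x \notin W ->
  exists f : 'Hom(V, k^o), f x = 1 /\ forall w, w \in W -> f w = 0.
Proof.
move=> nxW; have py : x - projv W x != 0.
  by apply: contra nxW; rewrite subr_eq0 => /eqP ->; exact: memv_proj.
have [i ni] : exists i, coord (vbasis {:V}) i (x - projv W x) != 0.
  apply/existsP; apply: contraR py; rewrite negb_exists => /forallP n0.
  rewrite (coord_vbasis (memvf (x - _))) big1 // => i _.
  by move/negPn/eqP: (n0 i) => ->; rewrite scale0r.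
set c := coord _ _ _ in ni.
pose f0 (v : V) : k^o := c^-1 * coord (vbasis {:V}) i (v - projv W v).
have lf : linear f0.
  move=> a u v; rewrite /f0 linearP /= opprD addrACA -scalerBr linearP /=.
  by rewrite mulrDr mulrCA.
pose g := GRing.isLinear.Build k V k^o _ f0 lf.
pose F0 : {linear V -> k^o} := HB.pack f0 g.
exists (linfun F0); split=> [|w wW]; rewrite lfunE /= /f0; first by rewrite mulVf.
by rewrite projv_id // subrr linear0 mulr0.
Qed.

Lemma mk_lfun (W : vectType k) (f : V -> W) : linear f ->
  exists F : 'Hom(V, W), forall x, F x = f x.
Proof.
move=> lf; pose g := GRing.isLinear.Build k V W _ f lf.
pose F0 : {linear V -> W} := HB.pack f g.
by exists (linfun F0) => x; rewrite lfunE.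
Qed.

End LinearAlgebra.

Section Spans.
Variables (k : fieldType) (V : vectType k).

(** An inductive span, so that properties of an infinite generating family pass
    to its span by induction. *)
Inductive lspan (Q : V -> Prop) : V -> Prop :=
| lspan_gen x : Q x -> lspan Q x
| lspan0 : lspan Q 0
| lspanD c x y : lspan Q x -> lspan Q y -> lspan Q (c *: x + y).

Lemma lspan_vspace (Q : V -> Prop) :
  exists W : {vspace V}, forall x, x \in W <-> lspan Q x.
Proof. by apply: vspace_of_pred; [exact: lspan0 | move=> c u v; exact: lspanD]. Qed.

Lemma generated_left_ideal (A : falgType k) (C : {vspace A}) :
  left_ideal (fullv * C)%VS.
Proof.
move=> a x xC; have := memv_mul (memvf a) xC; rewrite prodvA.
by apply/subvP/prodvSl/subvf.
Qed.

End Spans.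

(** * Ideals of a quotient Lie algebra *)

Section SimpleQuotient.
Variables (k : fieldType) (L : lieAlgType k) (I : lieIdeal L).

Lemma mem_lqproj x : (lqproj I x == 0) = (x \in lie_ideal_space I).
Proof.
have -> : 0 = lqproj I 0 by apply/esym; apply: (linear0 (qproj I)).
by rewrite /lqproj qproj_eq subr0.
Qed.

Lemma lie_ideal_img (K : lieIdeal L) : (I <= K)%VS ->
  exists K' : lieIdeal (lieQuot I), forall x, (lqproj I x \in lie_ideal_space K') = (x \in lie_ideal_space K).
Proof.
move=> IK; have [f fE] := mk_lfun (@lqproj_linear k L I).
pose W := (f @: K)%VS.
have memW x : (lqproj I x \in W) = (x \in lie_ideal_space K).
  apply/idP/idP => [/memv_imgP[y yK]|xK]; last by rewrite -fE memv_img.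
  rewrite fE => /eqP; rewrite /lqproj qproj_eq => xy.
  by rewrite -(subrK y x) memvD // (subvP IK).
have WP (x y : lieQuot I) : y \in W -> lieb x y \in W.
  rewrite -[x]lqreprK -[y]lqreprK [lieb _ _]lqproj_lieb !memW.
  exact: lie_idealP.
by exists (LieIdeal WP).
Qed.

Lemma lie_ideal_preim (K : lieIdeal (lieQuot I)) :
  exists K' : lieIdeal L, (I <= K')%VS /\
     forall x, (x \in lie_ideal_space K') = (lqproj I x \in lie_ideal_space K).
Proof.
have [f fE] := mk_lfun (@lqproj_linear k L I).
pose W := (f @^-1: K)%VS.
have memW x : (x \in W) = (lqproj I x \in lie_ideal_space K).
  by rewrite -memv_preim fE.
have WP x y : y \in W -> lieb x y \in W.
  by rewrite !memW -lqproj_lieb; apply: lie_idealP.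
exists (LieIdeal WP); split=> //; apply/subvP => x xI; rewrite memW.
by move: xI; rewrite -mem_lqproj => /eqP ->; exact: mem0v.
Qed.

Lemma simple_lieQuotP : simple_lie (lieQuot I) <->
  (exists x y : L, lieb x y \notin lie_ideal_space I) /\
  (forall K : lieIdeal L, (I <= K)%VS -> (K <= I)%VS \/ (fullv <= K)%VS).
Proof.
split=> [[[x [y nxy]] Hs]|[[x [y nxy]] Hs]]; split.
- exists (lqrepr x), (lqrepr y); rewrite -mem_lqproj -lqproj_lieb !lqreprK.
  exact/eqP.
- move=> K IK; have [K' K'E] := lie_ideal_img IK.
  have [K'0|K'1] := Hs K'; [left | right]; apply/subvP => z.
    by rewrite -K'E K'0 memv0 mem_lqproj.
  by move=> _; rewrite -K'E K'1 memvf.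
- exists (lqproj I x), (lqproj I y); rewrite [lieb _ _]lqproj_lieb.
  by apply/eqP; rewrite mem_lqproj.
- move=> K; have [K' [IK' K'E]] := lie_ideal_preim K.
  have [/subvP K'0|/subvP K'1] := Hs K' IK'; [left | right]; apply/vspaceP => z.
    rewrite -[z]lqreprK -K'E memv0 mem_lqproj; apply/idP/idP; first exact: K'0.
    exact: (subvP IK').
  by rewrite memvf -[z]lqreprK -K'E K'1 ?memvf.
Qed.

End SimpleQuotient.

(** * Derivations *)

Section Derivations.
Variables (k : fieldType) (A : falgType k).

Lemma mk_der (d : A -> A) : linear d -> (forall x y, d (x * y) = d x * y + x * d y) ->
  exists D : Der A, forall x, der_fun D x = d x.
Proof.
move=> ld dM; have [f fE] := mk_lfun ld.
have fP : f \in derv A by apply/dervP => x y; rewrite !fE.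
by exists (Subvs fP) => x; rewrite -fE.
Qed.

Lemma der_fun1 (d : Der A) : der_fun d 1 = 0.
Proof. by have := der_funM d 1 1; rewrite !mulr1 mul1r => /eqP; rewrite -subr_eq subrr eq_sym => /eqP. Qed.

Lemma der_comm_scale (mulC : commutative (@GRing.mul A)) (a : A) (d : Der A) :
  exists D : Der A, forall x, der_fun D x = a * der_fun d x.
Proof.
apply: mk_der => [c u v|x y]; first by rewrite linearP mulrDr -scalerAr.
by rewrite der_funM mulrDr mulrA !mulrA (mulC a x).
Qed.

Lemma mem_ider (d : Der A) :
  (d \in ider_space A) <-> exists a : A, forall x, der_fun d x = a * x - x * a.
Proof.
split=> [/memv_imgP[a _ ->]|[a da]].
  by exists a => x; rewrite lfunE inner_derE.
have -> : d = linfun (@inner_der k A) a by rewrite lfunE; apply: der_ext => x; rewrite da inner_derE.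
exact/memv_img/memvf.
Qed.

End Derivations.

(** * Local augmented algebras *)

Section Augmented.
Variables (k : fieldType) (A : falgType k) (eps : 'Hom(A, k^o)).
Hypothesis eps1 : eps 1 = 1.
Hypothesis epsM : forall a b : A, eps (a * b) = eps a * eps b.
Hypothesis eps_local : forall M : {vspace A},
  left_ideal M -> M <> fullv -> (M <= lker eps)%VS.
Local Notation J := (lker eps).

Lemma aug_sub (a : A) : a - eps a *: 1 \in J.
Proof. by rewrite memv_ker linearB linearZ /= eps1 [_ *: 1]mulr1 subrr. Qed.

Lemma aug_mull (a b : A) : b \in J -> a * b \in J.
Proof. by rewrite !memv_ker epsM => /eqP ->; rewrite mulr0. Qed.

Lemma aug_mulr (a b : A) : b \in J -> b * a \in J.
Proof. by rewrite !memv_ker epsM => /eqP ->; rewrite mul0r. Qed.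

(** A non-invertible s would generate a proper left ideal A s, which lies in J. *)
Lemma aug_linv (s : A) : eps s != 0 -> exists y, y * s = 1.
Proof.
move=> ns; pose M := limg (amulr s).
have lM : left_ideal M.
  move=> a _ /memv_imgP[b _ ->]; rewrite lfunE /= mulrA.
  by apply/memv_imgP; exists (a * b); rewrite ?memvf // lfunE.
have [M1|M1] := classic (M = fullv); last first.
  have sM : s \in M by apply/memv_imgP; exists 1; rewrite ?memvf // lfunE /= mul1r.
  by move/subvP: (eps_local lM M1) => /(_ _ sM); rewrite memv_ker (negPf ns).
have : 1 \in M by rewrite M1 memvf.
by case/memv_imgP => y _ e; exists y; rewrite e lfunE.
Qed.

Lemma aug_nakayama (i n : A) : i \in J -> n = i * n -> n = 0.
Proof.
move=> iJ e; have [y y1] : exists y, y * (1 - i) = 1.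
  apply: aug_linv; rewrite linearB /= eps1; move: iJ; rewrite memv_ker => /eqP ->.
  by rewrite subr0 oner_eq0.
by rewrite -[n]mul1r -y1 -mulrA mulrBl mul1r -e subrr mulr0.
Qed.

(** The powers of J become stationary at an idempotent ideal I. If I <> 0,
    a minimal left ideal N with I N <> 0 has the form I n with n in N; then
    n = i n for some i in I, so n = 0 by Nakayama. *)
Lemma aug_nilpotent : exists N, (J ^+ N = 0)%VS.
Proof.
have Jl m : (fullv * J ^+ m.+1 <= J ^+ m.+1)%VS.
  rewrite expvSl prodvA prodvSl //; apply/prodvP => u v _; exact: aug_mull.
have JS m : (J ^+ m.+2 <= J ^+ m.+1)%VS.
  rewrite (expvSl J m.+1); apply: subv_trans (Jl m); apply: prodvSl; exact: subvf.
have JD m n : (J ^+ (m.+1 + n) <= J ^+ m.+1)%VS.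
  elim: n => [|n IH]; first by rewrite addn0.
  by rewrite addnS; apply: subv_trans IH; rewrite addSn; exact: JS.
have [_ [_ [m ->] mI]] := @minimal_vspace _ _ (fun W => exists m, W = (J ^+ m.+1)%VS)
  (J ^+ 1)%VS (ex_intro _ 0%N erefl).
set I := (J ^+ m.+1)%VS in mI *.
have II : (I * I = I)%VS.
  rewrite -expvD; apply: mI; last exact: JD.
  by exists (m + m.+1)%N.
have IJ : (I <= J)%VS by rewrite -[X in (_ <= X)%VS]expv1 /I -add1n; exact: JD.
have Il : left_ideal I.
  by move=> a x xI; apply: (subvP (Jl m)); rewrite memv_mul // memvf.
exists m.+1; apply: NNPP => /eqP nI.
have QT : left_ideal {:A}%VS /\ (I * {:A} != 0)%VS.
  split=> [? ? _|]; first exact: memvf.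
  apply: contra nI => /eqP e; rewrite -subv0 -e -[X in (X <= _)%VS]prodv1.
  by apply: prodvSr; exact: subvf.
have [N [_ [lN nN] mN]] := @minimal_vspace _ _ (fun N => left_ideal N /\ (I * N != 0)%VS) _ QT.
have [n nN' nI0] : exists2 n, n \in N & (I * <[n]> != 0)%VS.
  apply: NNPP => no; case/negP: nN; rewrite -subv0; apply/prodvP => u v uI vN.
  rewrite memv0; apply: contraT => nuv; case: no; exists v => //.
  apply: contra nuv => /eqP e; rewrite -memv0 -e memv_mul //; exact: memv_line.
have : (I * <[n]>)%VS = N.
  apply: mN; first split.
  - by move=> a x; rewrite -limg_amulr => /memv_imgP[i iI ->];
      rewrite lfunE /= mulrA; apply/memv_imgP; exists (a * i); rewrite ?lfunE ?Il.
  - by rewrite prodvA II.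
  - by rewrite -limg_amulr; apply/subvP => x /memv_imgP[i _ ->]; rewrite lfunE; apply: lN.
move/vspaceP => /(_ n); rewrite nN' -limg_amulr => /memv_imgP[i iI e].
have n0 : n = 0 by apply: (@aug_nakayama i); [exact: (subvP IJ) | rewrite {1}e lfunE].
by move: nI0; rewrite n0 /= -[X in X != _]limg_amulr; case/negP; apply/eqP/vspaceP => x;
  apply/memv_imgP/idP => [[y _ ->]|]; rewrite ?lfunE /= ?mulr0 ?memv0 // => /eqP ->;
  exists 0; rewrite ?mem0v ?lfunE /= ?mulr0.
Qed.

(** Tangent vectors at eps, that is linear forms on J/J^2. *)
Definition point_der (f : 'Hom(A, k^o)) : Prop :=
  forall a b : A, f (a * b) = f a * eps b + eps a * f b.

(** A linear form vanishing on 1 and on J^2 is a tangent vector, because a b is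
    eps(a) b + eps(b) a modulo k and J^2. *)
Lemma point_der_ex (W : {vspace A}) (x : A) :
  1 \in W -> x \notin (W + J * J)%VS ->
  exists f : 'Hom(A, k^o), [/\ point_der f, f x = 1 & forall w, w \in W -> f w = 0].
Proof.
move=> W1 nx; have [f [fx f0]] := functional_sep nx.
exists f; split=> // [a b|w wW]; last by apply: f0; apply: (subvP (addvSl _ _)).
have f1 : f 1 = 0 by apply: f0; apply: (subvP (addvSl _ _)).
have fJ u v : u \in J -> v \in J -> f (u * v) = 0.
  by move=> uJ vJ; apply: f0; apply: (subvP (addvSr _ _)); rewrite memv_mul.
have := fJ _ _ (aug_sub a) (aug_sub b).
rewrite mulrBl !mulrBr -!scalerAl -!scalerAr !mul1r mulr1 !linearB /= !linearZ /= f1.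
rewrite !oppr0 !scaler0 addr0 !scalerN -addrA -opprD => /eqP.
rewrite subr_eq0 => /eqP ->.
by rewrite -[eps b *: f a]/(eps b * f a) -[eps a *: f b]/(eps a * f b) mulrC.
Qed.

Lemma aug_full : (1 + J)%VS = fullv.
Proof.
apply/vspaceP => a; rewrite memvf -[a](subrK (eps a *: 1)) addrC.
by apply: memv_add; [rewrite memvZ // memv_line | exact: aug_sub].
Qed.

(** The inclusions J^m <= B + J^(m+1) follow by induction on m from the
    hypotheses, and J is nilpotent. *)
Lemma subspace_full (B C : {vspace A}) : 1 \in B -> (C * B <= B)%VS ->
  (J <= C + J * J)%VS -> B = fullv.
Proof.
move=> B1 CB JC.
have JS m : (J ^+ m.+2 <= J ^+ m.+1)%VS.
  by rewrite !expvSl prodvA prodvSl //; apply/prodvP => u v _; exact: aug_mull.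
have step m : (J ^+ m <= B + J ^+ m.+1)%VS.
  elim: m => [|m IH].
    by rewrite expv0; apply: subv_trans (addvSl _ _); rewrite -memvE.
  rewrite expvSl; apply/prodvP => u v uJ vJ.
  have /memv_addP[b bB [w wJ vE]] := subvP IH _ vJ.
  have /memv_addP[c cC [q qJ uE]] := subvP JC _ uJ.
  have -> : u * v = c * b + (q * (v - w) + u * w).
    by rewrite vE addrK addrA -mulrDl -uE -mulrDr.
  apply: memv_add; first by apply: (subvP CB); exact: memv_mul.
  apply: memvD; last by rewrite expvSl memv_mul.
  rewrite mulrBr; apply: memvB; first by rewrite !expvSl prodvA memv_mul.
  by apply: (subvP (JS m.+1)); rewrite 2!expvSl prodvA memv_mul.
have JB m j : (J ^+ m <= B + J ^+ (m + j))%VS.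
  elim: j => [|j IH]; first by rewrite addn0 addvSr.
  apply: subv_trans IH _; rewrite addnS -{2}[B]addvv -addvA addvS //; exact: step.
have [N JN] := aug_nilpotent.
have JmB m : (J ^+ m <= B)%VS.
  by have := JB m N; rewrite expvD JN prodv0 addv0.
apply/eqP; rewrite eqEsubv subvf -aug_full subv_add -memvE B1 /=.
by have := JmB 1%N; rewrite expv1.
Qed.

Lemma point_der_sep (x : A) : x \in J -> x \notin (J * J)%VS ->
  exists f, point_der f /\ f x = 1.
Proof.
move=> xJ nx; have [|f [fd fx _]] := @point_der_ex 1%VS x (memv_line 1); last by exists f.
apply: contra nx => /memv_addP[u /vlineP[c ->] [v vJ xE]]; rewrite xE.
have vJ' : v \in J by apply: (subvP _ _ vJ); apply/prodvP => a b _; exact: aug_mull.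
suff /eqP-> : c == 0 by rewrite scale0r add0r.
have := xJ; rewrite xE memv_ker linearD linearZ /= eps1.
by move: vJ'; rewrite memv_ker => /eqP ->; rewrite addr0 [_ *: _]mulr1.
Qed.

Lemma point_der_neq0 : J != 0%VS ->
  exists f x, [/\ point_der f, x \in J & f x = 1].
Proof.
move=> nJ; have [N JN] := aug_nilpotent.
have /subvPn[x xJ nx] : ~~ (J <= J * J)%VS.
  apply: contra nJ => sJ; rewrite -subv0 -(prodv0 J) -JN -expvSl.
  elim: N {JN} => [|N IH]; first by rewrite expv1.
  by apply: subv_trans sJ _; rewrite expvSl; exact: prodvSr.
by have [f [fd fx]] := point_der_sep xJ nx; exists f, x.
Qed.

(* Group algebras satisfy this by translation; it makes the tangent vectors
   available as derivations. *)
Hypothesis translation : forall f, point_der f ->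
  exists d : Der A, forall a, eps (der_fun d a) = f a.

Definition der_stable (M : {vspace A}) : Prop :=
  forall (d : Der A) x, x \in M -> der_fun d x \in M.

Definition right_ideal (M : {vspace A}) : Prop :=
  forall a x : A, x \in M -> x * a \in M.

Lemma eps_comm (a b : A) : eps (a * b - b * a) = 0.
Proof. by rewrite linearB /= !epsM mulrC subrr. Qed.

Lemma simple_aug_neq0 : simple_lie (HH1 A) -> J != 0%VS.
Proof.
move/simple_lieQuotP => [[x [y nxy]] _]; apply: contraNneq nxy => J0.
have scal (a : A) : exists c, a = c *: 1.
  by exists (eps a); apply/eqP; rewrite -subr_eq0 -memv0 -J0 aug_sub.
have der0 (d : Der A) z : der_fun d z = 0.
  by have [c ->] := scal z; rewrite linearZ /= der_fun1 scaler0.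
by apply/mem_ider; exists 0 => z; rewrite mul0r mulr0 subrr der0.
Qed.

(** The derivations that are inner modulo M form a Lie ideal containing the
    inner ones. A derivation d with eps o d = f for a nonzero tangent vector f
    does not belong to it, since eps kills M and all commutators; by simplicity
    the Lie ideal is the space of inner derivations. *)
Lemma simple_der_inner (M : {vspace A}) (d : Der A) : simple_lie (HH1 A) ->
    left_ideal M -> right_ideal M -> der_stable M -> (M <= J)%VS ->
    (forall a, der_fun d a \in M) ->
  exists a : A, forall x, der_fun d x = a * x - x * a.
Proof.
move=> sA lM rM dM MJ dA; have nJ := simple_aug_neq0 sA.
pose Q (e : Der A) := exists a : A, forall x, der_fun e x - (a * x - x * a) \in M.
have [|c u v [a ua] [b vb]|W WE] := @vspace_of_pred _ _ Q.
- by exists 0 => x; rewrite mul0r mulr0 der_fun0 !subrr mem0v.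
- exists (c *: a + b) => x; rewrite der_funP mulrDl mulrDr -scalerAl -scalerAr.
  set y := (X in X \in M).
  have -> : y = c *: (der_fun u x - (a * x - x * a)) + (der_fun v x - (b * x - x * b)).
    by rewrite /y scalerBr addrACA -opprD scalerBr [in RHS]addrACA -opprD.
  by rewrite memvD ?memvZ.
have WP (e u : Der A) : u \in W -> lieb e u \in W.
  rewrite !WE => -[a ua]; exists (der_fun e a) => x; rewrite der_liebE.
  have := dM e _ (ua x); have := ua (der_fun e x).
  rewrite !(linearB (der_fun e)) /= !der_funM => h1 h2; have := memvB h2 h1.
  set y := (X in X \in M -> _); set z := (X in _ -> X \in M).
  suff -> : y = z by [].
  rewrite /y /z {y z}!opprB !opprD.
  by rewrite (AC ((1*(2*2))*3) ((1*8)*(3*4)*(2*7)*(5*6)))/= subrr addNr !addr0.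
pose K := LieIdeal WP.
have IK : (IDer A <= K)%VS.
  apply/subvP => e /mem_ider[a ea]; rewrite WE.
  by exists a => x; rewrite ea subrr mem0v.
have dK : d \in W.
  by rewrite WE; exists 0 => x; rewrite mul0r mulr0 !subr0.
have [_ /(_ K IK)] := (simple_lieQuotP (IDer A)).1 sA.
case=> [/subvP/(_ _ dK)|/subvP Kf]; first by move/mem_ider.
have [f [x [fd _ fx]]] := point_der_neq0 nJ; have [e ef] := translation fd.
have /WE[a /(_ x)] := Kf e (memvf _).
move/(subvP MJ); rewrite memv_ker linearB /= eps_comm subr0 ef fx.
by rewrite (negPf (oner_neq0 _)).
Qed.

(** * A symmetric form and simplicity force commutativity *)

Section TraceForm.
Variable lam : 'Hom(A, k^o).
Hypothesis lamC : forall a b : A, lam (a * b) = lam (b * a).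
Hypothesis lam_nondeg : forall a : A, (forall b, lam (b * a) = 0) -> a = 0.

Lemma left_socle_ex (K : {vspace A}) : left_ideal K -> K != 0%VS ->
  exists2 t, t \in K /\ t != 0 & forall x, x \in J -> x * t = 0.
Proof.
move=> lK nK.
have [N [sN [lN nN] mN]] := @minimal_vspace _ _ (fun N => left_ideal N /\ N != 0%VS) K (conj lK nK).
have tN := memv_pick N; set t := vpick N in tN.
have nt : t != 0 by rewrite vpick0.
exists t; first by split=> //; apply: (subvP sN).
pose M := (amulr t @: J)%VS.
have lM : left_ideal M.
  move=> a _ /memv_imgP[i iJ ->]; rewrite lfunE /= mulrA.
  by apply/memv_imgP; exists (a * i); rewrite ?lfunE // aug_mull.
move=> x xJ; apply/eqP; rewrite -memv0.
have xM : x * t \in M by apply/memv_imgP; exists x; rewrite ?lfunE.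
have [<- //|nM] := eqVneq M 0%VS.
have MN : M = N.
  apply: mN => //; apply/subvP => _ /memv_imgP[i _ ->]; rewrite lfunE; exact: lN.
move: tN; rewrite -MN => /memv_imgP[i iJ]; rewrite lfunE /= => e.
by move: nt; rewrite (aug_nakayama iJ e) eqxx.
Qed.

(** If the commutator ideal K is nonzero, it contains t <> 0 with J t = 0. The
    form makes t central with lam t <> 0. For a tangent vector f, the derivation
    x |-> f(x) t has values in K, so it is inner, and lam kills its values;
    but f is nonzero. *)
Lemma simple_mulC : simple_lie (HH1 A) -> commutative (@GRing.mul A).
Proof.
move=> sA.
have [C CE] := lspan_vspace (fun x : A => exists a b : A, x = a * b - b * a).
(* The left ideal generated by the commutators is two-sided and stable. *)
pose K := (fullv * C)%VS.
have Cgen (a b : A) : a * b - b * a \in C by apply/CE/lspan_gen; exists a, b.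
have CJ : (C <= J)%VS.
  apply/subvP => x /CE; elim=> [_ [a [b ->]]||c u v _ uJ _ vJ].
  - by rewrite memv_ker eps_comm.
  - exact: mem0v.
  - by rewrite memvD ?memvZ.
have KJ : (K <= J)%VS.
  by apply/prodvP => u v _ vC; apply: aug_mull; apply: (subvP CJ).
have Cder (d : Der A) x : x \in C -> der_fun d x \in C.
  move=> /CE; elim=> [_ [a [b ->]]||c u v _ uC _ vC].
  - rewrite linearB /= !der_funM opprD (AC (2*2) ((1*4)*(2*3))) /=.
    exact: memvD.
  - by rewrite linear0 mem0v.
  - by rewrite linearP memvD ?memvZ.
have lK : left_ideal K by exact: generated_left_ideal.
have mK (f : 'End(A)) : (forall u v, v \in C -> f (u * v) \in K) ->
    forall x, x \in K -> f x \in K.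
  move=> fK x xK; rewrite memv_preim; apply: (subvP _ _ xK).
  by apply/prodvP => u v _ vC; rewrite -memv_preim; apply: fK.
have rK : right_ideal K.
  move=> a x xK; have := mK (amulr a) _ x xK; rewrite lfunE /=; apply=> u v vC.
  rewrite lfunE /= -mulrA -(subrK (a * v) (v * a)) mulrDr.
  apply: memvD; first by rewrite memv_mul ?memvf.
  by rewrite mulrA memv_mul ?memvf.
have dK : der_stable K.
  move=> d x; apply: mK => u v vC; rewrite der_funM memvD //.
    by rewrite memv_mul ?memvf.
  by rewrite memv_mul ?memvf ?Cder.
move=> a b; apply/eqP; rewrite -subr_eq0; apply: contraT => nab.
have nK : K != 0%VS.
  apply: contra nab => /eqP K0; rewrite -memv0 -K0 -[_ - _]mul1r.
  by rewrite memv_mul ?memvf.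
have [t [tK nt] Jt] := left_socle_ex lK nK.
have ct (x : A) : x * t = eps x *: t.
  apply/eqP; rewrite -subr_eq0 -[eps x *: t]mul1r -scalerAr scalerAl -mulrBl Jt //.
  exact: aug_sub.
have lt : lam t != 0.
  apply: contra nt => /eqP lt0; apply/eqP/lam_nondeg => x.
  by rewrite ct linearZ /= lt0 scaler0.
have tJ (x : A) : x \in J -> t * x = 0.
  move=> xJ; apply: lam_nondeg => y; rewrite mulrA lamC mulrA ct linearZ /=.
  by move: xJ; rewrite memv_ker epsM => /eqP ->; rewrite mul0r scale0r.
have tc (x : A) : t * x = eps x *: t.
  apply/eqP; rewrite -subr_eq0 -[eps x *: t]mulr1 -scalerAl scalerAr -mulrBr tJ //.
  exact: aug_sub.
have [f [x [fd xJ fx]]] := point_der_neq0 (simple_aug_neq0 sA).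
have [|y z|d dE] := @mk_der _ A (fun y => f y *: t).
- by move=> c u v; rewrite linearP scalerDl scalerA.
- by rewrite fd scalerDl -scalerAl -scalerAr tc ct !scalerA addrC mulrC addrC.
have [|e ed] := simple_der_inner sA lK rK dK KJ (d := d).
  by move=> y; rewrite dE memvZ.
move/eqP: lt; case; have := congr1 lam (ed x).
by rewrite dE fx scale1r linearB /= lamC subrr.
Qed.

End TraceForm.

(** * Differentiably simple commutative algebras *)

Section CommutativeAugmented.
Hypothesis mulC : commutative (@GRing.mul A).

(** The same ring with its commutativity bundled, so that ring applies. *)
Definition commRing : comNzRingType :=
  HB.pack_for comNzRingType A (GRing.PzSemiRing_hasCommutativeMul.Build A mulC).

(** Differentiable simplicity. *)
Definition dsimple : Prop := forall M : {vspace A},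
  left_ideal M -> der_stable M -> M = 0%VS \/ M = fullv.

(** If m lies in a proper stable ideal M and d is a derivation, then m d has
    values in M, so it is inner, hence 0. Since d x is invertible for some d
    and x, this gives m = 0. *)
Lemma simple_dsimple : simple_lie (HH1 A) -> dsimple.
Proof.
move=> sA M lM dM; have [M1|M1] := classic (M = fullv); first by right.
left; have MJ := eps_local lM M1.
have [f [x [fd _ fx]]] := point_der_neq0 (simple_aug_neq0 sA).
have [d df] := translation fd.
have [y y1] : exists y, y * der_fun d x = 1.
  by apply: aug_linv; rewrite df fx oner_eq0.
have rM : right_ideal M by move=> a z zM; rewrite mulC lM.
apply/eqP; rewrite -subv0; apply/subvP => m mM; rewrite memv0.
have [D DE] := der_comm_scale mulC m d.
have [|e De] := simple_der_inner sA lM rM dM MJ (d := D).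
  by move=> a; rewrite DE rM.
by rewrite -[m]mulr1 -y1 (mulC y) mulrA -DE De (mulC e) subrr mul0r.
Qed.

Fact der_scale_derv (c : A) (d : Der A) : (amull c \o der_fun d)%VF \in derv A.
Proof.
have [D DE] := der_comm_scale mulC c d.
have -> : (amull c \o der_fun d)%VF = der_fun D.
  by apply/lfunP => x; rewrite comp_lfunE lfunE DE.
exact: subvsP.
Qed.

Definition der_scale (c : A) (d : Der A) : Der A := Subvs (der_scale_derv c d).

Lemma der_scaleE c d x : der_fun (der_scale c d) x = c * der_fun d x.
Proof. by rewrite /der_fun /= comp_lfunE lfunE. Qed.

(** The value at x of [u, g b d] - [g u, b d] = b (u(g) d + d(g) u), with each
    derivative as an indeterminate: ub is u(b), udx is u(d(x)), and so on. *)
Fact second_order_identity (R : comNzRingType) (g b ub dx udx dg ux dux ug : R) :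
  - (g * (ub * dx + b * udx) - b * (dg * ux + g * dux))
    + ((ug * b + g * ub) * dx + g * b * udx - g * b * dux)
  = b * (ug * dx + dg * ux).
Proof. by ring. Qed.

(** The value at x of y^2 s (s e + e(g) u) - y^2 e(g) s u = (y s)^2 e, with ex
    for e(x), eg for e(g) and ux for u(x). *)
Fact second_order_inverse (R : comNzRingType) (y s ex eg ux : R) :
  - (y * y * eg * s * ux) + y * y * s * (s * ex + eg * ux) = y * s * (y * s) * ex.
Proof. by ring. Qed.

Section LieIdeal.
Variable K : lieIdeal (Der A).

Lemma lie_idealC (x y : Der A) : x \in lie_ideal_space K -> lieb x y \in lie_ideal_space K.
Proof. by move=> xK; rewrite liebC memvN lie_idealP. Qed.

(** Up to sign, u(f) u is the bracket of f u with u. *)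
Lemma ideal_scale_self (u : Der A) f : u \in lie_ideal_space K ->
  der_scale (der_fun u f) u \in lie_ideal_space K.
Proof.
move=> uK; rewrite -memvN.
have -> : - der_scale (der_fun u f) u = lieb (der_scale f u) u.
  apply: der_ext => x; rewrite der_liebE !der_scaleE der_funM.
  rewrite -scaleN1r -[_ *: _]addr0 der_funP der_fun0 scaleN1r addr0 der_scaleE.
  by rewrite opprD [RHS]addrC subrK.
exact: lie_idealP.
Qed.

(** With g = u(f), this is [u, g b d] - [g u, b d]. *)
Lemma ideal_second_order (u d : Der A) b f : u \in lie_ideal_space K ->
  der_scale b (der_scale (der_fun u (der_fun u f)) d + der_scale (der_fun d (der_fun u f)) u)
    \in lie_ideal_space K.
Proof.
move=> uK; set g := der_fun u f.
have h1 := lie_idealC (der_scale b d) (ideal_scale_self f uK).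
have h2 := lie_idealC (der_scale (g * b) d) uK.
have := memvB h2 h1.
set y := (X in X \in _ -> _); set z := (X in _ -> X \in _).
suff -> : y = z by []; rewrite {}/y {}/z; apply: der_ext => x.
rewrite -scaleN1r addrC der_funP !der_liebE !(der_scaleE, der_funD) -/g !der_funM.
rewrite scaleN1r; exact: (@second_order_identity commRing).
Qed.

End LieIdeal.

(** The ideal of A generated by all values u(a) with u in K is stable under
    derivations, since d(u(a)) = [d, u](a) + u(d(a)). It is nonzero, hence equal
    to A, so it is not contained in J. *)
Lemma dsimple_ideal_unit (K : lieIdeal (Der A)) (u0 : Der A) (a0 : A) :
  dsimple -> u0 \in lie_ideal_space K -> der_fun u0 a0 != 0 ->
  exists u a, [/\ u \in lie_ideal_space K, a \in J & eps (der_fun u a) != 0].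
Proof.
move=> sA u0K nua; apply: NNPP => no.
have valJ (u : Der A) a : u \in lie_ideal_space K -> der_fun u a \in J.
  move=> uK; rewrite memv_ker; apply: contraT => nu; case: no.
  exists u, (a - eps a *: 1); rewrite aug_sub.
  by rewrite linearB linearZ /= der_fun1 scaler0 subr0.
have [G GE] := lspan_vspace (fun x : A =>
  exists (u : Der A) (a : A), u \in lie_ideal_space K /\ x = der_fun u a).
pose M := (fullv * G)%VS.
have MJ : (M <= J)%VS.
  apply/prodvP => x y _ /GE yG; apply: aug_mull; elim: yG => {y}.
  - by move=> _ [u [a [uK ->]]]; exact: valJ.
  - exact: mem0v.
  - by move=> c y z _ yJ _ zJ; rewrite memvD ?memvZ.
have lM : left_ideal M by exact: generated_left_ideal.
have dM : der_stable M.
  move=> d x xM; rewrite memv_preim; apply: (subvP _ _ xM).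
  apply/prodvP => b y _ yG; rewrite -memv_preim der_funM memvD ?memv_mul ?memvf //.
  apply/GE; move/GE: yG; elim=> {y} [_ [u [a [uK ->]]]||c y z _ yG _ zG].
  - have -> : der_fun d (der_fun u a) = 1 *: der_fun (lieb d u) a + der_fun u (der_fun d a).
      by rewrite scale1r der_liebE subrK.
    apply: lspanD; apply: lspan_gen; first by exists (lieb d u), a; rewrite lie_idealP.
    by exists u, (der_fun d a).
  - by rewrite linear0; exact: lspan0.
  - by rewrite linearP; exact: lspanD.
have [M0|M1] := sA M lM dM; last first.
  by have := memvf (1 : A); rewrite -M1 => /(subvP MJ);
    rewrite memv_ker eps1 (negPf (oner_neq0 _)).
case/negP: nua; rewrite -memv0 -M0 -[der_fun _ _]mul1r.
by apply: memv_mul; [exact: memvf | apply/GE/lspan_gen; exists u0, a0].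
Qed.

(** Jordan's argument. A Lie ideal K that is not zero contains u with u(a)
    invertible for some a in J, and then s = u(u(a^2)) is invertible, because it
    is 2 u(a)^2 modulo J. With d = u, [ideal_second_order] gives b u(u(f)) u in K
    for all b and f as 2 is invertible; with g = u(a^2) it gives
    b (s e + e(g) u) in K for every derivation e. The choice of b as s^-2 e(g)
    in the former and s^-1 in the latter shows that e lies in K. *)
Lemma dsimple_simple : 2%:R != 0 :> k -> J != 0%VS -> dsimple -> simple_lie (HH1 A).
Proof.
move=> n2 nJ sA; apply/simple_lieQuotP.
have ider0 (d : Der A) : d \in ider_space A -> forall x, der_fun d x = 0.
  by move=> /mem_ider[a da] x; rewrite da (mulC a) subrr.
split.
  have [f [x [fd _ fx]]] := point_der_neq0 nJ; have [d df] := translation fd.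
  exists (der_scale x d), d; apply/negP => /ider0/(_ x) /(congr1 eps).
  rewrite der_liebE !der_scaleE der_funM opprD addrCA subrr addr0 linearN /= epsM df fx.
  by rewrite mulr1 linear0 => /eqP; rewrite oppr_eq0 (negPf (oner_neq0 _)).
move=> K _; have [?|/subvPn[u0 u0K nu0]] := boolP (K <= IDer A)%VS; first by left.
right; apply/subvP => e _.
have [a0 nua] : exists a, der_fun u0 a != 0.
  apply: NNPP => no; case/negP: nu0; apply/mem_ider; exists 0 => x.
  rewrite mul0r mulr0 subrr; apply/eqP; apply: contraT => nx.
  by case: no; exists x.
have [u [a [uK aJ nu]]] := dsimple_ideal_unit sA u0K nua.
pose s := der_fun u (der_fun u (a * a)).
have [y ys] : exists y, y * s = 1.
  apply: aug_linv; rewrite /s der_funM (mulC (der_fun u a)) -mulr2n linearMn /=.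
  rewrite der_funM linearMn /= linearD /= !epsM; move: aJ; rewrite memv_ker => /eqP ->.
  by rewrite mul0r addr0 -mulr_natl !mulf_neq0.
have h3 b f : der_scale (b * der_fun u (der_fun u f)) u \in lie_ideal_space K.
  have := ideal_second_order u b f uK; move/(memvZ (2%:R^-1)).
  set z := (X in X \in _ -> _); suff -> : z = der_scale (b * der_fun u (der_fun u f)) u by [].
  apply: der_ext => x; rewrite /z -[_ *: _]addr0 der_funP der_fun0 addr0.
  rewrite !(der_scaleE, der_funD) -mulr2n mulrnAr -scaler_nat scalerA mulVf //.
  by rewrite scale1r mulrA.
pose g := der_fun u (a * a); have := h3 (y * y * der_fun e g) (a * a).
have := ideal_second_order e (y * y * s) (a * a) uK; rewrite -/g -/s => h1 h2.
have := memvB h1 h2; set z := (X in X \in _ -> _); suff -> : z = e by [].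
apply: der_ext => x; rewrite /z -scaleN1r addrC der_funP scaleN1r.
rewrite !(der_scaleE, der_funD) -[RHS]mul1r -[1]mulr1 -ys.
exact: (@second_order_inverse commRing).
Qed.

Lemma der_fun_sum I (r : seq I) (F : I -> Der A) x :
  der_fun (\sum_(i <- r) F i) x = \sum_(i <- r) der_fun (F i) x.
Proof.
elim: r => [|i r IH]; first by rewrite !big_nil der_fun0.
by rewrite !big_cons der_funD IH.
Qed.

(** * Coordinates and exact derivations *)

Section Coordinates.
Variables (n : nat) (x : 'I_n -> A) (d : 'I_n -> Der A).
Hypothesis xJ : forall i, x i \in J.
Hypothesis dx : forall i j, eps (der_fun (d i) (x j)) = (i == j)%:R.
Hypothesis x_gen : forall a, a \in J ->
  (forall i, eps (der_fun (d i) a) = 0) -> a \in (J * J)%VS.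

(* The m-th power of J as an ideal: J ^+ 0 is k, not A. *)
Local Notation I m := (fullv * J ^+ m)%VS.

Lemma coord_decomp a : exists q, q \in (J * J)%VS /\
  a = eps a *: 1 + \sum_i eps (der_fun (d i) a) *: x i + q.
Proof.
pose b := a - eps a *: 1; exists (b - \sum_i eps (der_fun (d i) a) *: x i).
rewrite addrACA subrr addr0 addrC subrK; split=> //.
have db i : der_fun (d i) b = der_fun (d i) a.
  by rewrite linearB linearZ /= der_fun1 scaler0 subr0.
apply: x_gen => [|j].
  by rewrite memvB ?aug_sub //; apply: memv_suml => i _; rewrite memvZ.
rewrite (linearB (der_fun (d j)) b) (linearB eps) /= db linear_sum linear_sum (bigD1 j) //= !linearZ /= dx eqxx [_ *: 1]mulr1.
rewrite big1 ?addr0 ?subrr // => i /negPf ij.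
by rewrite !linearZ /= dx eq_sym ij [_ *: 0]mulr0.
Qed.

Lemma powI_left m a y : y \in I m -> a * y \in I m.
Proof. by move=> yI; apply: generated_left_ideal. Qed.

Lemma powIS m y z : y \in I m -> z \in J -> y * z \in I m.+1.
Proof. by move=> yI zJ; rewrite expvSr prodvA memv_mul. Qed.

Lemma powI0 y : y \in I 0.
Proof. by rewrite expv0 prodv1 memvf. Qed.

Lemma powI_nil : exists N, forall y, y \in I N -> y = 0.
Proof.
have [N JN] := aug_nilpotent; exists N => y.
by rewrite JN prodv0 memv0 => /eqP.
Qed.

(** Modulo J^2 the x j and 1 span A, and D maps J^2 into J D(A). *)
Lemma der_powI_step (D : Der A) m : (forall a, der_fun D a \in I m) ->
  (forall j, der_fun D (x j) \in I m.+1) -> forall a, der_fun D a \in I m.+1.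
Proof.
move=> Dm Dx a; have [q [qJ ->]] := coord_decomp a.
rewrite !linearD /= linearZ /= der_fun1 scaler0 add0r; apply: memvD.
  by rewrite linear_sum /=; apply: memv_suml => i _; rewrite linearZ /= memvZ.
rewrite memv_preim; apply: (subvP _ _ qJ); apply/prodvP => u v uJ vJ.
rewrite -memv_preim der_funM; apply: memvD; first exact: powIS.
by rewrite mulC; apply: powIS.
Qed.

Lemma delta_sub i j : der_fun (d i) (x j) - (i == j)%:R \in J.
Proof.
by rewrite memv_ker linearB /= dx -[in eps _]scaler_nat linearZ /= eps1 [_ *: 1]mulr1 subrr.
Qed.

Definition der_comb (c : 'I_n -> A) : Der A := \sum_i der_scale (c i) (d i).

Lemma der_combE c a : der_fun (der_comb c) a = \sum_i c i * der_fun (d i) a.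
Proof. by rewrite der_fun_sum; apply: eq_bigr => i _; rewrite der_scaleE. Qed.

Lemma delta_sum (c : 'I_n -> A) j : \sum_i c i * (i == j)%:R = c j.
Proof.
rewrite (bigD1 j) //= eqxx mulr1 big1 ?addr0 // => i /negPf ->.
by rewrite mulr0.
Qed.

Lemma der_combE_x m (c : 'I_n -> A) j : (forall i, c i \in I m) ->
  der_fun (der_comb c) (x j) - c j \in I m.+1.
Proof.
move=> cI; rewrite der_combE -[c j]delta_sum -sumrB; apply: memv_suml => i _.
by rewrite -mulrBr powIS // delta_sub.
Qed.

(** The coefficients are improved modulo higher and higher powers of J: the
    matrix of the d i (x j) is the identity modulo J. *)
Lemma der_generated (D : Der A) : exists c, forall a,
  der_fun D a = \sum_i c i * der_fun (d i) a.
Proof.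
suff H m : exists c, forall a, der_fun (D - der_comb c) a \in I m.
  have [N IN] := powI_nil; have [c cN] := H N; exists c => a.
  have := IN _ (cN a); rewrite -scaleN1r addrC der_funP scaleN1r der_combE addrC.
  by move/eqP; rewrite subr_eq0 => /eqP.
elim: m => [|m [c cm]]; first by exists (fun=> 0) => a; exact: powI0.
pose E := D - der_comb c; pose e i := der_fun E (x i).
exists (fun i => c i + e i).
have E'E a : der_fun (D - der_comb (fun i => c i + e i)) a =
    der_fun E a - der_fun (der_comb e) a.
  rewrite /E -!scaleN1r !(addrC D) !der_funP !scaleN1r !der_combE.
  rewrite addrAC -opprD -big_split /=; congr (- _ + _); apply: eq_bigr => i _.
  by rewrite mulrDl.
apply: der_powI_step => [a|j]; rewrite E'E.
  rewrite memvB ?cm // der_combE; apply: memv_suml => i _.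
  by rewrite mulC powI_left ?cm.
by rewrite -memvN opprB der_combE_x // => i; exact: cm.
Qed.

Lemma der_prescribed (b : 'I_n -> A) : exists D : Der A, forall j, der_fun D (x j) = b j.
Proof.
suff H m : exists D : Der A, forall j, b j - der_fun D (x j) \in I m.
  have [N IN] := powI_nil; have [D DN] := H N; exists D => j.
  by have /eqP := IN _ (DN j); rewrite subr_eq0 => /eqP.
elim: m => [|m [D Dm]]; first by exists 0 => j; exact: powI0.
pose e i := b i - der_fun D (x i); exists (D + der_comb e) => j.
rewrite der_funD opprD addrA -memvN opprB; exact: der_combE_x.
Qed.

Lemma der_eq0 (D : Der A) : (forall j, der_fun D (x j) = 0) -> forall a, der_fun D a = 0.
Proof.
move=> Dx a; have [N IN] := powI_nil; apply: IN; elim: N a => [|m IH] a.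
  exact: powI0.
by apply: der_powI_step => // j; rewrite Dx mem0v.
Qed.

(** The derivations with D_i x_j = delta_ij commute, because their brackets kill
    the coordinates, and a derivation is determined by its values there. *)
Lemma exact_ders : exists D : 'I_n -> Der A,
  (forall i j, der_fun (D i) (x j) = (i == j)%:R) /\
  (forall i j a, der_fun (D i) (der_fun (D j) a) = der_fun (D j) (der_fun (D i) a)).
Proof.
have [D DE] := fin_all_exists (fun i => der_prescribed (fun j => (i == j)%:R)).
exists D; split=> // i j a; apply/eqP; rewrite -subr_eq0 -der_liebE.
apply/eqP/der_eq0 => l; rewrite der_liebE !DE.
by rewrite -!scaler_nat !linearZ /= !der_fun1 oppr0 !scaler0 addr0.
Qed.

(** * Dimension counts for exact derivations *)

Section Tower.
Variable p : nat.
Hypothesis charkp : p \in [pchar k].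

(** The elements a of V such that D a, ..., D^(m-1) a lie in V and D^m a = 0. *)
Fixpoint derker (D : Der A) (V : {vspace A}) (m : nat) : {vspace A} :=
  if m is m'.+1 then (V :&: (der_fun D @^-1: derker D V m'))%VS else 0%VS.

Section Step.
Variables (D : Der A) (z : A) (V : {vspace A}).
Hypothesis Dz : der_fun D z = 1.
Hypothesis zV : forall a, a \in V -> z * a \in V.

Lemma mem_derkerS m a :
  (a \in derker D V m.+1) = (a \in V) && (der_fun D a \in derker D V m).
Proof. by rewrite memv_cap -memv_preim. Qed.

Lemma derker_sub m : (derker D V m <= V)%VS.
Proof. by case: m => [|m]; [exact: sub0v | exact: capvSl]. Qed.

Lemma der_fun_expr j : der_fun D (z ^+ j.+1) = j.+1%:R *: z ^+ j.
Proof.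
elim: j => [|j IH]; first by rewrite expr1 Dz expr0 scale1r.
rewrite exprS der_funM Dz mul1r IH -scalerAr -exprS.
by rewrite -[j.+2]add1n natrD scalerDl scale1r.
Qed.

(** Integration by parts: the integral of z^j b is z^(j+1) b / (j+1) minus the
    integral of z^(j+1) D(b) / (j+1), and the denominators stay below p. *)
Lemma der_antiderivative m j b : (j + m < p)%N -> b \in derker D V m ->
  exists2 a, a \in V & der_fun D a = z ^+ j * b.
Proof.
elim: m j b => [|m IH] j b jm.
  by rewrite memv0 => /eqP ->; exists 0; rewrite ?mem0v // linear0 mulr0.
rewrite mem_derkerS => /andP[bV Db].
have [|a' a'V a'E] := IH j.+1 _ _ Db; first by rewrite addSnnS.
have nj : j.+1%:R != 0 :> k.
  rewrite -(dvdn_pcharf charkp); apply/negP => /(dvdn_leq (ltn0Sn j)).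
  by apply/negP; rewrite -ltnNge; apply: leq_trans jm; rewrite ltnS addnS ltnS leq_addr.
have zXV i : z ^+ i * b \in V.
  by elim: i => [|i IHi]; rewrite ?expr0 ?mul1r // exprS -mulrA zV.
exists (j.+1%:R^-1 *: (z ^+ j.+1 * b - a')).
  by rewrite memvZ ?memvB.
rewrite linearZ linearB /= der_funM der_fun_expr a'E addrK.
by rewrite -scalerAl scalerA mulVf // scale1r.
Qed.

(** For m < p, D maps the elements killed by D^(m+1) onto those killed by D^m,
    with kernel the elements killed by D. *)
Lemma dim_derker m : (m <= p)%N -> \dim (derker D V m) = (m * \dim (derker D V 1))%N.
Proof.
elim: m => [|m IH] mp; first by rewrite dimv0.
rewrite -(limg_ker_dim (der_fun D)) mulSn -IH 1?ltnW //; congr (_ + _)%N.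
  congr (\dim _); apply/vspaceP => a.
  rewrite memv_cap !mem_derkerS memv_ker /= memv0.
  by case: eqP => [->|_]; rewrite ?mem0v ?andbT ?andbF.
congr (\dim _); apply/vspaceP => b; apply/memv_imgP/idP => [[a + ->]|bK].
  by rewrite mem_derkerS => /andP[].
have [|a aV aE] := @der_antiderivative m 0 b _ bK; first by rewrite add0n.
rewrite expr0 mul1r in aE; exists a => //.
by rewrite mem_derkerS aV aE.
Qed.

Lemma dim_derker_le : (p * \dim (derker D V 1) <= \dim V)%N.
Proof. by rewrite -dim_derker // dimvS // derker_sub. Qed.

(** The dimensions force V to be the set of elements killed by D^p, so D is
    nilpotent on M; the last nonzero iterated image of M is killed by D. *)
Lemma derker_meet (M : {vspace A}) : (\dim V <= p * \dim (derker D V 1))%N ->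
    (M <= V)%VS -> (forall a, a \in M -> der_fun D a \in M) -> M != 0%VS ->
  (M :&: derker D V 1 != 0)%VS.
Proof.
move=> dV; have Vp : V = derker D V p.
  by apply/esym/eqP; rewrite eqEdim derker_sub dim_derker.
rewrite [X in (_ <= X)%VS]Vp {Vp dV}.
elim: p M => [|m IH] M sM DM nM; first by rewrite subv0 (negPf nM) in sM.
have [DM0|nDM] := eqVneq (der_fun D @: M)%VS 0%VS.
  suff /capv_idPl-> : (M <= derker D V 1)%VS by [].
  apply/subvP => a aM; move/subvP: sM => /(_ a aM); rewrite !mem_derkerS => /andP[-> _].
  by rewrite /= -DM0 memv_img.
have sDM : (der_fun D @: M <= M)%VS by apply/subvP => _ /memv_imgP[a aM ->]; exact: DM.
have /IH-/(_ _ nDM) : (der_fun D @: M <= derker D V m)%VS.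
  apply/subvP => _ /memv_imgP[a aM ->]; move/subvP: sM => /(_ a aM).
  by rewrite mem_derkerS => /andP[].
have DDM a : a \in (der_fun D @: M)%VS -> der_fun D a \in (der_fun D @: M)%VS.
  by move=> aM; apply: memv_img; apply: (subvP sDM).
move=> /(_ DDM); apply: contraNneq => M0.
by rewrite -subv0 -M0; apply: capvS.
Qed.

End Step.

Section ExactDerivations.
Variable D : 'I_n -> Der A.
Hypothesis DxE : forall i j, der_fun (D i) (x j) = (i == j)%:R.
Hypothesis D_comm : forall i j a,
  der_fun (D i) (der_fun (D j) a) = der_fun (D j) (der_fun (D i) a).

(** The common kernel of the D i with i in s, as a tower of single kernels. *)
Definition kers (s : seq 'I_n) : {vspace A} :=
  foldr (fun i V => derker (D i) V 1) fullv s.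

Lemma mem_kers s a : (a \in kers s) = all (fun i => der_fun (D i) a == 0) s.
Proof.
elim: s => [|i s IH]; first exact: memvf.
by rewrite /= memv_cap -memv_preim memv0 IH andbC.
Qed.

Lemma kers_der s i a : a \in kers s -> der_fun (D i) a \in kers s.
Proof.
rewrite !mem_kers => /allP as0; apply/allP => j js.
by rewrite D_comm (eqP (as0 j js)) linear0.
Qed.

Lemma kers_mulx s i a : i \notin s -> a \in kers s -> x i * a \in kers s.
Proof.
rewrite !mem_kers => nis /allP as0; apply/allP => j js.
rewrite der_funM (eqP (as0 j js)) DxE mulr0 addr0.
by case: (j =P i) js nis => [->|_ _ _]; [move=> -> | rewrite mul0r].
Qed.

Lemma kers1 s : 1 \in kers s.
Proof. by rewrite mem_kers; apply/allP => i _; rewrite der_fun1. Qed.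

Lemma kers_tower s t : uniq (t ++ s) ->
  (p ^ size t * \dim (kers (t ++ s)) <= \dim (kers s))%N.
Proof.
elim: t => [|i t IH] /=; first by rewrite mul1n.
case/andP => nits uts; apply: leq_trans (IH uts); rewrite expnSr -mulnA leq_mul2l.
apply/orP; right; apply: (@dim_derker_le (D i) (x i) (kers (t ++ s))).
- by rewrite DxE eqxx.
- by move=> a; apply: kers_mulx.
Qed.

Lemma kers_gt0 s : (0 < \dim (kers s))%N.
Proof.
rewrite lt0n dimv_eq0; apply/eqP => s0; have := kers1 s.
by rewrite s0 memv0 (negPf (oner_neq0 _)).
Qed.

(** The reverse of [dim_derker_le]. All the inequalities
    p dim (kers (i :: s)) <= dim (kers s) in the tower from A down to the kernel
    of all D i multiply to p^n <= dim A, so each of them is an equality. *)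
Lemma kers_step s i : uniq (i :: s) -> (\dim {:A} <= p ^ n)%N ->
  (\dim (kers s) <= p * \dim (derker (D i) (kers s) 1))%N.
Proof.
(* The tower is continued below i :: s by the remaining indices r. *)
move=> us dA; pose r := [seq j <- enum 'I_n | j \notin i :: s].
have ur : uniq (r ++ i :: s).
  rewrite cat_uniq us filter_uniq ?enum_uniq // andbT.
  by apply/hasPn => j js; rewrite mem_filter js.
have sr : (size r + size (i :: s))%N = n.
  rewrite -[RHS]size_enum_ord -size_cat; apply: perm_size; apply: uniq_perm; rewrite ?enum_uniq // => j.
  by rewrite mem_cat mem_filter mem_enum andbT orNb.
have p0 : (0 < p)%N by rewrite prime_gt0 // (pcharf_prime charkp).
have h1 : (p ^ size r <= \dim (kers (i :: s)))%N.
  by apply: leq_trans (kers_tower ur); rewrite leq_pmulr ?kers_gt0.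
apply: (@leq_trans (p ^ (size r).+1)); last by rewrite expnS leq_mul2l h1 orbT.
rewrite -(@leq_pmul2l (p ^ size s)) ?expn_gt0 ?p0 // -expnD addnC addSnnS sr.
apply: leq_trans dA; have := @kers_tower [::] s; rewrite cats0.
by case/andP: us => _ us /(_ us).
Qed.

(** The D i are nilpotent on the successive kernels, so a nonzero stable
    subspace reaches each of them. *)
Lemma kers_meet s (M : {vspace A}) : uniq s -> (\dim {:A} <= p ^ n)%N ->
    (forall i a, a \in M -> der_fun (D i) a \in M) -> M != 0%VS ->
  (M :&: kers s != 0)%VS.
Proof.
move=> + dA DM nM; elim: s => [|i s IH] us; first by rewrite capvf.
have us' : uniq s by case/andP: us.
have := @derker_meet (D i) (x i) (kers s) _ _ (M :&: kers s)%VS (kers_step us dA).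
move=> H; have {}H : ((M :&: kers s) :&: derker (D i) (kers s) 1 != 0)%VS.
  apply: H.
  - by rewrite DxE eqxx.
  - by move=> a; apply: kers_mulx; case/andP: us.
  - exact: capvSr.
  - by move=> a; rewrite !memv_cap => /andP[aM aK]; rewrite DM // kers_der.
  - exact: IH.
apply: contraNneq H => e; rewrite -subv0 -e -capvA; apply: capvS => //.
exact: capvSr.
Qed.

End ExactDerivations.

Lemma dim_ge_expn : (p ^ n <= \dim {:A})%N.
Proof.
have [D [DxE D_comm]] := exact_ders.
have := @kers_tower D DxE [::] (enum 'I_n); rewrite cats0 size_enum_ord.
move/(_ (enum_uniq _)); apply: leq_trans; rewrite leq_pmulr //.
exact: kers_gt0.
Qed.

(** A nonzero stable ideal meets the common kernel of exact derivations, which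
    has dimension at most dim A / p^n = 1, so it is k. *)
Lemma dim_le_dsimple : (\dim {:A} <= p ^ n)%N -> dsimple.
Proof.
move=> dA M lM dM; have [M0|nM] := eqVneq M 0%VS; [by left | right].
have [D [DxE D_comm]] := exact_ders.
pose e := enum 'I_n.
have := @kers_meet D DxE D_comm e M (enum_uniq _) dA (fun i => dM (D i)) nM.
rewrite -vpick0; set c := vpick _; move=> nc.
have := memv_pick (M :&: kers D e)%VS; rewrite -/c memv_cap => /andP[cM cK].
have de : (\dim (kers D e) <= 1)%N.
  have p0 : (0 < p)%N by rewrite prime_gt0 // (pcharf_prime charkp).
  rewrite -(@leq_pmul2l (p ^ n)) ?expn_gt0 ?p0 // muln1; apply: leq_trans dA.
  have := @kers_tower D DxE [::] (enum 'I_n); rewrite cats0 size_enum_ord.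
  by move/(_ (enum_uniq _)).
have e1 : (1 == kers D e)%VS.
  by rewrite eqEdim dimv1 de -memvE kers1.
move: cK; rewrite -(eqP e1) => /vlineP[l cE]; have nl : l != 0.
  by apply: contraNneq nc => l0; rewrite cE l0 scale0r.
apply/vspaceP => a; rewrite memvf -[a]mulr1; apply: lM.
by rewrite -[1](scalerK nl) memvZ // -cE.
Qed.

Section UpperBound.
Hypothesis xp : forall i, x i ^+ p = 0.

(** The span of the monomials in the x i, i in s, with exponents below p. *)
Definition monos (s : seq 'I_n) : {vspace A} :=
  foldr (fun i W => (\sum_(j < p) <[x i ^+ j]> * W)%VS) 1%VS s.

Lemma dim_monos s : (\dim (monos s) <= p ^ size s)%N.
Proof.
elim: s => [|i s IH] /=; first by rewrite dimv1.
apply: leq_trans (dimv_leq_sum _ _ _) _.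
apply: (@leq_trans (\sum_(j < p) p ^ size s)); last first.
  by rewrite sum_nat_const card_ord expnS.
apply: leq_sum => j _; apply: leq_trans (dim_prodv _ _) _.
by rewrite -[X in (_ <= X)%N]mul1n leq_mul // dim_vline; case: (_ != _).
Qed.

Lemma mem_monosS s i (j : nat) b : b \in monos s -> x i ^+ j * b \in monos (i :: s).
Proof.
move=> bs; have [jp|pj] := ltnP j p; last first.
  by rewrite -(subnK pj) exprD xp mulr0 mul0r mem0v.
apply: (subvP (sumv_sup (Ordinal jp) isT (subvv _))).
by rewrite memv_mul // memv_line.
Qed.

Lemma monos1 s : 1 \in monos s.
Proof.
elim: s => [|i s IH]; first exact: memv_line.
by have := @mem_monosS s i 0 _ IH; rewrite expr0 mul1r.
Qed.

Lemma monos_mulx s i a : i \in s -> a \in monos s -> x i * a \in monos s.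
Proof.
elim: s a => // j s IH a; rewrite inE => ijs.
have closed : (monos (j :: s) <= amull (x i) @^-1: monos (j :: s))%VS.
  apply/subv_sumP => l _; apply/prodvP => _ b /vlineP[c ->] bs.
  rewrite -memv_preim lfunE /= -scalerAl -scalerAr memvZ //.
  have [->|nij] := eqVneq i j; first by rewrite mulrA -exprS mem_monosS.
  rewrite (negPf nij) /= in ijs.
  by rewrite mulrA (mulC (x i)) -mulrA mem_monosS ?IH.
by move/(subvP closed); rewrite -memv_preim lfunE.
Qed.

Lemma monos_full : monos (enum 'I_n) = fullv.
Proof.
apply: (@subspace_full _ (\sum_i <[x i]>)%VS); first exact: monos1.
  apply/prodvP => _ b /memv_sumP[u uE ->] bB.
  rewrite mulr_suml; apply: memv_suml => i _; have /vlineP[c ->] := uE i isT.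
  by rewrite -scalerAl memvZ // monos_mulx // mem_enum.
apply/subvP => a aJ; have [q [qJ ->]] := coord_decomp a.
move: aJ; rewrite memv_ker => /eqP ->; rewrite scale0r add0r.
apply: memv_add => //; apply: memv_sumr => i _; exact/memvZ/memv_line.
Qed.

Lemma dim_le_expn : (\dim {:A} <= p ^ n)%N.
Proof. by rewrite -monos_full -[in X in (_ <= X)%N](size_enum_ord n) dim_monos. Qed.

End UpperBound.

End Tower.
End Coordinates.
End CommutativeAugmented.
End Augmented.

(** * The group algebra as the dual of the coordinate ring *)

Section TensorFunctionals.
Variables (k : fieldType) (B C : vectType k).

Definition pair_fun (f : 'Hom(B, k^o)) (g : 'Hom(C, k^o)) (x : B) (y : C) : k^o := f x * g y.

Lemma bilin_pair_fun f g : bilin (pair_fun f g).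
Proof.
split=> [y|x] c u v; rewrite /pair_fun linearP; first by rewrite mulrDl -scalerAl.
by rewrite mulrDr -scalerAr.
Qed.

Lemma tens_sep (t : tens B C) : (forall f g, tens_lift (pair_fun f g) t = 0) -> t = 0.
Proof.
move=> t0; apply/matrixP => i j; rewrite mxE.
have [f fE] := @mk_lfun _ B k^o (coord (vbasis {:B}) i) (@linearP _ _ _ _ _).
have [g gE] := @mk_lfun _ C k^o (coord (vbasis {:C}) j) (@linearP _ _ _ _ _).
rewrite -[RHS](t0 f g) /tens_lift (bigD1 i) //= (bigD1 j) //= /pair_fun fE gE.
rewrite !coord_free ?(basis_free (vbasisP _)) // !eqxx mulr1 [_ *: 1]mulr1.
rewrite !big1 ?addr0 // => [i' /negPf ni|j' /negPf nj].
  rewrite big1 // => j' _.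
  by rewrite fE coord_free ?(basis_free (vbasisP _)) // ni mul0r scaler0.
by rewrite gE coord_free ?(basis_free (vbasisP _)) // nj mulr0 scaler0.
Qed.

End TensorFunctionals.

Section GroupAlgebraBasics.
Variables (k : fieldType) (U : finGroupScheme k).
Local Notation A := (groupAlg U).
Implicit Types (a b c : A) (o x y : U).

Lemma gapp_is_linear a : linear (gapp a). Proof. exact: linearP. Qed.

Lemma gapp_sep x : (forall a, gapp a x = 0) -> x = 0.
Proof.
move=> x0; apply/eqP; rewrite -memv0; apply: contraT => nx.
have [f [fx _]] := functional_sep nx; have := x0 f.
by rewrite /gapp fx => /eqP; rewrite oner_eq0.
Qed.

Lemma gapp0 x : gapp (0 : A) x = 0. Proof. by rewrite /gapp lfunE. Qed.

Lemma gapp_sum I (r : seq I) (F : I -> A) x :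
  gapp (\sum_(i <- r) F i) x = \sum_(i <- r) gapp (F i) x.
Proof.
elim: r => [|i r IH]; first by rewrite !big_nil gapp0.
by rewrite !big_cons gappD IH.
Qed.

Lemma gapp_repr (phi : 'Hom(A, k^o)) : exists o, forall a, phi a = gapp a o.
Proof.
pose e := vbasis {:U}.
have [f fE] := fin_all_exists (fun i => @mk_lfun _ U k^o (coord e i) (@linearP _ _ _ _ _)).
pose F i : A := f i; exists (\sum_(i < \dim {:U}) phi (F i) *: e`_i) => a.
have aE : a = \sum_(i < \dim {:U}) gapp a e`_i *: F i.
  apply: gextP => x; rewrite gapp_sum {1}(coord_vbasis (memvf x)) -/e linear_sum.
  by apply: eq_bigr => i _; rewrite linearZ gappZ [gapp (F i) x]fE; apply: mulrC.
rewrite {1}aE !linear_sum; apply: eq_bigr => i _.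
by rewrite !linearZ; apply: mulrC.
Qed.

Lemma gmul_pair a b x : gapp (a * b) x = tens_lift (pair_fun (gapp a) (gapp b)) (comul x).
Proof. exact: gmulE. Qed.

Definition gev_fun (o : U) (a : A) : k^o := gapp a o.
Fact gev_is_linear o : linear (gev_fun o).
Proof. by move=> c a b; rewrite /gev_fun gappD gappZ. Qed.
HB.instance Definition _ o := GRing.isLinear.Build k A k^o _ (gev_fun o) (gev_is_linear o).
Definition gev (o : U) : 'Hom(A, k^o) := linfun (gev_fun o).

Lemma gevE o a : gev o a = gapp a o. Proof. exact: lfunE. Qed.

Definition gaug : 'Hom(A, k^o) := gev 1.

Lemma gaugE a : gaug a = gapp a 1. Proof. exact: gevE. Qed.

Lemma gapp1 x : gapp (1 : A) x = counit x. Proof. by []. Qed.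

Lemma gaug1 : gaug 1 = 1. Proof. by rewrite gaugE gapp1 rmorph1. Qed.

Lemma gaugM a b : gaug (a * b) = gaug a * gaug b.
Proof.
rewrite !gaugE gmul_pair rmorph1 -ptens1 tens_liftE //; exact: bilin_pair_fun.
Qed.

(** The action of O on its dual by transposed multiplication. *)
Definition gact (o : U) (a : A) : A := (gapp a \o amull o)%VF.

Lemma gactE o a x : gapp (gact o a) x = gapp a (o * x).
Proof. by rewrite /gapp /gact comp_lfunE lfunE. Qed.

Lemma gact_linear o : linear (gact o).
Proof. by move=> c a b; apply: gextP => x; rewrite gappD gappZ !gactE gappD gappZ. Qed.

HB.instance Definition _ o :=
  GRing.isLinear.Build k A A _ (gact o) (gact_linear o).

Lemma gact_linearl a : linear (gact^~ a).
Proof.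
by move=> c o o'; apply: gextP => x; rewrite gappD gappZ !gactE mulrDl -scalerAl linearP.
Qed.

Lemma gactM o o' a : gact (o * o') a = gact o' (gact o a).
Proof. by apply: gextP => x; rewrite !gactE mulrA. Qed.

Lemma gactC o o' a : gact o (gact o' a) = gact o' (gact o a).
Proof. by rewrite -!gactM coord_mulC. Qed.

Lemma gact1 a : gact 1 a = a.
Proof. by apply: gextP => x; rewrite gactE mul1r. Qed.

Lemma gaug_act o a : gaug (gact o a) = gapp a o.
Proof. by rewrite gaugE gactE mulr1. Qed.

Lemma pair_act a b x y (t : tens U U) :
  tens_lift (pair_fun (gapp a) (gapp b)) ((x *t y) * t)
  = tens_lift (pair_fun (gapp (gact x a)) (gapp (gact y b))) t.
Proof.
elim/tens_ind: t => [u v|c s t Hs Ht]; last first.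
  by rewrite mulrDr -scalerAr !linearP /= Hs Ht.
rewrite ptensM !tens_liftE; try exact: bilin_pair_fun.
by rewrite /pair_fun !gactE.
Qed.

Definition primitive (v : U) : Prop := comul v = v *t 1 + 1 *t v.

(** In terms of A, a primitive element is a tangent vector at eps of A, through
    the evaluation a |-> a(v). *)
Lemma primitiveP v : primitive v <->
  (forall a b, gapp (a * b) v = gapp a v * gapp b 1 + gapp a 1 * gapp b v).
Proof.
have vE a b : tens_lift (pair_fun (gapp a) (gapp b)) (v *t 1 + 1 *t v)
    = gapp a v * gapp b 1 + gapp a 1 * gapp b v.
  by rewrite linearD /= !tens_liftE //; exact: bilin_pair_fun.
split=> [vP a b|vP]; first by rewrite gmul_pair vP vE.
apply/eqP; rewrite -subr_eq0; apply/eqP; apply: tens_sep => f g.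
rewrite linearB /= -[X in X - _](gmul_pair (f : A) (g : A)) vP.
by rewrite (vE (f : A) (g : A)) subrr.
Qed.

Lemma primitive_linear (r : k) u v : primitive u -> primitive v -> primitive (r *: u + v).
Proof.
move=> /primitiveP uP /primitiveP vP; apply/primitiveP => a b.
rewrite !(gapp_is_linear _ r) uP vP !mulrDl !mulrDr !scalerDr -scalerAl -scalerAr.
by rewrite addrACA.
Qed.

Lemma primitive0 : primitive 0.
Proof. by apply/primitiveP => a b; rewrite !linear0 mul0r mulr0 addr0. Qed.

Lemma primitive_counit v : primitive v -> counit v = 0 :> k^o.
Proof.
move/primitiveP/(_ 1 1); rewrite mulr1 !gapp1 rmorph1 mulr1 mul1r => /eqP.
by rewrite -subr_eq subrr eq_sym => /eqP.
Qed.

(** Multiplicativity of comul gives comul (v x) = (v (x) 1 + 1 (x) v) comul x. *)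
Lemma primitive_actM v a b : primitive v ->
  gact v (a * b) = gact v a * b + a * gact v b.
Proof.
move=> vP; apply: gextP => x; rewrite gappD gactE !gmul_pair rmorphM /= vP.
by rewrite mulrDl linearD /= !pair_act !gact1.
Qed.

Lemma primitive_pow p v : p \in [pchar k] -> primitive v -> primitive (v ^+ p).
Proof.
move=> charkp vP; rewrite /primitive rmorphXn /= vP.
have chT : p \in [pchar (tens U U)] by rewrite pchar_lalg.
rewrite -(pFrobenius_autE chT) pFrobenius_autD_comm; last first.
  by rewrite /GRing.comm !ptensM !mul1r !mulr1.
by rewrite !pFrobenius_autE !ptensX !expr1n.
Qed.

Lemma primitive_der v : primitive v ->
  exists d : Der A, forall a, der_fun d a = gact v a.
Proof.
by move=> vP; apply: mk_der; [exact: gact_linear | move=> a b; exact: primitive_actM].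
Qed.

Lemma point_der_primitive (f : 'Hom(A, k^o)) : point_der gaug f ->
  exists2 v, primitive v & forall a, f a = gapp a v.
Proof.
move=> fd; have [v fE] := gapp_repr f; exists v => //.
by apply/primitiveP => a b; rewrite -!fE fd !gaugE.
Qed.

Lemma gaug_translation (f : 'Hom(A, k^o)) : point_der gaug f ->
  exists d : Der A, forall a, gaug (der_fun d a) = f a.
Proof.
move=> fd; have [v vP fE] := point_der_primitive fd.
by have [d dE] := primitive_der vP; exists d => a; rewrite dE gaug_act fE.
Qed.

(** The augmentation ideal is a maximal left ideal, hence the only one, and a
    proper left ideal is contained in a maximal one. *)
Lemma unipotent_local : unipotent_gs U ->
  forall M : {vspace A}, left_ideal M -> M <> fullv -> (M <= lker gaug)%VS.
Proof.
move=> [M0 [_ M0u]] M lM nM.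
have Jl : left_ideal (lker gaug) by move=> a b; exact: (aug_mull gaugM).
have Jn : lker gaug <> fullv.
  move=> e; have := memvf (1 : A); rewrite -e memv_ker gaug1.
  by rewrite (negPf (oner_neq0 _)).
have maxJ : maximal_left_ideal (lker gaug).
  split=> // N lN sN; have [NJ|/subvPn[a aN naJ]] := boolP (N <= lker gaug)%VS.
    by left; apply/eqP; rewrite eqEsubv NJ sN.
  right; apply/vspaceP => b; rewrite memvf.
  have na : gaug a != 0 by rewrite -memv_ker.
  have N1 : 1 \in N.
    have -> : 1 = (gaug a)^-1 *: (a - (a - gaug a *: 1)) :> A.
      by rewrite opprB addrC subrK scalerA mulVf // scale1r.
    by rewrite memvZ // memvB // (subvP sN) // (aug_sub gaug1).
  by rewrite -[b]mulr1 lN.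
rewrite -(M0u _ maxJ).
have [N [sN [lN nN] mN]] :=
  @maximal_vspace _ _ (fun N : {vspace A} => left_ideal N /\ N <> fullv) M (conj lM nM).
rewrite (M0u N) //; split=> // X lX sX.
by have [->|nX] := classic (X = fullv); [right | left; apply: mN].
Qed.

End GroupAlgebraBasics.

(** * Integrals and the symmetric form on the group algebra *)

Section Integrals.
Variables (k : fieldType) (U : finGroupScheme k).
Local Notation A := (groupAlg U).
Implicit Types (a b c : A) (o x y : U).

(** In Sweedler notation: S(o_1) o_2 (x) o_3 = 1 (x) o. *)
Lemma antipode_shiftl o :
  tens_lift (fun x y => (antipode x *t 1) * comul y) (comul o) = 1 *t o :> tens U U.
Proof.
have [pl pr] := bilin_ptens U U; have lS := ahom_lin (@antipode k U).
have lD := ahom_lin (@comul k U).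
pose G x (w : tens U U) := (antipode x *t 1) * w.
have bG : bilin G.
  split=> [w|x] r u v; last by rewrite /G mulrDr -scalerAr.
  by rewrite /G lS pl mulrDl -scalerAl.
pose m x y : U := antipode x * y.
have bm : bilin m.
  split=> [y|x] r u v; first by rewrite /m lS mulrDl -scalerAl.
  by rewrite /m mulrDr -scalerAr.
pose H (xy : tens U U) (z : U) : tens U U := tens_lift m xy *t z.
have bH : bilin H.
  by split=> [z|s] r u v; rewrite /H ?linearP ?pl ?pr.
have GH (w : tens (tens U U) U) : tens_lift G (tassoc w) = tens_lift H w.
  elim/tens_ind: w => [xy z|r u v Hu Hv]; last by rewrite tassoc_linear !linearP /= Hu Hv.
  rewrite [RHS]tens_liftE //; elim/tens_ind: xy => [x y|r u v Hu Hv].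
    by rewrite tassocE tens_liftE // /H tens_liftE // /G ptensM mul1r.
  have [ql _] := bilin_ptens (tens U U) U.
  by rewrite ql tassoc_linear linearP /= Hu Hv bH.1.
transitivity (tens_lift G (tmap id comul (comul o))); first by rewrite tens_lift_tmap.
rewrite -comulA GH tens_lift_tmap // -{2}[o]counitl (lin_tens_lift _ _ (pr 1)).
apply: eq_tens_lift => x y; rewrite /H antipodel.
have zl := pl y (counit x) 1 0; rewrite addr0 ptens0l addr0 in zl.
have zr := pr 1 (counit x) y 0; rewrite addr0 ptens0r addr0 in zr.
by rewrite zl zr.
Qed.

(** In Sweedler notation: o_1 (x) S(o_3) o_2 = o (x) 1. *)
Lemma antipode_shiftr o :
  tens_lift (fun x y => (1 *t antipode y) * comul x) (comul o) = o *t 1 :> tens U U.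
Proof.
have [pl pr] := bilin_ptens U U; have lS := ahom_lin (@antipode k U).
have lD := ahom_lin (@comul k U).
pose G (w : tens U U) z := (1 *t antipode z) * w.
have bG : bilin G.
  split=> [x|w] r u v; first by rewrite /G mulrDr -scalerAr.
  by rewrite /G lS pr mulrDl -scalerAl.
pose m x y : U := antipode y * x.
have bm : bilin m.
  split=> [y|x] r u v; first by rewrite /m mulrDr -scalerAr.
  by rewrite /m lS mulrDl -scalerAl.
pose H (x : U) (yz : tens U U) : tens U U := x *t tens_lift m yz.
have bH : bilin H.
  by split=> [z|s] r u v; rewrite /H ?linearP ?pl ?pr.
have GH (w : tens (tens U U) U) : tens_lift G w = tens_lift H (tassoc w).
  elim/tens_ind: w => [xy z|r u v Hu Hv]; last by rewrite tassoc_linear !linearP /= Hu Hv.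
  rewrite [LHS]tens_liftE //; elim/tens_ind: xy => [x y|r u v Hu Hv].
    by rewrite tassocE tens_liftE // /H tens_liftE // /G ptensM mul1r.
  have [ql _] := bilin_ptens (tens U U) U.
  by rewrite ql tassoc_linear linearP /= -Hu -Hv bG.1.
transitivity (tens_lift G (tmap comul id (comul o))); first by rewrite tens_lift_tmap.
rewrite GH comulA tens_lift_tmap // -{2}[o]counitr (lin_tens_lift _ _ (pl 1)).
apply: eq_tens_lift => x y; rewrite /H.
have -> : tens_lift m (comul y) = (counit y : k) *: (1 : U).
  by rewrite -antipoder; apply: eq_tens_lift => u v; rewrite /m coord_mulC.
have zl := pl 1 (counit y) x 0; rewrite addr0 ptens0l addr0 in zl.
have zr := pr x (counit y) 1 0; rewrite addr0 ptens0r addr0 in zr.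
by rewrite zl zr.
Qed.

Definition integral (lam : U) : Prop := forall o, o * lam = (counit o : k) *: lam.

Lemma mulr_lin (B : falgType k) (t : B) : linear (fun s : B => s * t).
Proof. by move=> r u v; rewrite mulrDl -scalerAl. Qed.

(** By [antipode_shiftl] the left-hand side is (S(o_1) (x) 1) comul(o_2 lam), and
    o_2 lam = counit(o_2) lam. *)
Lemma integral_shiftl lam o : integral lam ->
  (1 *t o) * comul lam = (antipode o *t 1) * comul lam.
Proof.
move=> lamI; have [pl pr] := bilin_ptens U U; have lS := ahom_lin (@antipode k U).
rewrite -antipode_shiftl (lin_tens_lift _ _ (mulr_lin (comul lam))).
rewrite -{2}[o]counitr (lin_tens_lift _ _ lS) (lin_tens_lift _ _ (pl 1)).
rewrite (lin_tens_lift _ _ (mulr_lin (comul lam))); apply: eq_tens_lift => x y.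
rewrite -mulrA -rmorphM /= lamI linearZ /=.
have zl := pl 1 (counit y) (antipode x) 0; rewrite addr0 ptens0l addr0 in zl.
by rewrite linearZ /= zl -scalerAl scalerAr.
Qed.

Lemma integral_shiftr lam o : integral lam ->
  (o *t 1) * comul lam = (1 *t antipode o) * comul lam.
Proof.
move=> lamI; have [pl pr] := bilin_ptens U U; have lS := ahom_lin (@antipode k U).
rewrite -antipode_shiftr (lin_tens_lift _ _ (mulr_lin (comul lam))).
rewrite -{2}[o]counitl (lin_tens_lift _ _ lS) (lin_tens_lift _ _ (pr 1)).
rewrite (lin_tens_lift _ _ (mulr_lin (comul lam))); apply: eq_tens_lift => x y.
rewrite -mulrA -rmorphM /= lamI linearZ /=.
have zr := pr 1 (counit x) (antipode y) 0; rewrite addr0 ptens0r addr0 in zr.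
by rewrite linearZ /= zr -scalerAl scalerAr.
Qed.

(** For the form (a, b) |-> (a b)(lam), the adjoint of o is S(o). *)
Lemma integral_actl lam o a b : integral lam ->
  gapp (a * gact o b) lam = gapp (gact (antipode o) a * b) lam.
Proof.
move=> lamI; rewrite !gmul_pair -{1}[a]gact1 -pair_act (integral_shiftl o lamI).
by rewrite pair_act gact1.
Qed.

Lemma integral_actr lam o a b : integral lam ->
  gapp (gact o a * b) lam = gapp (a * gact (antipode o) b) lam.
Proof.
move=> lamI; rewrite !gmul_pair -{1}[b]gact1 -pair_act (integral_shiftr o lamI).
by rewrite pair_act gact1.
Qed.

(** A Fitting argument at the ideal ker counit: on an ideal N minimal among
    those not contained in ker counit, every m in ker counit acts nilpotently,
    since the elements killed by a power of m form such an ideal too.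
    Hence ker counit annihilates a minimal nonzero ideal inside N. *)
Lemma integral_ex : exists2 lam : U, lam != 0 & integral lam.
Proof.
pose ideal (N : {vspace U}) := forall o x, x \in N -> o * x \in N.
pose Q N := ideal N /\ exists2 x, x \in N & counit x != 0 :> k^o.
have QT : Q fullv.
  split=> [o x _|]; first exact: memvf.
  by exists 1; rewrite ?memvf // rmorph1 oner_eq0.
have [N [_ [iN [x0 x0N nx0]] mN]] := minimal_vspace QT.
have nil (m : U) : counit m = 0 :> k^o -> forall x, x \in N -> exists j, m ^+ j * x = 0.
  move=> m0 x xN; have [| |N1 N1E] := @vspace_of_pred _ U
     (fun x => x \in N /\ exists j, m ^+ j * x = 0).
  - by split; [exact: mem0v | exists 0%N; rewrite mulr0].
  - move=> r u v [uN [i iu]] [vN [j jv]]; split; first by rewrite memvD ?memvZ.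
    exists (i + j)%N; rewrite mulrDr -scalerAr exprD.
    by rewrite -[X in _ + X]mulrA jv mulr0 addr0 (coord_mulC (m ^+ i)) -mulrA iu mulr0 scaler0.
  have sN1 : (N1 <= N)%VS by apply/subvP => y /N1E[].
  suff QN1 : Q N1 by move: xN; rewrite -(mN _ QN1 sN1) => /N1E[].
  split=> [o y /N1E[yN [j jy]]|].
    apply/N1E; split; first exact: iN.
    by exists j; rewrite (coord_mulC o) mulrA jy mul0r.
  pose im j := (amull (m ^+ j.+1) @: N)%VS.
  have [_ [_ [M ->] mM]] :=
    @minimal_vspace _ _ (fun W => exists j, W = im j) (im 0%N) (ex_intro _ 0%N erefl).
  (* The images m^j N become stationary, so x0 is the sum of an element of m N
     and of one killed by a power of m; counit does not vanish on the latter. *)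
  have imM : im (M + M.+1)%N = im M.
    apply: mM; first by exists (M + M.+1)%N.
    apply/subvP => _ /memv_imgP[y yN ->]; rewrite lfunE /= -addSn exprD -mulrA.
    by apply/memv_imgP; exists (m ^+ M.+1 * y); rewrite ?iN // lfunE.
  have : m ^+ M.+1 * x0 \in im (M + M.+1)%N.
    by rewrite imM; apply/memv_imgP; exists x0; rewrite ?lfunE.
  case/memv_imgP => y yN; rewrite lfunE /= -addSn exprD -mulrA => e.
  exists (x0 - m ^+ M.+1 * y).
    apply/N1E; split; first by rewrite memvB ?iN.
    by exists M.+1; rewrite mulrBr e subrr.
  rewrite linearB /= rmorphM rmorphXn /= m0.
  by rewrite expr0n /= mul0r subr0.
have QN' : ideal N /\ N != 0%VS.
  split=> //; apply: contraNneq nx0 => N0.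
  by move: x0N; rewrite N0 memv0 => /eqP ->; rewrite linear0.
have [N' [sN' [iN' nN'] mN']] :=
  @minimal_vspace _ _ (fun N => ideal N /\ N != 0%VS) N QN'.
have tN := memv_pick N'; set t := vpick N' in tN.
have nt : t != 0 by rewrite vpick0.
exists t => // o.
pose m := o - (counit o : k) *: 1.
have m0 : counit m = 0 :> k^o by rewrite linearB linearZ /= rmorph1 [_ *: 1]mulr1 subrr.
suff mt : m * t = 0 by apply/eqP; rewrite -subr_eq0 -[X in _ - X]mul1r -scalerAr scalerAl -mulrBl mt.
have [j jt] := nil m m0 t (subvP sN' _ tN).
suff /subvP/(_ _ tN) : (N' <= lker (amull m))%VS by rewrite memv_ker lfunE /= => /eqP.
rewrite -[N' in X in (X <= _)%VS](mN' (N' :&: lker (amull m))%VS); first exact: capvSr.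
  split=> [o' x|].
    rewrite !memv_cap !memv_ker !lfunE /= => /andP[xN /eqP mx]; rewrite iN' //=.
    by rewrite (coord_mulC o') mulrA mx mul0r.
  elim: j jt => [|j IH] jt; first by rewrite expr0 mul1r in jt; rewrite jt eqxx in nt.
  have [j0|j0] := eqVneq (m ^+ j * t) 0; first exact: IH.
  apply: contraNneq j0 => N0; rewrite -memv0 -N0 memv_cap iN' // memv_ker lfunE /=.
  by rewrite mulrA -exprS jt.
exact: capvSl.
Qed.

Section LocalTrace.
Hypothesis U_unip : unipotent_gs U.
Variable lam : U.
Hypothesis lam0 : lam != 0.
Hypothesis lamI : integral lam.

(** The radical of the form is a left ideal, stable under O because the action
    has adjoints. It is proper, so it lies in J, and an O-stable subspace of J
    is 0 as eps(o . a) = a(o). *)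
Lemma integral_nondeg a : (forall b, gapp (b * a) lam = 0) -> a = 0.
Proof.
have [||N NE] := @vspace_of_pred _ A (fun a => forall b, gapp (b * a) lam = 0).
- by move=> b; rewrite mulr0 gapp0.
- by move=> r u v Hu Hv b; rewrite mulrDr -scalerAr gappD gappZ Hu Hv scaler0 addr0.
have lN : left_ideal N by move=> u v /NE vN; apply/NE => b; rewrite mulrA.
have [N1|/(unipotent_local U_unip lN)/subvP NJ] := classic (N = fullv).
  case/eqP: lam0; apply: gapp_sep => b; rewrite -[b]mulr1.
  by apply: (NE 1).1; rewrite N1 memvf.
move=> aN; apply: gextP => o; rewrite gapp0 -gaug_act.
apply/eqP; rewrite -memv_ker NJ //; apply/NE => b.
by rewrite integral_actl // aN.
Qed.

(** A nondegenerate form represents every linear form. *)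
Lemma integral_dual (o : U) : exists a, forall b, gapp (b * a) lam = gapp b o.
Proof.
pose Phi a : U := tens_lift (fun x y => (gapp a y : k) *: x) (comul lam).
have bPhi a : bilin (fun x y : U => (gapp a y : k) *: x).
  split=> [y|x] r u v; first by rewrite scalerDr !scalerA mulrC.
  by rewrite linearP scalerDl scalerA.
have PhiE a b : gapp b (Phi a) = gapp (b * a) lam.
  rewrite /Phi gmul_pair (lin_tens_lift _ _ (gapp_is_linear b)).
  by apply: eq_tens_lift => x y; rewrite linearZ; apply: mulrC.
have [F FE] : exists F : 'Hom(A, U), forall a, F a = Phi a.
  apply: mk_lfun => r u v; apply/eqP; rewrite -subr_eq0; apply/eqP/gapp_sep => b.
  by rewrite linearB linearP /= !PhiE mulrDr -scalerAr gappD gappZ subrr.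
have kF : lker F == 0%VS.
  rewrite -subv0; apply/subvP => a; rewrite memv_ker memv0 => /eqP Fa.
  by apply/eqP/integral_nondeg => b; rewrite -PhiE -FE Fa linear0.
have : limg F = fullv.
  apply/eqP; rewrite eqEdim subvf limg_dim_eq ?(eqP kF) ?capv0 //.
  by rewrite !dimvf /dim /= muln1.
move/vspaceP => /(_ o); rewrite memvf => /memv_imgP[a _ ->].
by exists a => b; rewrite FE PhiE.
Qed.

(** The Nakayama automorphism nu, given by (a b)(lam) = (b nu(a))(lam), commutes
    with the action of O by adjointness. The elements a with eps(nu(a)) = 0 form
    a proper left ideal, contained in J, so eps o nu = eps. Then
    nu(a)(o) = eps(o . nu(a)) = eps(nu(o . a)) = eps(o . a) = a(o). *)
Lemma integral_trace a b : gapp (a * b) lam = gapp (b * a) lam.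
Proof.
(* The graph of the Nakayama automorphism. *)
pose R (a c : A) := forall b, gapp (a * b) lam = gapp (b * c) lam.
have Rex u : exists c, R u c.
  have [phi phiE] : exists phi : 'Hom(A, k^o), forall v, phi v = gapp (u * v) lam.
    by apply: mk_lfun => r v w; rewrite mulrDr -scalerAr gappD gappZ.
  have [o oE] := gapp_repr phi; have [c cE] := integral_dual o.
  by exists c => v; rewrite -phiE oE cE.
have Runiq u c c' : R u c -> R u c' -> c = c'.
  move=> Rc Rc'; apply/eqP; rewrite -subr_eq0; apply/eqP/integral_nondeg => v.
  rewrite mulrBr -scaleN1r addrC gappD gappZ -Rc -Rc' scaleN1r addNr.
  by [].
have Rlin r u v c d : R u c -> R v d -> R (r *: u + v) (r *: c + d).
  move=> Rc Rd w; rewrite mulrDl mulrDr -scalerAl -scalerAr !gappD !gappZ Rc Rd.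
  by [].
have RM u v c d : R u c -> R v d -> R (u * v) (c * d).
  by move=> Rc Rd w; rewrite -mulrA Rc -mulrA Rd mulrA.
have R1 : R 1 1 by move=> w; rewrite mul1r mulr1.
have Ract o u c : R u c -> R (gact o u) (gact o c).
  by move=> Rc w; rewrite integral_actr // Rc -integral_actl.
have [||M ME] := @vspace_of_pred _ A (fun u => exists2 c, R u c & gaug U c = 0).
- exists 0; last exact: linear0.
  by move=> w; rewrite mul0r mulr0.
- move=> r u v [c Rc c0] [d Rd d0]; exists (r *: c + d); first exact: Rlin.
  by rewrite linearP /= c0 d0 scaler0 addr0.
have lM : left_ideal M.
  move=> u v /ME[d Rd d0]; have [c Rc] := Rex u; apply/ME.
  by exists (c * d); [exact: RM | rewrite gaugM d0 mulr0].
have nM : M <> fullv.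
  move=> M1; have /ME[c Rc c0] : 1 \in M by rewrite M1 memvf.
  by move/eqP: c0; rewrite -(Runiq _ _ _ R1 Rc) gaug1 oner_eq0.
have MJ := subvP (unipotent_local U_unip lM nM).
have Raug u c : R u c -> gaug U u = gaug U c.
  move=> Rc; have : (- gaug U c : k) *: (1 : A) + u \in M.
    apply/ME; exists ((- gaug U c : k) *: (1 : A) + c); first exact: Rlin.
    by rewrite linearP /= gaug1 [_ *: 1]mulr1 addNr.
  move/MJ; rewrite memv_ker linearP /= gaug1 [_ *: 1]mulr1 addrC subr_eq0.
  by move/eqP.
have [c Rc] := Rex a; rewrite Rc; congr (gapp (_ * _) _).
by apply: gextP => o; rewrite -!gaug_act; apply/esym/Raug/Ract.
Qed.

End LocalTrace.

Lemma unipotent_simple_mulC : unipotent_gs U ->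
  simple_lie (HH1 A) -> commutative (@GRing.mul A).
Proof.
move=> U_unip sA; have [lam lam0 lamI] := integral_ex.
have [f fE] := @mk_lfun _ A k^o (fun a => gapp a lam) (fun r u v =>
  etrans (gappD _ _ _) (congr1 (fun z => z + gapp v lam) (gappZ _ _ _))).
apply: (simple_mulC (gaug1 U) (@gaugM k U) (unipotent_local U_unip)
  (@gaug_translation k U) (lam := f)) => // [a b|a H].
  by rewrite !fE; exact: integral_trace.
by apply: (integral_nondeg U_unip lam0 lamI) => b; rewrite -fE.
Qed.

End Integrals.

(** * Commutative local group algebras *)

(** The primitive elements generate the coordinate ring as an algebra, in the
    form of an induction principle over products of primitive elements. *)
Definition prim_generated (k : fieldType) (U : finGroupScheme k) : Prop :=
  forall W : {vspace U}, 1 \in W ->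
    (forall v x : U, primitive v -> x \in W -> v * x \in W) -> W = fullv.

Section Commutative.
Variables (k : fieldType) (U : finGroupScheme k).
Local Notation A := (groupAlg U).
Local Notation aug := (gaug U).
Local Notation J := (lker aug).
Hypothesis U_unip : unipotent_gs U.
Hypothesis mulC : commutative (@GRing.mul A).

Let loc := unipotent_local U_unip.

Lemma prim_space : exists P : {vspace U}, forall v, v \in P <-> primitive v.
Proof. by apply: vspace_of_pred; [exact: primitive0 | move=> r u v; exact: primitive_linear]. Qed.

Section PrimitiveSpace.
Variable P : {vspace U}.
Hypothesis PE : forall v, v \in P <-> primitive v.
Local Notation n := (\dim P).
Local Notation v_ i := ((vbasis P)`_(i : 'I_n)).

Lemma prim_basis i : primitive (v_ i).
Proof. by apply/PE/vbasis_mem/mem_nth; rewrite size_tuple. Qed.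

(** A basis of P, read as derivations of A, together with a dual basis, made to
    vanish at 1: the primitive elements form the dual of J/J^2. *)
Lemma prim_coords : exists (x : 'I_n -> A) (d : 'I_n -> Der A),
  [/\ forall i, x i \in J,
      forall i j, aug (der_fun (d i) (x j)) = (i == j)%:R,
      forall a, a \in J -> (forall i, aug (der_fun (d i) a) = 0) -> a \in (J * J)%VS
    & forall i a, der_fun (d i) a = gact (v_ i) a].
Proof.
have [d dE] := fin_all_exists (fun i => primitive_der (prim_basis i)).
have [f fE] := fin_all_exists (fun i : 'I_n =>
   @mk_lfun _ U k^o (fun u => coord (vbasis P) i (projv P u))
     (fun r u v => etrans (congr1 _ (linearP (projv P) r u v)) (linearP _ r _ _))).
pose g i : A := f i; pose x i : A := g i - (aug (g i) : k) *: (1 : A).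
have gv i j : gapp (g j) (v_ i) = (i == j)%:R.
  rewrite [gapp _ _]fE projv_id ?vbasis_mem ?mem_nth ?size_tuple //.
  by rewrite coord_free ?(basis_free (vbasisP _)) // eq_sym.
exists x, d; split=> // [i|i j|a aJ a0]; first exact: aug_sub (gaug1 U) _.
  rewrite dE gaug_act /x -scaleNr addrC gappD gappZ gapp1.
  by rewrite (primitive_counit (prim_basis i)) scaler0 add0r gv.
apply: contraT => na; have [h [hd ha]] := point_der_sep (gaug1 U) (@gaugM k U) aJ na.
have [v /PE vP hE] := point_der_primitive hd.
move: ha; rewrite hE (coord_vbasis vP) linear_sum /= big1 => [/eqP|i _].
  by rewrite eq_sym (negPf (oner_neq0 _)).
by rewrite linearZ /= -gaug_act -dE a0 scaler0.
Qed.

Lemma prim_dim_le p : p \in [pchar k] -> (p ^ n <= \dim {:A})%N.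
Proof.
move=> charkp; have [x [d [xJ dx x_gen _]]] := prim_coords.
exact: (dim_ge_expn (gaug1 U) (@gaugM k U) loc mulC xJ dx x_gen charkp).
Qed.

(** A is spanned by the monomials in coordinates with exponents below p, so
    dim A <= p^n. *)
Lemma pth_power_dsimple p : p \in [pchar k] ->
  (forall a, a \in J -> a ^+ p = 0) -> dsimple A.
Proof.
move=> charkp Jp; have [x [d [xJ dx x_gen _]]] := prim_coords.
apply: (dim_le_dsimple (gaug1 U) (@gaugM k U) loc mulC xJ dx x_gen charkp).
apply: (dim_le_expn (gaug1 U) (@gaugM k U) loc mulC xJ dx x_gen) => i.
exact: Jp.
Qed.

Lemma dsimple_sub0 (M : {vspace A}) : dsimple A -> left_ideal M -> der_stable M ->
  (M <= J)%VS -> M = 0%VS.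
Proof.
move=> sA lM dM MJ; have [//|M1] := sA M lM dM.
have := memvf (1 : A); rewrite -M1 => /(subvP MJ).
by rewrite memv_ker gaug1 (negPf (oner_neq0 _)).
Qed.

(** Let N be the annihilator in A of a subspace W that contains 1 and is closed
    under multiplication by primitive elements. Every derivation is an A-linear
    combination of primitive elements, which preserve N, so the ideal A N is
    stable. It lies in J because 1 is in W, hence it is 0, and W = O. *)
Lemma dsimple_prim_generated : dsimple A -> prim_generated U.
Proof.
move=> sA W W1 WP; have [x [d [xJ dx x_gen dE]]] := prim_coords.
have [||N NE] := @vspace_of_pred _ A (fun a => forall o, o \in W -> gapp a o = 0).
- by move=> o _; rewrite gapp0.
- by move=> r a b Ha Hb o oW; rewrite gappD gappZ Ha // Hb // scaler0 addr0.
pose M := (fullv * N)%VS.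
have lM : left_ideal M by exact: generated_left_ideal.
have MJ : (M <= J)%VS.
  apply/prodvP => u a _ /NE aN; apply: (aug_mull (@gaugM k U)).
  by rewrite memv_ker gaugE aN.
have dM : der_stable M.
  move=> D y yM; rewrite memv_preim; apply: (subvP _ _ yM).
  apply/prodvP => b a _ aN; rewrite -memv_preim der_funM.
  apply: memvD; first by rewrite memv_mul ?memvf.
  have [c cE] := der_generated (gaug1 U) (@gaugM k U) loc mulC xJ dx x_gen D.
  rewrite cE; apply: lM; apply: memv_suml => i _; apply: memv_mul; first exact: memvf.
  rewrite dE; apply/NE => o oW; rewrite gactE; apply: (NE a).1 => //.
  by apply: WP => //; exact: prim_basis.
have M0 := dsimple_sub0 sA lM dM MJ.
apply/vspaceP => o; rewrite memvf; apply: contraT => no.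
have [f [fo fW]] := functional_sep no.
pose F : A := f; have : 1 * F \in M.
  by apply: memv_mul; [exact: memvf | apply/NE].
rewrite mul1r M0 memv0 => /eqP f0; move/eqP: fo.
by rewrite -[f o]/(gapp F o) f0 gapp0 eq_sym (negPf (oner_neq0 _)).
Qed.

Lemma der_fun_pow (D : Der A) a m : der_fun D (a ^+ m.+1) = m.+1%:R *: (a ^+ m * der_fun D a).
Proof.
elim: m => [|m IH]; first by rewrite expr1 expr0 mul1r scale1r.
rewrite exprS der_funM IH -scalerAr mulrA -exprS mulC.
by rewrite -[m.+2]add1n natrD scalerDl scale1r.
Qed.

(** The ideal A a^p is stable, because derivations kill p-th powers. *)
Lemma dsimple_pth_power p : p \in [pchar k] -> dsimple A ->
  forall a, a \in J -> a ^+ p = 0.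
Proof.
move=> charkp sA a aJ; pose M := limg (amulr (a ^+ p)).
have pE : p = p.-1.+1 by rewrite prednK // prime_gt0 // (pcharf_prime charkp).
have memM b : b * a ^+ p \in M by apply/memv_imgP; exists b; rewrite ?memvf ?lfunE.
have lM : left_ideal M.
  by move=> u _ /memv_imgP[b _ ->]; rewrite lfunE /= mulrA.
have dM : der_stable M.
  move=> D _ /memv_imgP[b _ ->]; rewrite lfunE /= der_funM {2}pE der_fun_pow -pE.
  by rewrite (pcharf0 charkp) scale0r mulr0 addr0.
have MJ : (M <= J)%VS.
  apply/subvP => _ /memv_imgP[b _ ->]; rewrite lfunE /= pE exprS.
  by apply: (aug_mull (@gaugM k U)); apply: (aug_mulr (@gaugM k U)).
have := memM 1; rewrite (dsimple_sub0 sA lM dM MJ) mul1r memv0.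
by move/eqP.
Qed.

End PrimitiveSpace.
End Commutative.

(** * Products of subgroup schemes and of their group algebras *)

Section TensorAnnihilator.
Variables (k : fieldType) (B C : vectType k).

Lemma mem_tensv (X : {vspace B}) (Y : {vspace C}) x y :
  x \in X -> y \in Y -> x *t y \in tensv X Y.
Proof.
have [pl pr] := bilin_ptens B C; move=> xX yY.
rewrite (coord_vbasis xX) (lin_sum _ _ _ (pl y)); apply: memv_suml => i _.
rewrite memvZ // (coord_vbasis yY) (lin_sum _ _ _ (pr _)); apply: memv_suml => j _.
by rewrite memvZ // memv_span //; apply: allpairs_f; rewrite mem_nth // size_tuple.
Qed.

Lemma tensv_ann (X : {vspace B}) (Y : {vspace C}) (f : 'Hom(B, k^o)) (g : 'Hom(C, k^o)) t :
  (forall x, x \in X -> f x = 0) \/ (forall y, y \in Y -> g y = 0) ->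
  t \in tensv X Y -> tens_lift (pair_fun f g) t = 0.
Proof.
move=> fg; suff /subvP sT : (tensv X Y <= lker (linfun (tens_lift (pair_fun f g))))%VS.
  by move=> /sT; rewrite memv_ker lfunE /= => /eqP.
apply/span_subvP => _ /allpairsP[[x y] [xX yY ->]] /=.
rewrite memv_ker lfunE /= tens_liftE; last exact: bilin_pair_fun.
by rewrite /pair_fun; case: fg => [-> |->]; rewrite ?vbasis_mem ?mul0r ?mulr0.
Qed.

(** Let pX and pY be the projections with kernels X and Y. Every tensor is
    congruent to its image under pX (x) pY, and this image is 0 as soon as the
    forms that vanish on X and Y kill the tensor. *)
Lemma tens_ann_mem (X : {vspace B}) (Y : {vspace C}) (t : tens B C) :
  (forall (f : 'Hom(B, k^o)) (g : 'Hom(C, k^o)), (forall x, x \in X -> f x = 0) -> (forall y, y \in Y -> g y = 0) ->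
     tens_lift (pair_fun f g) t = 0) ->
  t \in (tensv X fullv + tensv fullv Y)%VS.
Proof.
have [pl pr] := bilin_ptens B C; move=> t0.
pose pX := (\1 - projv X)%VF; pose pY := (\1 - projv Y)%VF.
have lX : linear pX by exact: linearP.
have lY : linear pY by exact: linearP.
have pXE x : pX x = x - projv X x by rewrite add_lfunE opp_lfunE id_lfunE.
have pYE y : pY y = y - projv Y y by rewrite add_lfunE opp_lfunE id_lfunE.
have H s : s - tmap pX pY s \in (tensv X fullv + tensv fullv Y)%VS.
  elim/tens_ind: s => [x y|c u v Hu Hv]; last first.
    by rewrite tmap_linear opprD addrACA -scalerBr memvD ?memvZ.
  have -> : x *t y - tmap pX pY (x *t y) = projv X x *t y + pX x *t projv Y y.
    rewrite tmapE //; apply/matrixP => i j; rewrite !mxE pXE pYE !linearB /=.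
    by ring.
  by apply: memv_add; apply: mem_tensv; rewrite ?memvf ?memv_proj.
have -> : t = t - tmap pX pY t; last exact: H.
suff -> : tmap pX pY t = 0 by rewrite subr0.
apply: tens_sep => f g; rewrite tens_lift_tmap //; [|exact: bilin_pair_fun].
rewrite -[RHS](t0 (f \o pX)%VF (g \o pY)%VF).
- by apply: eq_tens_lift => x y; rewrite /pair_fun !comp_lfunE.
- by move=> x xX; rewrite comp_lfunE pXE projv_id // subrr linear0.
- by move=> y yY; rewrite comp_lfunE pYE projv_id // subrr linear0.
Qed.

End TensorAnnihilator.

Section Pullback.
Variables (k : fieldType) (G H : finGroupScheme k) (f : 'AHom(G, H)).
Hypothesis fh : is_gs_hom f.

Definition gpull (b : groupAlg H) : groupAlg G := (gapp b \o f)%VF.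

Lemma gpullE b x : gapp (gpull b) x = gapp b (f x).
Proof. by rewrite /gapp comp_lfunE. Qed.

Lemma gpull_is_linear : linear gpull.
Proof. by move=> c a b; apply: gextP => x; rewrite gappD gappZ !gpullE gappD gappZ. Qed.

HB.instance Definition _ :=
  GRing.isLinear.Build k (groupAlg H) (groupAlg G) _ gpull gpull_is_linear.

Lemma gpullM a b : gpull (a * b) = gpull a * gpull b.
Proof.
have lf := ahom_lin f.
apply: gextP => x; rewrite gpullE !gmul_pair fh.1 tens_lift_tmap //; [|exact: bilin_pair_fun].
by apply: eq_tens_lift => u v; rewrite /pair_fun !gpullE.
Qed.

Lemma gpull1 : gpull 1 = 1.
Proof. by apply: gextP => x; rewrite gpullE !gapp1 fh.2. Qed.

Lemma gpullX a n : gpull (a ^+ n) = gpull a ^+ n.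
Proof. by elim: n => [|n IH]; rewrite ?gpull1 // !exprS gpullM IH. Qed.

Lemma gpull_aug a : gaug G (gpull a) = gaug H a.
Proof. by rewrite !gaugE gpullE rmorph1. Qed.

Lemma gpull_ex (a : groupAlg G) : limg f = fullv ->
  (forall x, f x = 0 -> gapp a x = 0) -> exists b, a = gpull b.
Proof.
move=> fs a0; exists (gapp a \o f^-1)%VF; apply: gextP => x.
rewrite gpullE /gapp comp_lfunE -/(gapp a); apply/eqP; rewrite -subr_eq0 -linearB.
by rewrite /= a0 // linearB /= limg_lfunVK ?subrr // fs memvf.
Qed.

Definition pull_space : {vspace groupAlg G} := limg (linfun gpull).

Lemma mem_pull a : a \in pull_space <-> exists b, a = gpull b.
Proof.
split=> [/memv_imgP[b _ ->]|[b ->]]; first by exists b; rewrite lfunE.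
by apply/memv_imgP; exists b; rewrite ?memvf // lfunE.
Qed.

End Pullback.

Section ProductIdeal.
Variables (k : fieldType) (U : finGroupScheme k).
Local Notation A := (groupAlg U).
Implicit Types (X : subgroupScheme U) (E : seq (subgroupScheme U)).

(** The image in kU of the group algebra of the subgroup scheme. *)
Definition sub_span X : {vspace A} := pull_space (sub_res X).

Lemma sub_spanP X (a : A) :
  a \in sub_span X <-> forall x, x \in lker (sub_res X) -> gapp a x = 0.
Proof.
split=> [/mem_pull[b ->] x|a0].
  by rewrite memv_ker gpullE => /eqP ->; rewrite linear0.
apply/mem_pull/gpull_ex; first exact: sub_res_surj.
by move=> x fx; apply: a0; rewrite memv_ker fx.
Qed.

Definition prod_span E : {vspace A} := foldr (fun X V => (sub_span X * V)%VS) 1%VS E.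

Lemma prod_ideal_ann E o (a : A) : o \in prod_ideal E -> a \in prod_span E -> gapp a o = 0.
Proof.
elim: E o a => [|X E IH] o a /=.
  rewrite memv_ker => /eqP o0 /vlineP[c ->].
  by rewrite gappZ gapp1 o0 scaler0.
rewrite /mul_ideal -memv_preim => /memv_addP[s sI [t tI oE]].
suff /subvP H : (sub_span X * prod_span E <= lker (gev o))%VS.
  by move/H; rewrite memv_ker gevE => /eqP.
apply/prodvP => u v /sub_spanP uX vE; rewrite memv_ker gevE gmul_pair oE linearD /=.
rewrite (tensv_ann (or_introl uX) sI) (tensv_ann (or_intror _) tI) ?addr0 // => y yI.
exact: IH.
Qed.

Lemma ann_span_mem (V : {vspace A}) (a : A) :
  (forall o, (forall b, b \in V -> gapp b o = 0) -> gapp a o = 0) -> a \in V.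
Proof.
move=> H; apply: contraT => na; have [f [fa fV]] := functional_sep na.
have [o oE] := gapp_repr f; have := H o _; rewrite -oE fa => H'.
have /eqP := H' (fun b bV => etrans (esym (oE b)) (fV b bV)).
by rewrite oner_eq0.
Qed.

Lemma prod_ideal_mem E o : (forall a : A, a \in prod_span E -> gapp a o = 0) ->
  o \in prod_ideal E.
Proof.
elim: E o => [|X E IH] o o0 /=.
  by rewrite memv_ker -gapp1 o0 // memv_line.
rewrite /mul_ideal -memv_preim; apply: tens_ann_mem => f g fX gI.
rewrite -[LHS](gmul_pair (f : A) (g : A)); apply: o0; apply: memv_mul.
  exact/sub_spanP.
by apply: ann_span_mem => o' /IH; exact: gI.
Qed.

(** The ideal of a product of subgroup schemes is the annihilator of the product
    of their group algebras. *)
Lemma prod_ideal0P E : prod_ideal E = 0%VS <-> prod_span E = fullv.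
Proof.
split=> E0; apply/vspaceP => z.
  rewrite memvf; apply: ann_span_mem => o /prod_ideal_mem.
  by rewrite E0 memv0 => /eqP ->; rewrite linear0.
rewrite memv0; apply/idP/eqP => [zI|->]; last exact: mem0v.
by apply: gapp_sep => a; apply: prod_ideal_ann zI _; rewrite E0 memvf.
Qed.

End ProductIdeal.

Section PrimGenerated.
Variables (k : fieldType) (p : nat) (charkp : p \in [pchar k]).

(** The set of o at which all commutators vanish is closed under multiplication
    by primitive elements, which act as derivations. *)
Lemma prim_generated_mulC (G : finGroupScheme k) : prim_generated G ->
  commutative (@GRing.mul (groupAlg G)).
Proof.
move=> Ggen; have [||W WE] := @vspace_of_pred _ G
    (fun o => forall a b : groupAlg G, gapp (a * b) o = gapp (b * a) o).
- by move=> a b; rewrite !linear0.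
- by move=> r u v Hu Hv a b; rewrite !linearP /= Hu Hv.
have W1 : W = fullv.
  apply: Ggen => [|v x vP /WE xW]; apply/WE => a b.
    by rewrite -!gaugE !gaugM mulrC.
  by rewrite -!gactE !primitive_actM // !gappD xW (xW a) addrC.
by move=> a b; apply: gextP => o; apply: (WE o).1; rewrite W1 memvf.
Qed.

(** Primitive elements act as derivations, so they kill a^p. *)
Lemma prim_generated_pth (G : finGroupScheme k) : prim_generated G ->
  forall a : groupAlg G, a ^+ p = (gaug G a : k) ^+ p *: (1 : groupAlg G).
Proof.
move=> Ggen a; have mulC := prim_generated_mulC Ggen.
have [||W WE] := @vspace_of_pred _ G
    (fun o => gapp (a ^+ p) o = gaug G (a ^+ p) * counit o).
- by rewrite !linear0 mulr0.
- by move=> r u v Hu Hv; rewrite !linearP /= Hu Hv mulrDr mulrCA.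
have W1 : W = fullv.
  apply: Ggen => [|v x vP /WE xW]; apply/WE; first by rewrite rmorph1 mulr1 gaugE.
  have [d dE] := primitive_der vP.
  have pE : p = p.-1.+1 by rewrite prednK // prime_gt0 // (pcharf_prime charkp).
  rewrite -gactE -dE {1}pE der_fun_pow // -pE (pcharf0 charkp) scale0r gapp0.
  by rewrite rmorphM /= (primitive_counit vP) mul0r mulr0.
apply: gextP => o; rewrite gappZ gapp1; have := (WE o).1; rewrite W1 memvf => -> //.
congr (_ * _); elim: p => [|m IH]; first by rewrite !expr0 gaug1.
by rewrite !exprS gaugM IH.
Qed.

End PrimGenerated.

(** * The elementary factors and their products *)

Section ElementaryFactors.
Variables (k : fieldType) (p : nat) (charkp : p \in [pchar k]).
Local Notation Zp := (constGS k 'Z_p).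

Section AdditiveKernelFactor.
Variable r : nat.
Local Notation G := (Ga_ker charkp r).

Definition Ga_var : G := tvar k (p ^ r).

(** The coordinate of the additive group. *)
Lemma Ga_var_primitive : primitive Ga_var.
Proof. exact: Ga_comulT. Qed.

Lemma Ga_prim_generated : prim_generated G.
Proof.
move=> W W1 WP; apply/vspaceP => q; rewrite memvf.
have -> : q = in_qpoly 'X^(p ^ r) (polyn q).
  by apply: val_inj; apply/esym/in_qpoly_small/size_mk_monic.
elim/poly_ind: (polyn q) => [|s c IH]; first by rewrite in_qpoly0 mem0v.
rewrite in_qpolyD in_qpolyM memvD //.
  by rewrite -[_ * _](coord_mulC Ga_var) WP //; exact: Ga_var_primitive.
by rewrite -alg_polyC in_qpolyZ memvZ // in_qpoly1.
Qed.

Lemma Ga_var_exp_neq0 j : (j < p ^ r)%N -> Ga_var ^+ j != 0.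
Proof.
move=> jN; rewrite /Ga_var /tvar -(rmorphXn (in_qpoly 'X^(p ^ r))) /=.
have N1 : (0 < p ^ r)%N by apply: leq_ltn_trans jN.
apply/eqP => /(congr1 val) /=; rewrite mk_monic_Xn prednK //.
rewrite Pdiv.CommonRing.rmodp_small ?size_polyXn ?ltnS // => /eqP.
by rewrite -size_poly_eq0 size_polyXn.
Qed.

End AdditiveKernelFactor.

Lemma Zp_cardE : (Zp_trunc p).+2 = p.
Proof. by rewrite Zp_cast // prime_gt1 // (pcharf_prime charkp). Qed.

(** The inclusion of the prime field in k, as a function on Z/(p): it is additive,
    hence primitive. *)
Definition Zp_var : Zp := cfun (fun i : 'Z_p => (i : nat)%:R : k).

Lemma pchar_modn m : (m %% p)%:R = m%:R :> k.
Proof.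
by rewrite [in RHS](divn_eq m p) natrD natrM (pcharf0 charkp) mulr0 add0r.
Qed.

Lemma Zp_var_primitive : primitive Zp_var.
Proof.
apply: ev2_ext => g h; rewrite [comul _]ccomulE ev2_comul.
have [e1 eM] := ev2_mon k g h; have le := ev2_linear (k := k) g h.
rewrite (lin_add _ _ le) !ev2E !cval1 mulr1 mul1r !cvalE /=.
by rewrite -natrD -[RHS]pchar_modn; congr (_ %% _)%:R; exact: Zp_cardE.
Qed.

Lemma pchar_natr_inj m n : (m < p)%N -> (n < p)%N -> m%:R = n%:R :> k -> m = n.
Proof.
wlog nm : m n / (n <= m)%N => [H mp np e|mp _ e].
  by have [/H|/ltnW/H] := leqP n m; [apply | move=> /(_ np mp (esym e))].
apply/eqP; rewrite eqn_leq nm andbT -subn_eq0; apply: contraT; rewrite -lt0n => d0.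
have : (p %| m - n)%N by rewrite (dvdn_pcharf charkp) natrB // e subrr.
by move/(dvdn_leq d0); rewrite leqNgt (leq_ltn_trans (leq_subr _ _) mp).
Qed.

Lemma cval_prod_sub (f : Zp) (s : seq k) (i : 'Z_p) :
  cval (\prod_(c <- s) (f - c *: 1)) i = \prod_(c <- s) (cval f i - c).
Proof.
elim: s => [|c s IH]; first by rewrite !big_nil cval1.
rewrite !big_cons cvalM IH; congr (_ * _).
by rewrite -scaleN1r addrC !cvalD !cvalZ cval1 mulr1 mulN1r addrC.
Qed.

(** The product of the f - f(i) over i <> g is a nonzero multiple of the delta
    function at g. *)
Lemma Zp_interpolation (W : {vspace Zp}) (f : Zp) : injective (cval f) -> 1 \in W ->
  (forall x, x \in W -> f * x \in W) -> W = fullv.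
Proof.
move=> f_inj W1 Wf; apply/vspaceP => h; rewrite memvf.
have prodW s : \prod_(c <- s) (f - c *: 1) \in W.
  elim: s => [|c s IH]; first by rewrite big_nil.
  by rewrite big_cons mulrBl -scalerAl mul1r memvB ?Wf ?memvZ.
rewrite [h]cdelta_sum; apply: memv_suml => g _; apply: memvZ.
pose s := [seq cval f i | i <- enum 'Z_p & i != g].
pose c := \prod_(c <- s) (cval f g - c).
have nc : c != 0.
  rewrite /c prodf_seq_neq0; apply/allP => _ /mapP[i + ->] /=.
  rewrite mem_filter => /andP[ig _]; rewrite subr_eq0.
  by apply: contra ig => /eqP/f_inj ->.
have -> : cdelta k g = c^-1 *: \prod_(c <- s) (f - c *: 1); last by rewrite memvZ.
apply: cext => i; rewrite cvalE cvalZ cval_prod_sub.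
have [->|ig] := eqVneq i g; first by rewrite -/c mulVf.
rewrite (big_rem (cval f i)) /=; first by rewrite subrr mul0r mulr0.
by apply/mapP; exists i => //; rewrite mem_filter ig mem_enum.
Qed.

Lemma Zp_var_inj : injective (cval Zp_var).
Proof.
move=> i j; rewrite !cvalE => /pchar_natr_inj e; apply: val_inj; apply: e.
  by rewrite -{2}Zp_cardE.
by rewrite -{2}Zp_cardE.
Qed.

Lemma Zp_prim_generated : prim_generated Zp.
Proof.
move=> W W1 WP; apply: (Zp_interpolation Zp_var_inj W1) => x xW.
by apply: WP => //; exact: Zp_var_primitive.
Qed.

Definition elementary_factor (H : finGroupScheme k) : Prop :=
  (exists r, (0 < r)%N /\ gs_iso H (Ga_ker charkp r)) \/ gs_iso H Zp.

Lemma elementary_factor_var (H : finGroupScheme k) : elementary_factor H ->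
  exists G : finGroupScheme k, [/\ gs_iso H G, prim_generated G
    & exists2 v : G, primitive v & v != 0].
Proof.
case=> [[r [r0 Hr]]|Hp].
  exists (Ga_ker charkp r); split=> //; first exact: Ga_prim_generated.
  exists (Ga_var r); first exact: Ga_var_primitive.
  rewrite -[Ga_var r]expr1; apply: Ga_var_exp_neq0.
  have p1 : (1 < p)%N by rewrite prime_gt1 // (pcharf_prime charkp).
  by apply: leq_trans p1 _; rewrite -{1}(expn1 p) leq_exp2l ?prime_gt1 ?(pcharf_prime charkp).
exists Zp; split=> //; first exact: Zp_prim_generated.
exists Zp_var; first exact: Zp_var_primitive.
apply/eqP => v0; have := @Zp_var_inj 0%R 1%R; rewrite v0 !cval0 => /(_ erefl).
by move/eqP; rewrite eq_sym oner_eq0.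
Qed.

Section Necessary.
Variable U : finGroupScheme k.
Local Notation A := (groupAlg U).

Lemma abelian_gs_mulC : abelian_gs U <-> commutative (@GRing.mul A).
Proof.
have sw (a b : A) t : tens_lift (pair_fun (gapp a) (gapp b)) (tswap t)
    = tens_lift (pair_fun (gapp b) (gapp a)) t.
  elim/tens_ind: t => [x y|c u v Hu Hv].
    have [pl pr] := bilin_ptens U U.
    rewrite /tswap tens_liftE; last by split=> ? ? ? ?; rewrite ?pl ?pr.
    by rewrite !tens_liftE; try exact: bilin_pair_fun; rewrite /pair_fun mulrC.
  by rewrite /tswap !linearP /= -/(tswap u) -/(tswap v) Hu Hv.
split=> [Uab a b|mulC o].
  by apply: gextP => o; rewrite !gmul_pair -{1}Uab sw.
apply/eqP; rewrite -subr_eq0; apply/eqP; apply: tens_sep => f g.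
rewrite linearB /= (sw (f : A) (g : A)) -[X in X - _](gmul_pair (g : A) (f : A)).
by rewrite -[X in _ - X](gmul_pair (f : A) (g : A)) mulC subrr.
Qed.

Lemma factor_pth (X : subgroupScheme U) : elementary_factor (sub_gs X) ->
  forall a, a \in sub_span X -> a ^+ p = (gaug U a : k) ^+ p *: (1 : A).
Proof.
case/elementary_factor_var => G [[f [fh fb]] Ggen _] a /mem_pull[b ->].
have [|y fy|b' ->] := @gpull_ex _ _ _ f b.
- apply/eqP; rewrite eqEsubv subvf; apply/subvP => y _; have [g gK fK] := fb.
  by rewrite -[y]fK memv_img ?memvf.
- have -> : y = 0 by apply: (bij_inj fb); rewrite fy linear0.
  by rewrite linear0.
rewrite -!(gpullX (sub_res_hom X)) -(gpullX fh) (prim_generated_pth charkp Ggen).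
by rewrite !linearZ /= (gpull1 fh) (gpull1 (sub_res_hom X)) !gpull_aug.
Qed.

(** The elements with a^p = eps(a)^p form a subalgebra of the commutative
    algebra A, which contains the group algebras of the factors. *)
Lemma elementary_abelian_pth : elementary_abelian_gs charkp U ->
  commutative (@GRing.mul A) /\ forall a : A, a ^+ p = (gaug U a : k) ^+ p *: (1 : A).
Proof.
case=> /abelian_gs_mulC mulC [n [E [E0 Ef]]]; split=> // a.
have chA : p \in [pchar A] by rewrite pchar_lalg.
have p0 : (0 < p)%N by rewrite prime_gt0 // (pcharf_prime charkp).
have [||T TE] := @vspace_of_pred _ A (fun a => a ^+ p = (gaug U a : k) ^+ p *: (1 : A)).
- by rewrite linear0 !expr0n !eqn0Ngt p0 scale0r.
- move=> r u v Hu Hv; rewrite -!(pFrobenius_autE chA) pFrobenius_autD_comm; last exact: mulC.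
  rewrite !pFrobenius_autE exprZn Hu Hv linearP scalerA -exprMn -scalerDl.
  by rewrite -!(pFrobenius_autE charkp) -rmorphD.
have spanT (s : seq 'I_n.+1) : (prod_span [seq E i | i <- s] <= T)%VS.
  elim: s => [|i s IH] /=.
    by rewrite -memvE; apply/TE; rewrite expr1n gaug1 expr1n scale1r.
  apply/prodvP => u v uE vs; apply/TE.
  have /TE Hv := subvP IH v vs; have Hu := factor_pth (Ef i) uE.
  rewrite exprMn_comm; last exact: mulC.
  by rewrite Hu Hv gaugM exprMn -scalerAl mul1r scalerA.
apply: (TE a).1; apply: (subvP (spanT (enum 'I_n.+1))).
by move/prod_ideal0P: E0 => ->; exact: memvf.
Qed.

(** If J = 0 then O = k, and the quotient of O attached to a factor has
    no nonzero primitive element. *)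
Lemma elementary_abelian_aug_neq0 : elementary_abelian_gs charkp U ->
  lker (gaug U) != 0%VS.
Proof.
case=> _ [n [E [_ /(_ ord0)/elementary_factor_var]]].
case=> G [[f [fh [g gK fK]]] _ [v vP nv]]; apply: contraNneq nv => J0.
have scal (o : U) : o = (counit o : k) *: 1.
  apply/eqP; rewrite -subr_eq0; apply/eqP/gapp_sep => a.
  have : a - (gaug U a : k) *: (1 : A) \in lker (gaug U) by exact: aug_sub (gaug1 U) a.
  rewrite J0 memv0 subr_eq0 => /eqP ->.
  rewrite linearB linearZ /= !gappZ !gapp1 rmorph1; apply/eqP; rewrite subr_eq0.
  by rewrite [_ *: 1]mulr1 [_ *: _]mulrC.
have [o _ oE] : exists2 o, o \in fullv & g v = sub_res (E ord0) o.
  by apply/memv_imgP; rewrite sub_res_surj memvf.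
have vE : v = f (sub_res (E ord0) o) by rewrite -oE fK.
have cv := primitive_counit vP; rewrite vE fh.2 (sub_res_hom (E ord0)).2 in cv.
by rewrite vE [o]scal cv scale0r !linear0.
Qed.

End Necessary.
End ElementaryFactors.

(** * Linear algebra over an algebraically closed field *)

Section ClosedFieldLinear.
Variable k : closedFieldType.

Lemma closed_eigenvector (V : vectType k) (T : 'End(V)) (W : {vspace V}) :
  W != 0%VS -> (forall w, w \in W -> T w \in W) ->
  exists z w, [/\ w \in W, w != 0 & T w = z *: w].
Proof.
move=> nW TW; pose n := \dim W; pose e := vbasis W.
have n0 : (0 < n)%N by rewrite lt0n dimv_eq0.
pose M : 'M[k]_n := \matrix_(i, j) coord e j (T e`_i).
have /closed_rootP[z rz] : size (char_poly M) != 1%N.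
  by rewrite size_char_poly eqSS -lt0n.
have /eigenvalueP[v vM nv] : eigenvalue M z by rewrite eigenvalue_root_char.
pose w := \sum_i v 0 i *: e`_i; exists z, w.
have eW (i : 'I_n) : e`_i \in W by rewrite vbasis_mem // mem_nth // size_tuple.
split.
- by apply: memv_suml => i _; rewrite memvZ.
- apply: contraNneq nv => w0; apply/eqP/rowP => i; rewrite mxE.
  have /freeP/(_ (v 0) w0 i) := basis_free (vbasisP W).
  by [].
rewrite linear_sum scaler_sumr /=.
have TE (i : 'I_n) : T e`_i = \sum_(j < n) M i j *: e`_j.
  rewrite {1}(coord_vbasis (TW _ (eW i))); apply: eq_bigr => j _.
  by rewrite mxE.
under eq_bigr => i _ do rewrite linearZ /= TE scaler_sumr.
rewrite exchange_big; apply: eq_bigr => j _; rewrite scalerA.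
have := congr1 (fun m : 'rV_n => m 0 j) vM; rewrite !mxE => <-.
by rewrite scaler_suml; apply: eq_bigr => i _; rewrite scalerA.
Qed.

Lemma closed_nth_root (c : k) n : (0 < n)%N -> exists d, d ^+ n = c.
Proof.
move=> n0; have /closed_rootP[d] : size ('X^n - c%:P) != 1%N.
  by rewrite size_XnsubC // eqSS -lt0n.
by rewrite rootE !hornerE subr_eq0 => /eqP <-; exists d.
Qed.

End ClosedFieldLinear.

(** * Frobenius powers and nilpotent elements *)

Section Frobenius.
Variables (k : fieldType) (p : nat) (charkp : p \in [pchar k]) (U : finGroupScheme k).

Lemma frobD j (x y : U) : (x + y) ^+ (p ^ j) = x ^+ (p ^ j) + y ^+ (p ^ j).
Proof.
have chU : p \in [pchar U] by rewrite pchar_lalg.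
elim: j => [|j IH]; first by rewrite !expr1.
rewrite expnSr !exprM IH -!(pFrobenius_autE chU) pFrobenius_autD_comm //.
exact: coord_mulC.
Qed.

Lemma frob0 j : (0 : U) ^+ (p ^ j) = 0.
Proof.
have p0 : (0 < p)%N by rewrite prime_gt0 // (pcharf_prime charkp).
by rewrite expr0n eqn0Ngt expn_gt0 p0.
Qed.

Lemma frobP j c (x y : U) :
  (c *: x + y) ^+ (p ^ j) = c ^+ (p ^ j) *: x ^+ (p ^ j) + y ^+ (p ^ j).
Proof. by rewrite frobD exprZn. Qed.

Lemma frobS i j (x : U) : (x ^+ (p ^ i)) ^+ (p ^ j) = x ^+ (p ^ (i + j)).
Proof. by rewrite -exprM -expnD. Qed.

Lemma primitive_frob j (v : U) : primitive v -> primitive (v ^+ (p ^ j)).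
Proof.
move=> vP; elim: j => [|j IH]; first by rewrite expr1.
by rewrite expnSr exprM; exact: primitive_pow.
Qed.

Lemma frob_sum j n (c : 'I_n -> k) (x : 'I_n -> U) :
  (\sum_i c i *: x i) ^+ (p ^ j) = \sum_i c i ^+ (p ^ j) *: x i ^+ (p ^ j).
Proof.
elim/big_rec2: _ => [|i y1 y2 _ <-]; first exact: frob0.
exact: frobP.
Qed.

(** The ideals generated by 1, u, ..., u^(m+1) decrease strictly: an equality
    between consecutive ones would make u^m a multiple of all its powers. *)
Lemma nilpotent_exp_lt (u : U) m M : u ^+ M = 0 -> u ^+ m != 0 -> (m < \dim {:U})%N.
Proof.
move=> uM um; pose I i := limg (amulr (u ^+ i)).
have step i : (i <= m)%N -> (\dim (I i.+1) < \dim (I i))%N.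
  move=> im; have sI : (I i.+1 <= I i)%VS.
    apply/subvP => _ /memv_imgP[b _ ->]; rewrite lfunE /= exprS mulrA.
    by apply/memv_imgP; exists (b * u); rewrite ?memvf // lfunE.
  rewrite ltn_neqAle dimvS // andbT; apply/negP => /eqP e.
  have eI : I i.+1 = I i by apply/eqP; rewrite eqEdim sI e leqnn.
  have : u ^+ i \in I i by apply/memv_imgP; exists 1; rewrite ?memvf // lfunE /= mul1r.
  rewrite -eI => /memv_imgP[b _]; rewrite lfunE /= => ub.
  have H l : u ^+ i = b ^+ l * u ^+ (i + l).
    elim: l => [|l IH]; first by rewrite mul1r addn0.
    have ul : u ^+ (i + l) = b * u ^+ (i + l.+1).
      by rewrite exprD {1}ub -mulrA -exprD addSnnS.
    by rewrite {1}IH ul mulrA -exprSr.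
  case/eqP: um; by rewrite -(subnK im) exprD (H M) exprD uM !mulr0.
have : (\dim (I m.+1) + m.+1 <= \dim (I 0))%N.
  elim: m {um} step => [|m IH] step; first by rewrite addn1; exact: step.
  rewrite addnS -addSn; apply: leq_trans (IH _); last by move=> i im; apply: step; exact: leqW.
  by rewrite leq_add2r; apply: step.
move=> H; apply: leq_trans (dimvS (subvf (I 0%N))); apply: leq_trans H.
exact: leq_addl.
Qed.

End Frobenius.

(** * Invariants in the group algebra *)

Section Invariants.
Variables (k : fieldType) (U : finGroupScheme k).
Local Notation A := (groupAlg U).

Definition gactL (o : U) : 'End(A) := linfun (gact o).

Lemma gactLE o a : gactL o a = gact o a. Proof. exact: lfunE. Qed.

(** If S generates the ideal of a subgroup scheme, this is the group algebra of
    that subgroup scheme, inside kU. *)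
Definition invs (S : {vspace U}) : {vspace A} :=
  (\bigcap_(i < \dim S) lker (gactL (vbasis S)`_i))%VS.

Lemma mem_invs S a : a \in invs S <-> forall s, s \in S -> gact s a = 0.
Proof.
split=> [aS s sS|aS].
  rewrite (coord_vbasis sS) (lin_sum _ _ _ (gact_linearl a)) big1 // => i _.
  have /subv_bigcapP/(_ i isT) : (<[a]> <= invs S)%VS by rewrite -memvE.
  by rewrite -memvE memv_ker gactLE => /eqP ->; rewrite scaler0.
rewrite memvE; apply/subv_bigcapP => i _; rewrite -memvE memv_ker gactLE.
by apply/eqP/aS; rewrite vbasis_mem // mem_nth // size_tuple.
Qed.

Lemma invs_act S o a : a \in invs S -> gact o a \in invs S.
Proof. by move/mem_invs => aS; apply/mem_invs => s /aS e; rewrite gactC e linear0. Qed.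

Lemma invs0 : invs 0%VS = fullv.
Proof.
apply/vspaceP => a; rewrite memvf; apply/mem_invs => s; rewrite memv0 => /eqP ->.
by apply: gextP => x; rewrite gactE mul0r linear0 gapp0.
Qed.

(** Induction on the number of operators: t maps B onto a stable subspace
    killed by the product of the others. *)
Lemma dim_prod_act (ts : seq U) (B : {vspace A}) d :
  (forall t a, t \in ts -> a \in B -> gact t a \in B) ->
  (forall a, a \in B -> gact (\prod_(t <- ts) t) a = 0) ->
  (forall t, t \in ts -> (\dim (B :&: lker (gactL t)) <= d)%N) ->
  (\dim B <= size ts * d)%N.
Proof.
elim: ts B => [|t ts IH] B BS B0 Bd.
  rewrite leqn0 dimv_eq0 -subv0; apply/subvP => a /B0.
  by rewrite big_nil gact1 memv0 => ->.
rewrite -(limg_ker_dim (gactL t) B) /= mulSn leq_add ?Bd ?mem_head //.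
have sTB : (gactL t @: B <= B)%VS.
  by apply/subvP => _ /memv_imgP[a aB ->]; rewrite gactLE BS ?mem_head.
apply: IH => [s _ sts /memv_imgP[a aB ->]|_ /memv_imgP[a aB ->]|s sts].
- rewrite gactLE gactC -gactLE memv_img //; apply: BS => //.
  by rewrite inE sts orbT.
- by rewrite gactLE -gactM; have := B0 a aB; rewrite big_cons.
apply: leq_trans (Bd s _); last by rewrite inE sts orbT.
by apply: dimvS; apply: capvS.
Qed.

Lemma prim_invariant (a : A) : prim_generated U ->
  (forall v, primitive v -> gact v a = 0) -> a = (gaug U a : k) *: (1 : A).
Proof.
move=> Ugen a0; have [||W WE] := @vspace_of_pred _ U (fun o => gapp a o = gaug U a * counit o).
- by rewrite !linear0 mulr0.
- by move=> r u v Hu Hv; rewrite !linearP /= Hu Hv mulrDr mulrCA.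
have W1 : W = fullv.
  apply: Ugen => [|v x vP xW]; apply/WE; first by rewrite rmorph1 mulr1 gaugE.
  by rewrite -gactE a0 // gapp0 rmorphM /= (primitive_counit vP) mul0r mulr0.
apply: gextP => o; rewrite gappZ gapp1; apply: (WE o).1.
by rewrite W1 memvf.
Qed.

End Invariants.

Section InvariantDimension.
Variables (k : closedFieldType) (p : nat) (charkp : p \in [pchar k]).
Variable U : finGroupScheme k.
Local Notation A := (groupAlg U).
Local Notation aug := (gaug U).
Hypothesis mulC : commutative (@GRing.mul A).
Hypothesis pth : forall a : A, a ^+ p = (aug a : k) ^+ p *: (1 : A).

(** If the eigenspace V of w for z contains an a with eps(a) <> 0, then
    multiplication by a^(p-1) maps V into the kernel of w, as
    w . (a^(p-1) b) = (p-1) z a^(p-1) b + z a^(p-1) b = 0, and it is injective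
    because a^p is a nonzero scalar. Such an a exists when V <> 0, as V is
    stable under O. *)
Lemma dim_eigenspace (S : {vspace U}) (w : U) (z : k) :
    (forall s, s \in S -> primitive s) -> primitive w ->
  (\dim (invs S :&: lker (gactL (w - z *: 1)%R)) <= \dim (invs S :&: lker (gactL w)))%N.
Proof.
move=> SP wP; set V := (_ :&: lker (gactL (w - _)))%VS.
have memV a : a \in V <-> a \in invs S /\ gact w a = z *: a.
  rewrite memv_cap memv_ker gactLE.
  have -> : gact (w - z *: 1) a = gact w a - z *: a.
    rewrite -scaleNr addrC gact_linearl gact1 addrC scaleNr.
    by [].
  by rewrite subr_eq0; split=> [/andP[-> /eqP]|[-> ->]] //=.
have [V0|nV] := eqVneq V 0%VS; first by rewrite V0 dimv0.
have [a aV na] : exists2 a, a \in V & aug a != 0.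
  apply: NNPP => no; case/negP: nV; rewrite -subv0; apply/subvP => a /memV[aS aw].
  rewrite memv0; apply/eqP/gextP => o; rewrite gapp0 -gaug_act; apply/eqP.
  apply: contraT => nao; case: no; exists (gact o a) => //.
  by apply/memV; rewrite invs_act // gactC aw linearZ.
have pE : p = p.-1.+1 by rewrite prednK // prime_gt0 // (pcharf_prime charkp).
have /memV[aS aw] := aV.
have actX (s : U) m : primitive s -> gact s (a ^+ m.+1) = m.+1%:R *: (a ^+ m * gact s a).
  by move=> /primitive_der[d dE]; rewrite -!dE der_fun_pow.
set f := amull (a ^+ p.-1).
have fV : (f @: V <= invs S :&: lker (gactL w))%VS.
  apply/subvP => _ /memv_imgP[b /memV[bS bw] ->]; rewrite lfunE /=.
  have [q p2] : exists q, p.-1 = q.+1.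
    by have := prime_gt1 (pcharf_prime charkp); case: (p) => [|[|q]] // _; exists q.
  rewrite memv_cap memv_ker gactLE primitive_actM // p2 actX // -p2 aw bw.
  apply/andP; split.
    apply/mem_invs => s sS; have sP := SP s sS.
    rewrite primitive_actM // p2 actX //.
    have /mem_invs/(_ s sS) -> := aS; have /mem_invs/(_ s sS) -> := bS.
    by rewrite !mulr0 scaler0 mul0r addr0.
  rewrite -!scalerAr -exprSr -p2 -!scalerAl !scalerA -scalerDl.
  by rewrite -{2}[z]mul1r -mulrDl natr1 -pE (pcharf0 charkp) mul0r scale0r.
rewrite -(@limg_dim_eq _ _ _ f V); first exact: dimvS.
apply/eqP; rewrite -subv0; apply/subvP => b; rewrite memv_cap memv_ker lfunE /=.
case/andP => _ /eqP ab0; have := congr1 (fun x => a * x) ab0.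
rewrite mulrA -exprS -pE pth mulr0 -scalerAl mul1r => /eqP.
by rewrite scaler_eq0 expf_eq0 (negPf na) andbF memv0.
Qed.

Section Chain.
Variables (S : {vspace U}) (w : U).

(** The span of S and of the first m Frobenius powers of w. *)
Fixpoint frob_chain (m : nat) : {vspace U} :=
  if m is m'.+1 then (frob_chain m' + <[w ^+ (p ^ m')]>)%VS else S.

Lemma mem_frob_chainS m x : x \in frob_chain m.+1 ->
  exists2 y, y \in frob_chain m & exists c, x = y + c *: w ^+ (p ^ m).
Proof. by case/memv_addP => y yC [_ /vlineP[c ->] ->]; exists y => //; exists c. Qed.

Lemma sub_frob_chain m : (S <= frob_chain m)%VS.
Proof. by elim: m => [|m IH] //=; apply: subv_trans IH (addvSl _ _). Qed.

Lemma frob_chain_stable m : (forall x, x \in S -> x ^+ p \in S) ->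
  w ^+ (p ^ m) \in frob_chain m -> forall x, x \in frob_chain m -> x ^+ p \in frob_chain m.
Proof.
move=> Sp wC; have frob_step j x : x \in frob_chain j -> x ^+ p \in frob_chain j.+1.
  elim: j x => [|j IH] x; first by move=> xS; apply: (subvP (addvSl _ _)); exact: Sp.
  case/mem_frob_chainS => y /IH yC [c ->]; rewrite addrC.
  have -> : (c *: w ^+ (p ^ j) + y) ^+ p = y ^+ p + c ^+ p *: w ^+ (p ^ j.+1).
    have e := frobP charkp 1 c (w ^+ (p ^ j)) y; rewrite expn1 in e.
    by rewrite e addrC expnSr exprM.
  by apply: memv_add => //; rewrite memvZ // memv_line.
move=> x /frob_step; rewrite /= (addv_idPl _) //.
Qed.

Lemma frob_chain_poly m x : x \in frob_chain m -> exists (s : U) (q : {poly k}),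
  [/\ s \in S, (size q <= p ^ m)%N & x = s + horner_alg w q].
Proof.
elim: m x => [|m IH] x /=; first by move=> xS; exists x, 0; rewrite size_poly0 rmorph0 addr0.
case/mem_frob_chainS => y /IH[s [q [sS sq ->]]] [c ->].
have p1 : (1 < p)%N by rewrite prime_gt1 // (pcharf_prime charkp).
exists s, (q + c *: 'X^(p ^ m)); split=> //.
  apply: leq_trans (size_polyD _ _) _; rewrite geq_max; apply/andP; split.
    by apply: leq_trans sq _; apply: leq_pexp2l; rewrite ?leqnSn ?(ltnW p1).
  by apply: leq_trans (size_scale_leq _ _) _; rewrite size_polyXn ltn_exp2l ?p1 ?leqnn.
by rewrite rmorphD /= linearZ /= rmorphXn /= horner_algX addrA mulr_algl.
Qed.

Lemma dim_frob_chain m : (forall j, (j < m)%N -> w ^+ (p ^ j) \notin frob_chain j) ->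
  (\dim S + m <= \dim (frob_chain m))%N.
Proof.
elim: m => [|m IH] nC; first by rewrite addn0.
rewrite addnS; apply: leq_ltn_trans (IH _) _; first by move=> j jm; apply: nC; exact: leqW.
rewrite ltn_neqAle dimvS ?addvSl // andbT; apply: contra (nC m (leqnn _)) => /eqP e.
have -> : frob_chain m = frob_chain m.+1.
  by apply/eqP; rewrite eqEdim addvSl e leqnn.
by apply: (subvP (addvSr _ _)); exact: memv_line.
Qed.

Lemma frob_chain_stops : exists m, w ^+ (p ^ m) \in frob_chain m.
Proof.
have [_ [_ [m ->] mM]] := @maximal_vspace _ _ (fun X => exists m, X = frob_chain m)
   S (ex_intro _ 0%N erefl).
exists m; rewrite -(mM _ (ex_intro _ m.+1 erefl) (addvSl _ _)).
by apply: (subvP (addvSr _ _)); exact: memv_line.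
Qed.

End Chain.

(** By enlarging S from 0 to W: for w outside S, let m be minimal such that
    w^(p^m) lies in the span T of S and of the w^(p^i), i < m. Then f(w) lies in
    S for a monic polynomial f of degree p^m, so f(w) kills invs S. The
    polynomial f is a product of linear factors w - z, each of whose kernels on
    invs S is no larger than that of w ([dim_eigenspace]), and the
    latter lies in invs T. Hence dim (invs S) <= p^m dim (invs T), while
    dim T >= dim S + m. *)
Lemma dim_invs_ge (W : {vspace U}) : (forall x, x \in W -> primitive x) ->
  (forall x, x \in W -> x ^+ p \in W) ->
  (\dim {:A} <= p ^ \dim W * \dim (invs W))%N.
Proof.
move=> WP Wp.
pose Q (S : {vspace U}) := [/\ (S <= W)%VS, forall x, x \in S -> x ^+ p \in S
  & (\dim {:A} <= p ^ \dim S * \dim (invs S))%N].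
have p0 : (0 < p)%N by rewrite prime_gt0 // (pcharf_prime charkp).
have Q0 : Q 0%VS.
  split; [exact: sub0v | | by rewrite dimv0 mul1n invs0].
  by move=> x; rewrite memv0 => /eqP ->; rewrite expr0n eqn0Ngt p0 mem0v.
have [S [_ [SW Sp dS] mS]] := maximal_vspace Q0.
have [WS|/subvPn[w wW nwS]] := boolP (W <= S)%VS.
  by have <- : S = W by apply/eqP; rewrite eqEsubv SW.
have mex : exists m, w ^+ (p ^ m) \in frob_chain S w m by exact: frob_chain_stops.
case: (ex_minnP mex) => m wC m_min.
have CW j : (frob_chain S w j <= W)%VS.
  elim: j => [|j IH] //=; rewrite subv_add IH -memvE /=.
  by elim: j {IH} => [|j IH]; rewrite ?expr1 // expnSr exprM Wp.
have dC : (\dim S + m <= \dim (frob_chain S w m))%N.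
  apply: dim_frob_chain => j jm; apply/negP => /m_min.
  by rewrite leqNgt jm.
have [s [q [sS sq wE]]] := frob_chain_poly wC.
pose f : {poly k} := 'X^(p ^ m) - q.
have sf : size f = (p ^ m).+1.
  by rewrite /f size_polyDl ?size_polyXn // size_polyN ltnS.
have lf : lead_coef f = 1.
  by rewrite /f lead_coefDl ?lead_coefXn // size_polyXn size_polyN ltnS.
have fw : horner_alg w f = s.
  by rewrite rmorphB /= rmorphXn /= horner_algX wE addrK.
have [r fE] := closed_field_poly_normal f; rewrite lf scale1r in fE.
have sr : size r = (p ^ m)%N.
  by apply: succn_inj; rewrite -sf fE size_prod_XsubC.
pose ts := [seq w - z *: 1 | z <- r].
have prodE : \prod_(t <- ts) t = s.
  rewrite -fw fE rmorph_prod big_map; apply: eq_bigr => z _.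
  by rewrite rmorphB /= horner_algX horner_algC.
have wP := WP w wW.
have dts : (\dim (invs S) <= size ts * \dim (invs S :&: lker (gactL w)))%N.
  apply: dim_prod_act => [t a _ aS|a aS|_ /mapP[z _ ->]].
  - exact: invs_act.
  - by rewrite prodE; have /mem_invs := aS; apply.
  - by apply: dim_eigenspace => // x /(subvP SW); exact: WP.
have kS : (invs S :&: lker (gactL w) <= invs (frob_chain S w m))%VS.
  apply/subvP => a; rewrite memv_cap memv_ker gactLE => /andP[/mem_invs aS /eqP aw].
  apply/mem_invs; elim: (m) => [|j IH] x; [exact: aS |].
  case/mem_frob_chainS => y /IH y0 [c ->].
  have e : (p ^ j)%N = (p ^ j).-1.+1 by rewrite prednK // expn_gt0 p0.
  rewrite addrC gact_linearl y0 addr0 e exprS gactM aw linear0 scaler0.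
  by [].
have QC : Q (frob_chain S w m).
  split; [exact: CW | exact: frob_chain_stable |].
  apply: leq_trans dS _; apply: (@leq_trans (p ^ (\dim S + m) * \dim (invs (frob_chain S w m)))%N).
    rewrite expnD -mulnA leq_mul2l; apply/orP; right; apply: leq_trans dts _.
    by rewrite size_map sr leq_mul2l dimvS ?orbT.
  by rewrite leq_mul2r leq_pexp2l // ?orbT.
have := mS _ QC (sub_frob_chain _ _ _) => e.
case: m wC m_min dC e {dts sr sf prodE lf fw wE sq f fE CW kS QC} => [|m] wC _ dC e.
  by rewrite expr1 (negPf nwS) in wC.
by rewrite e -{2}[\dim S]addn0 leq_add2l in dC.
Qed.

End InvariantDimension.

(** * Nilpotent primitive elements and Frobenius kernels *)

Lemma ahom_ex (k : fieldType) (B C : falgType k) (f : 'Hom(B, C)) :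
  f 1 = 1 -> (forall x y, f (x * y) = f x * f y) ->
  exists F : 'AHom(B, C), forall x, F x = f x.
Proof.
move=> f1 fM; have fP : ahom_in fullv f by apply/ahomP_tmp; split.
by exists (AHom fP).
Qed.

(** The compatibilities with comul and counit are multiplicative conditions,
    so it is enough to check them on generators. *)
Lemma prim_gs_hom (k : fieldType) (G H : finGroupScheme k) (f : 'AHom(G, H)) :
  prim_generated G -> (forall v, primitive v -> primitive (f v)) -> is_gs_hom f.
Proof.
move=> Ggen fP; have lf := ahom_lin f; have mf := ahom_mon f.
have [t1 tM] := tmap_alghom lf lf mf mf.
have [||W WE] := @vspace_of_pred _ G (fun o =>
  comul (f o) = tmap f f (comul o) /\ (counit (f o) = counit o :> k^o)).
- by rewrite /tmap !linear0.
- move=> r u v [Hu Hu'] [Hv Hv']; rewrite lf !linearP /= Hu Hv.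
  by rewrite tmap_linear Hu' Hv'.
have W1 : W = fullv.
  apply: Ggen => [|v x vP /WE[Hx Hx']]; apply/WE.
    by split; rewrite !rmorph1 ?t1.
  split; last first.
    by rewrite !rmorphM /= Hx' (primitive_counit vP) (primitive_counit (fP v vP)) !mul0r.
  rewrite !rmorphM /= Hx tM; congr (_ * _).
  rewrite (fP v vP) vP (lin_add _ _ (tmap_linear f f)) !tmapE //.
  by rewrite !rmorph1.
by split=> a; have /WE[] : a \in W by rewrite W1 memvf.
Qed.

Section GaQuotient.
Variables (k : closedFieldType) (p : nat) (charkp : p \in [pchar k]).
Variable U : finGroupScheme k.
Local Notation A := (groupAlg U).
Local Notation aug := (gaug U).
Hypothesis U_unip : unipotent_gs U.
Hypothesis mulC : commutative (@GRing.mul A).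
Hypothesis pth : forall a : A, a ^+ p = (aug a : k) ^+ p *: (1 : A).
Hypothesis Ugen : prim_generated U.
Variable P : {vspace U}.
Hypothesis PE : forall v, v \in P <-> primitive v.

Let p1 : (1 < p)%N. Proof. by rewrite prime_gt1 // (pcharf_prime charkp). Qed.
Let p0 : (0 < p)%N. Proof. exact: ltnW. Qed.

(** The largest j such that v is a p^j-th power of a primitive element; it exists
    as the exponents of nonzero powers of a nilpotent element are bounded. *)
Lemma prim_height (v : U) : primitive v -> v != 0 -> v ^+ p = 0 ->
  exists j u, [/\ primitive u, v = u ^+ (p ^ j)
    & forall w, primitive w -> v <> w ^+ (p ^ j.+1)].
Proof.
move=> vP nv vp; apply: NNPP => no.
have H j : exists2 u, primitive u & v = u ^+ (p ^ j).
  elim: j => [|j [u uP vE]]; first by exists v; rewrite ?expr1.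
  apply: NNPP => noj; case: no; exists j, u; split=> // w wP vw.
  by apply: noj; exists w.
have [u uP vE] := H (\dim {:U}).
have : (p ^ \dim {:U} < \dim {:U})%N.
  apply: (@nilpotent_exp_lt _ _ u _ (p ^ \dim {:U} * p)); last by rewrite -vE.
  by rewrite exprM -vE.
by rewrite ltnNge ltnW // ltn_expl.
Qed.

(** Since k is perfect, the p^r-th powers of the elements of P form a subspace,
    spanned by the powers of a basis; v lies outside it. *)
Lemma frob_functional (v : U) r : (forall w, primitive w -> v <> w ^+ (p ^ r)) ->
  exists l : 'Hom(U, k^o), l v = 1 /\
    forall x i, x \in P -> (r <= i)%N -> l (x ^+ (p ^ i)) = 0.
Proof.
move=> nv; pose X := map_tuple (fun e : U => e ^+ (p ^ r)) (vbasis P).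
have XE (i : 'I_(\dim P)) : X`_i = (vbasis P)`_i ^+ (p ^ r).
  by rewrite (nth_map 0) // size_tuple.
have nvX : v \notin <<X>>%VS.
  apply/negP => /coord_span vE.
  have [d dE] := fin_all_exists (fun i => closed_nth_root (coord X i v) (n := p ^ r)
    (ltac:(by rewrite expn_gt0 p0))).
  apply: (nv (\sum_i d i *: (vbasis P)`_i)).
    by apply/PE; apply: memv_suml => i _; rewrite memvZ // vbasis_mem // mem_nth // size_tuple.
  by rewrite (frob_sum charkp) {1}vE; apply: eq_bigr => i _; rewrite XE dE.
have [l [lv lX]] := functional_sep nvX; exists l; split=> // x i xP ri.
have {}H y : y \in P -> l (y ^+ (p ^ r)) = 0.
  move=> yP; apply: lX; rewrite (coord_vbasis yP) (frob_sum charkp).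
  apply: memv_suml => j _; rewrite memvZ // memv_span // -XE.
  by rewrite mem_nth // size_tuple.
rewrite -(subnK ri) -frobS; apply: H; apply/PE/primitive_frob => //.
exact/PE.
Qed.

Section FixedHeight.
Variables (v u : U) (j : nat) (l : 'Hom(U, k^o)).
Hypothesis uP : primitive u.
Hypothesis vE : v = u ^+ (p ^ j).
Hypothesis vp : v ^+ p = 0.
Hypothesis lv : l v = 1.

Let ur i : (j < i)%N -> u ^+ (p ^ i) = 0.
Proof.
move=> ji; rewrite -(subnKC ji) expnD expnSr !exprM -vE vp expr0n.
by rewrite eqn0Ngt expn_gt0 p0.
Qed.

(** For m = 0 these x form a p-closed subspace W of P, complementary to the span
    of the u^(p^i); for m > j they form the whole of P, by the choice of l. The
    values of m in between allow an induction. *)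
Definition tail_vanish m (x : U) : Prop :=
  x \in P /\ forall i, (m <= i)%N -> l (x ^+ (p ^ i)) = 0.

Lemma tail_space m : exists Z : {vspace U}, forall x, x \in Z <-> tail_vanish m x.
Proof.
apply: vspace_of_pred => [|c x y [xP x0] [yP y0]].
  by split=> [|i _]; rewrite ?mem0v // (frob0 charkp) linear0.
split=> [|i mi]; first by rewrite memvD ?memvZ.
by rewrite (frobP charkp) linearP /= x0 // y0 // scaler0 addr0.
Qed.

(** Each step from m to m + 1 enlarges the space, because u^(p^(j-m)) satisfies
    l((u^(p^(j-m)))^(p^m)) = l(v) = 1 and its higher powers vanish. *)
Lemma tail_dim m (W Z : {vspace U}) : (m <= j.+1)%N ->
  (forall x, x \in W <-> tail_vanish 0 x) -> (forall x, x \in Z <-> tail_vanish m x) ->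
  (\dim W + m <= \dim Z)%N.
Proof.
move=> + WE; elim: m Z => [|m IH] Z mj ZE.
  rewrite addn0 dimvS //; apply/subvP => x /WE xW; exact/ZE.
have [Z' Z'E] := tail_space m.
rewrite addnS; apply: leq_ltn_trans (IH Z' (ltnW mj) Z'E) _.
have sZ : (Z' <= Z)%VS.
  by apply/subvP => x /Z'E[xP x0]; apply/ZE; split=> // i /ltnW; exact: x0.
rewrite ltn_neqAle dimvS // andbT; apply/negP => /eqP e.
have yZ : u ^+ (p ^ (j - m)) \in Z'.
  have -> : Z' = Z by apply/eqP; rewrite eqEdim sZ e leqnn.
  apply/ZE; split=> [|i mi]; first by apply/PE/primitive_frob.
  rewrite frobS ur ?linear0 //; rewrite ltnS in mj.
  by rewrite -{1}(subnK mj) ltn_add2l.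
have /Z'E[_ /(_ m (leqnn _))] := yZ.
by rewrite frobS subnK // -vE lv => /eqP; rewrite oner_eq0.
Qed.

(** Induction over W and the u^(p^i): a multiple of u^(p^(j-m)) corrects the
    value l(x^(p^m)), the coefficient being a p^m-th root. *)
Lemma tail_ind (Q : U -> Prop) m x :
  (forall c y z, Q y -> Q z -> Q (c *: y + z)) -> (forall y, tail_vanish 0 y -> Q y) ->
  (forall i, Q (u ^+ (p ^ i))) -> (m <= j.+1)%N -> tail_vanish m x -> Q x.
Proof.
move=> Ql Q0 Qu; elim: m x => [|m IH] x mj; first exact: Q0.
case=> xP x0.
have [c cE] := closed_nth_root (- l (x ^+ (p ^ m)) : k) (n := p ^ m)
  (ltac:(by rewrite expn_gt0 p0)).
pose y := u ^+ (p ^ (j - m)).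
have -> : x = - c *: y + (c *: y + x) by rewrite addrA -scalerDl addNr scale0r add0r.
apply: Ql; first exact: Qu.
apply: IH; first exact: ltnW.
split=> [|i mi]; first by rewrite memvD ?memvZ //; apply/PE/primitive_frob.
rewrite (frobP charkp) linearP /= /y frobS.
move: mi; rewrite leq_eqVlt => /predU1P[<-|mi].
  by rewrite subnK // -vE lv cE [_ *: 1]mulr1 addNr.
rewrite x0 // ur ?linear0 ?scaler0 ?addr0 //.
by rewrite ltnS in mj; rewrite -{1}(subnK mj) ltn_add2l.
Qed.

End FixedHeight.

Lemma horner_alg_expand (u : U) N (s : {poly k}) : (size s <= N)%N ->
  horner_alg u s = \sum_(i < N) s`_i *: u ^+ i.
Proof.
move=> sN; have -> : horner_alg u s = horner_alg u (\sum_(i < N) s`_i *: 'X^i).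
  congr (horner_alg u _); rewrite -poly_def; apply/polyP => i; rewrite coef_poly.
  by case: ltnP => // Ni; rewrite nth_default // (leq_trans sN).
rewrite rmorph_sum /=; apply: eq_bigr => i _.
by rewrite linearZ /= rmorphXn /= horner_algX mulr_algl.
Qed.

(** After multiplication by u^(N-1-i), where i is the lowest exponent in s, only
    the term of degree N - 1 remains. *)
Lemma cyclic_free (u : U) N (s : {poly k}) (a : A) : (size s <= N)%N ->
  u ^+ N = 0 -> gact (u ^+ N.-1) a != 0 -> gact (horner_alg u s) a = 0 -> s = 0.
Proof.
move=> sN uN ua sa; apply/eqP; apply: contraT => ns.
have ex : exists i, s`_i != 0 by exists (size s).-1; rewrite -lead_coefE lead_coef_eq0.
case: (ex_minnP ex) => i ni i_min.
have iN : (i < N)%N.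
  by apply: leq_trans sN; rewrite ltnNge; apply: contra ni => /(nth_default 0) ->.
have : gact (u ^+ (N.-1 - i)) (gact (horner_alg u s) a) = 0 by rewrite sa linear0.
rewrite -gactM (horner_alg_expand u sN) mulr_suml (bigD1 (Ordinal iN)) //=.
rewrite big1 ?addr0 => [|l li].
  rewrite -scalerAl -exprD subnKC; last by rewrite -ltnS prednK // (leq_ltn_trans _ iN).
  have := gact_linearl a s`_i (u ^+ N.-1) 0; rewrite addr0 => ->.
  have -> : gact 0 a = 0 by apply: gextP => x; rewrite gactE mul0r linear0 gapp0.
  by rewrite addr0 => /eqP; rewrite scaler_eq0 (negPf ni) (negPf ua).
have [il|li'] := ltnP l i.
  suff /eqP-> : s`_l == 0 by rewrite scale0r mul0r.
  by apply: contraT => /i_min; rewrite leqNgt il.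
have {}li : (i < l)%N by rewrite ltn_neqAle li' andbT eq_sym; exact: li.
have e : (l + (N.-1 - i) = (l - i.+1) + N)%N by lia.
by rewrite -scalerAl -exprD e exprD uN mulr0 scaler0.
Qed.

(** Write v = u^(p^j) with j maximal and take a p-closed complement W in P of the span
    of the u^(p^i); put N = p^(j+1), so that u^N = 0. On the space of invariants
    V = invs W the kernel of u is k, because W and u together kill only the
    scalars; thus dim V <= N. On the other hand
    dim A >= p^(dim P) and dim A <= p^(dim W) dim V give dim V >= N. Hence V is
    a free module of rank one over k[T]/(T^N), acting through u, with a
    generator a. As O acts on V and commutes with u, o . a = f(o)(u) . a
    defines an algebra map f from O onto k[T]/(T^N), the coordinate ring of
    G_a(j+1). It kills W and maps u to T, so it preserves primitive elements. *)
Lemma Ga_quotient (v : U) : primitive v -> v != 0 -> v ^+ p = 0 ->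
  exists r (f : 'AHom(U, Ga_ker charkp r)),
    [/\ (0 < r)%N, is_gs_hom f, limg f = fullv & f v != 0].
Proof.
move=> vP nv vp; have [j [u [uP vE nw]]] := prim_height vP nv vp.
have [l [lv l0]] := frob_functional nw.
have [W WE] := tail_space l 0; pose r := j.+1; pose N := (p ^ r)%N.
have N0 : (0 < N)%N by rewrite expn_gt0 p0.
have uN : u ^+ N = 0 by rewrite /N /r expnSr exprM -vE.
have WP x : x \in W -> primitive x by move=> /WE[/PE].
have Wp x : x \in W -> x ^+ p \in W.
  move=> /WE[xP x0]; apply/WE; split; first by apply/PE/(primitive_frob charkp 1)/PE.
  by move=> i _; rewrite -[p in x ^+ p]expn1 frobS x0.
have dW : (\dim W + r <= \dim P)%N.
  by apply: (tail_dim uP vE vp lv (leqnn _) WE) => x; split=> [xP|[]//]; split=> // i; apply: l0.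
have dV : (N <= \dim (invs W))%N.
  rewrite -(@leq_pmul2l (p ^ \dim W)) ?expn_gt0 ?p0 // -expnD.
  apply: leq_trans (leq_pexp2l p0 dW) _.
  apply: leq_trans (prim_dim_le U_unip mulC PE charkp) _.
  exact: dim_invs_ge.
have ker_u : (\dim (invs W :&: lker (gactL u)) <= 1)%N.
  apply: (@leq_trans (\dim (1%VS : {vspace A}))); last by rewrite dimv1.
  apply: dimvS; apply/subvP => a.
  rewrite memv_cap memv_ker gactLE => /andP[aW /eqP au].
  rewrite (prim_invariant (a := a) Ugen) ?memvZ ?memv_line // => x xP.
  apply: (tail_ind uP vE vp lv (Q := fun x => gact x a = 0) _ _ _ (leqnn _)).
  - by move=> c y z y0 z0; rewrite gact_linearl y0 z0 scaler0 addr0.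
  - by move=> y /WE; move/mem_invs: aW; apply.
  - move=> i; have e : (p ^ i)%N = (p ^ i).-1.+1 by rewrite prednK // expn_gt0 p0.
    by rewrite e exprS gactM au linear0.
  - by split=> [|i]; [exact/PE | apply: l0; exact/PE].
have prodN m : \prod_(t <- nseq m u) t = u ^+ m.
  by rewrite big_nseq; elim: m => [|m IH] //=; rewrite IH exprS.
have dimN m : (forall a, a \in invs W -> gact (u ^+ m) a = 0) -> (\dim (invs W) <= m)%N.
  move=> um; rewrite -(size_nseq m u) -[X in (_ <= X)%N]muln1; apply: dim_prod_act.
  - by move=> t a _; exact: invs_act.
  - by move=> a aW; rewrite prodN um.
  - by move=> t /nseqP[-> _].
have dVN : (\dim (invs W) <= N)%N.
  by apply: dimN => a _; rewrite uN; apply: gextP => x; rewrite gactE mul0r linear0 gapp0.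
have [a aW na] : exists2 a, a \in invs W & gact (u ^+ N.-1) a != 0.
  apply: NNPP => no; suff /dimN : forall a, a \in invs W -> gact (u ^+ N.-1) a = 0.
    by rewrite leqNgt (leq_trans _ dV) // prednK.
  move=> a aW; apply/eqP; apply: contraT => na; case: no; by exists a.
pose G := Ga_ker charkp r.
have sz : (size (mk_monic ('X^N : {poly k}))).-1 = N.
  by rewrite mk_monic_Xn size_polyXn /= prednK.
(* The identification th of k[T]/(T^N) with V, q |-> q(u) . a. *)
have [th thE] : exists th : 'Hom(G, A), forall q, th q = gact (teval u q) a.
  by apply: mk_lfun => c x y; rewrite linearP gact_linearl.
have th0 : lker th == 0%VS.
  rewrite -subv0; apply/subvP => q; rewrite memv_ker memv0 thE => /eqP q0.
  apply/eqP; apply: val_inj; apply: (@cyclic_free u N _ a) => //.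
  by apply: leq_trans (size_npoly q) _; rewrite sz.
have imth : limg th = invs W.
  apply/eqP; rewrite eqEdim; apply/andP; split.
    by apply/subvP => _ /memv_imgP[q _ ->]; rewrite thE invs_act.
  rewrite limg_dim_eq ?(eqP th0) ?capv0 //; apply: leq_trans dVN _.
  by rewrite -{1}sz -(dim_polyn k (size (mk_monic ('X^N : {poly k}))).-1).
have [F0 F0E] : exists F0 : 'Hom(U, G), forall o, F0 o = (th^-1)%VF (gact o a).
  by apply: mk_lfun => c x y; rewrite gact_linearl linearP.
have thF o : th (F0 o) = gact o a by rewrite F0E limg_lfunVK // imth invs_act.
have th_inj : injective th by apply/lker0P.
have [te1 teM] := teval_alghom N0 uN.
have [||f fE] := @ahom_ex _ _ _ F0.
- by apply: th_inj; rewrite thF gact1 thE te1 gact1.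
- move=> x y; apply: th_inj; rewrite thF gactM -thF thE.
  by rewrite gactC -thF thE -gactM thE teM coord_mulC.
have fev q : f (teval u q) = q.
  by apply: th_inj; rewrite fE thF thE.
have fu : f u = Ga_var charkp r by rewrite -(teval_var N0 uN) fev.
exists r, f; split=> //.
- apply: prim_gs_hom => // x xP.
  apply: (tail_ind uP vE vp lv (Q := fun x => primitive (f x)) _ _ _ (leqnn _)).
  + by move=> c y z yP zP; rewrite linearP; exact: primitive_linear.
  + move=> y /WE yW; have -> : f y = 0; last exact: primitive0.
    by apply: th_inj; rewrite fE thF linear0; move/mem_invs: aW; apply.
  + by move=> i; rewrite rmorphXn /= fu; apply/primitive_frob/Ga_var_primitive.
  + by split=> [|i]; [exact/PE | apply: l0; exact/PE].
- apply/eqP; rewrite eqEsubv subvf; apply/subvP => q _.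
  by apply/memv_imgP; exists (teval u q); rewrite ?memvf ?fev.
by rewrite vE rmorphXn /= fu; apply: Ga_var_exp_neq0; rewrite ltn_exp2l.
Qed.

End GaQuotient.

(** * Non-nilpotent primitive elements and cyclic groups of order p *)

Section ZpQuotient.
Variables (k : closedFieldType) (U : finGroupScheme k).
Local Notation A := (groupAlg U).
Local Notation aug := (gaug U).

(** The algebra maps from O to k; under multiplication in A they form a group, the
    k-rational points of U. *)
Definition grouplike (g : A) : Prop :=
  gapp g 1 = 1 /\ forall x y, gapp g (x * y) = gapp g x * gapp g y.

Lemma grouplike1 : grouplike 1.
Proof. by split=> [|x y]; rewrite !gapp1 ?rmorph1 ?rmorphM. Qed.

Lemma grouplikeM g h : grouplike g -> grouplike h -> grouplike (g * h).
Proof.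
move=> [g1 gM] [h1 hM].
have [|||e1 eM] := @tens_lift_alghom _ U U k^o (pair_fun (gapp g) (gapp h)).
- exact: bilin_pair_fun.
- by rewrite /pair_fun g1 h1 mulr1.
- by move=> x y x' y'; rewrite /pair_fun gM hM mulrACA.
by split=> [|x y]; rewrite !gmul_pair ?rmorph1 // rmorphM /= eM.
Qed.

Lemma grouplikeX g n : grouplike g -> grouplike (g ^+ n).
Proof.
move=> gG; elim: n => [|n IH]; first exact: grouplike1.
by rewrite exprS; exact: grouplikeM.
Qed.

(** Multiplication by v is injective on the ideal where the images of its powers
    become stationary. On a minimal ideal of O inside it, every o acts by a
    scalar, as k is algebraically closed; that scalar is an algebra map in o and
    does not vanish at v. *)
Lemma grouplike_ex (v : U) : (forall n, v ^+ n != 0) ->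
  exists2 g, grouplike g & gapp g v != 0.
Proof.
move=> nv; pose im m := limg (amull (v ^+ m)).
have memim m y : v ^+ m * y \in im m.
  by apply/memv_imgP; exists y; rewrite ?memvf // lfunE.
have [_ [_ [M ->] mM]] :=
  @minimal_vspace _ _ (fun W => exists m, W = im m) (im 0%N) (ex_intro _ 0%N erefl).
have vim : (amull v @: im M)%VS = im M.
  apply: mM.
    exists M.+1; apply/vspaceP => y; apply/memv_imgP/memv_imgP => -[z].
      by case/memv_imgP => z' _ -> ->; exists z'; rewrite ?memvf // !lfunE /= mulrA -exprS.
    by move=> _ ->; exists (v ^+ M * z); rewrite ?memim // !lfunE /= mulrA -exprS.
  apply/subvP => _ /memv_imgP[_ /memv_imgP[y _ ->] ->]; rewrite !lfunE /=.
  by rewrite mulrA -exprS exprSr -mulrA memim.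
have v_inj y : y \in im M -> v * y = 0 -> y = 0.
  move=> yM vy; have /eqP := limg_ker_dim (amull v) (im M).
  rewrite vim -[X in _ == X]add0n eqn_add2r dimv_eq0 => /eqP ker0.
  by apply/eqP; rewrite -memv0 -ker0 memv_cap yM memv_ker lfunE /= vy eqxx.
pose ideal (N : {vspace U}) := forall o x, x \in N -> o * x \in N.
have QM : ideal (im M) /\ im M != 0%VS.
  split=> [o _ /memv_imgP[y _ ->]|].
    by rewrite lfunE /= mulrA (coord_mulC o) -mulrA memim.
  apply: contra (nv M) => /eqP M0; have := memim M 1.
  by rewrite mulr1 M0 memv0.
have [N [sN [iN nN] mN]] := @minimal_vspace _ _ (fun N => ideal N /\ N != 0%VS) _ QM.
have scal o : exists z : k, forall x, x \in N -> o * x = z *: x.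
  have [|z [w [wN nw ow]]] := @closed_eigenvector _ _ (amull o) N nN.
    by move=> w wN; rewrite lfunE; exact: iN.
  rewrite lfunE /= in ow; exists z.
  have [||E EE] := @vspace_of_pred _ U (fun x => x \in N /\ o * x = z *: x).
  - by rewrite mem0v mulr0 scaler0.
  - move=> r x y [xN ox] [yN oy]; rewrite memvD ?memvZ //; split=> //.
    by rewrite mulrDr -scalerAr ox oy scalerDr !scalerA mulrC.
  have EN : E = N.
    apply: mN; last by apply/subvP => x /EE[].
    split=> [o' x /EE[xN ox]|].
      by apply/EE; split; [exact: iN | rewrite mulrA (coord_mulC o) -mulrA ox scalerAr].
    by apply: contraNneq nw => E0; rewrite -memv0 -E0; apply/EE.
  by move=> x; rewrite -{1}EN => /EE[].
have tN := memv_pick N; set t := vpick N in tN.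
have nt : t \notin 0%VS by rewrite memv0 vpick0.
have [phi [phit _]] := functional_sep nt.
have [g gE] : exists g : 'Hom(U, k^o), forall o, g o = phi (o * t).
  by apply: mk_lfun => r x y; rewrite mulrDl -scalerAl linearP.
have gt (o : U) : o * t = (g o : k) *: t.
  have [z zE] := scal o; rewrite gE zE // linearZ /= phit.
  by rewrite [_ *: 1]mulr1.
exists (g : A).
  split=> [|x y]; rewrite [LHS]gE; first by rewrite mul1r phit.
  by rewrite -mulrA gt -scalerAr linearZ /= -gE mulrC.
apply: contraNneq nt => gv; rewrite memv0; apply/eqP/v_inj; first exact: (subvP sN).
by rewrite gt [g v]gv scale0r.
Qed.

Variables (p : nat) (charkp : p \in [pchar k]).
Hypothesis pth : forall a : A, a ^+ p = (aug a : k) ^+ p *: (1 : A).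

Lemma primitive_exp (v : U) (g : A) n : primitive v -> gapp g 1 = 1 ->
  gapp (g ^+ n) v = n%:R * gapp g v.
Proof.
move=> vP g1; elim: n => [|n IH]; first by rewrite gapp1 (primitive_counit vP) mul0r.
have gn1 : gapp (g ^+ n) 1 = 1.
  elim: (n) => [|m IHm]; first by rewrite gapp1 rmorph1.
  by rewrite exprS -gaugE gaugM !gaugE g1 IHm mulr1.
rewrite exprS ((primitiveP v).1 vP) IH g1 gn1 mulr1 mul1r.
by rewrite -[n.+1]add1n natrD mulrDl mul1r.
Qed.

(** If g is an algebra map with g(v) <> 0, then g^p = 1 since a^p = eps(a)^p, and
    o |-> (i |-> g^i(o)) is a map from O to the functions on Z/(p). As v is
    primitive, g^i(v) = i g(v), so the image of v separates the points and
    generates all functions. *)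
Lemma Zp_quotient (v : U) : primitive v -> (forall n, v ^+ n != 0) ->
  exists f : 'AHom(U, constGS k 'Z_p), [/\ is_gs_hom f, limg f = fullv & f v != 0].
Proof.
move=> vP nv; have [g gG ngv] := grouplike_ex nv; have [g1 gM] := gG.
have gp : g ^+ p = 1 by rewrite pth gaugE g1 expr1n scale1r.
pose f0 o : constGS k 'Z_p := cfun (fun i : 'Z_p => gapp (g ^+ (i : nat)) o : k).
have f0E o i : cval (f0 o) i = gapp (g ^+ (i : nat)) o by exact: cvalE.
have [F FE] : exists F : 'Hom(U, constGS k 'Z_p), forall o, F o = f0 o.
  apply: mk_lfun => c x y; apply: cext => i.
  by rewrite cvalD cvalZ !f0E linearP.
have gXM (i : 'Z_p) x y : gapp (g ^+ (i : nat)) (x * y)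
    = gapp (g ^+ (i : nat)) x * gapp (g ^+ (i : nat)) y.
  exact: (grouplikeX i gG).2.
have [||f fE] := @ahom_ex _ _ _ F.
- by apply: cext => i; rewrite FE f0E cval1; exact: (grouplikeX i gG).1.
- by move=> x y; apply: cext => i; rewrite !FE cvalM !f0E gXM.
have fi o i : cval (f o) i = gapp (g ^+ (i : nat)) o by rewrite fE FE f0E.
have fv : f v = gapp g v *: Zp_var k p.
  by apply: cext => i; rewrite fi cvalZ primitive_exp // cvalE mulrC.
have f_inj : injective (cval (f v)).
  by move=> i j; rewrite fv !cvalZ => /(mulfI ngv); exact: Zp_var_inj.
exists f; split.
- have lf := ahom_lin f; split=> o; last first.
    rewrite [LHS]ccounitE fi expr0.
    by [].
  apply: ev2_ext => i j; rewrite [comul _]ccomulE ev2_comul fi.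
  rewrite /ev2 tens_lift_tmap //; last exact: bilin_ev2.
  have -> : gapp (g ^+ ((i * j)%g : 'Z_p)) o = gapp (g ^+ (i : nat) * g ^+ (j : nat)) o.
    rewrite -exprD; congr (gapp _ o); rewrite -[RHS](expr_mod _ gp) /=.
    by congr (g ^+ (_ %% _)); exact: (Zp_cardE charkp).
  by rewrite gmul_pair; apply: eq_tens_lift => x y; rewrite /pair_fun !fi.
- apply: (Zp_interpolation f_inj).
    by apply/memv_imgP; exists 1; rewrite ?memvf ?rmorph1.
  move=> _ /memv_imgP[x _ ->]; apply/memv_imgP; exists (v * x); rewrite ?memvf //.
  by rewrite rmorphM.
apply/eqP => fv0; have := f_inj 0%R 1%R; rewrite fv0 !cval0 => /(_ erefl)/eqP.
by rewrite eq_sym oner_eq0.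
Qed.

End ZpQuotient.

(** * Covering by elementary subgroup schemes *)

Section SpanSubalgebra.
Variables (k : fieldType) (U : finGroupScheme k).
Local Notation A := (groupAlg U).
Hypothesis mulC : commutative (@GRing.mul A).
Implicit Types (X : subgroupScheme U) (s : seq (subgroupScheme U)).

Lemma sub_span1 X : 1 \in sub_span X.
Proof. by apply/mem_pull; exists 1; rewrite (gpull1 (sub_res_hom X)). Qed.

Lemma sub_spanM X a b : a \in sub_span X -> b \in sub_span X -> a * b \in sub_span X.
Proof.
move=> /mem_pull[a' ->] /mem_pull[b' ->]; apply/mem_pull; exists (a' * b').
by rewrite (gpullM (sub_res_hom X)).
Qed.

Lemma sub_span_act X o a : a \in sub_span X -> gact o a \in sub_span X.
Proof.
move=> /sub_spanP aX; apply/sub_spanP => x; rewrite memv_ker gactE => /eqP fx.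
by rewrite aX // memv_ker rmorphM /= fx mulr0.
Qed.

Lemma prod_span1 s : 1 \in prod_span s.
Proof.
elim: s => [|X s IH] /=; first exact: memv_line.
by rewrite -[1]mulr1 memv_mul // sub_span1.
Qed.

Lemma prod_spanM s a b : a \in prod_span s -> b \in prod_span s -> a * b \in prod_span s.
Proof.
elim: s a b => [|X s IH] a b.
  by move=> /vlineP[c ->] /vlineP[d ->]; rewrite -scalerAl mul1r !memvZ // memv_line.
move=> aX bX; have closed u v : u \in sub_span X -> v \in prod_span s ->
    forall b, b \in prod_span (X :: s) -> u * v * b \in prod_span (X :: s).
  move=> uX vs c cX; have -> : u * v * c = amull (u * v) c by rewrite lfunE.
  rewrite memv_preim; apply: (subvP _ _ cX).
  apply/prodvP => u' v' u'X v's; rewrite -memv_preim lfunE /=.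
  have -> : u * v * (u' * v') = (u * u') * (v * v').
    by rewrite !mulrA -(mulrA u v) (mulC v) !mulrA.
  by rewrite memv_mul ?sub_spanM ?IH.
have -> : a * b = amulr b a by rewrite lfunE.
rewrite memv_preim; apply: (subvP _ _ aX).
by apply/prodvP => u v uX vs; rewrite -memv_preim lfunE /= closed.
Qed.

Lemma prod_span_act s v a : primitive v -> a \in prod_span s -> gact v a \in prod_span s.
Proof.
move=> vP; elim: s a => [|X s IH] a.
  move=> /vlineP[c ->]; rewrite linearZ /=; have [d dE] := primitive_der vP.
  by rewrite -dE der_fun1 scaler0 mem0v.
move=> aX; rewrite -gactLE memv_preim; apply: (subvP _ _ aX).
apply/prodvP => b c bX cs; rewrite -memv_preim gactLE primitive_actM //.
by apply: memvD; apply: memv_mul => //; [exact: sub_span_act | exact: IH].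
Qed.

End SpanSubalgebra.

Lemma gs_iso_refl (k : fieldType) (G : finGroupScheme k) : gs_iso G G.
Proof.
have [||f fE] := @ahom_ex _ G G \1%VF; rewrite ?id_lfunE //.
  by move=> x y; rewrite !id_lfunE.
have fx x : f x = x by rewrite fE id_lfunE.
exists f; split; last by exists id => x; rewrite fx.
have lf := ahom_lin f; split=> [x|x]; last by rewrite fx.
rewrite fx; move: (comul x) => t; elim/tens_ind: t => [a b|c u v Hu Hv].
  by rewrite tmapE // !fx.
by rewrite tmap_linear -Hu -Hv.
Qed.

Section Sufficient.
Variables (k : closedFieldType) (p : nat) (charkp : p \in [pchar k]).
Variable U : finGroupScheme k.
Local Notation A := (groupAlg U).
Local Notation aug := (gaug U).
Local Notation J := (lker aug).
Hypothesis U_unip : unipotent_gs U.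
Hypothesis mulC : commutative (@GRing.mul A).
Hypothesis pth : forall a : A, a ^+ p = (aug a : k) ^+ p *: (1 : A).
Hypothesis Ugen : prim_generated U.

(** The predicate V records what survives the passage from v to its last
    nonzero p-power, which is needed if v is nilpotent. *)
Lemma elementary_quotient (V : U -> Prop) (v : U) :
  (forall v, V v -> primitive v) -> (forall v, V v -> V (v ^+ p)) -> V v -> v != 0 ->
  exists (X : subgroupScheme U) (w : U),
    [/\ elementary_factor charkp (sub_gs X), V w & sub_res X w != 0].
Proof.
move=> VP Vp Vv nv; have [P PE] := prim_space U.
have [nil|nnil] := classic (exists n, v ^+ n = 0); last first.
  have [|f [fh fs fv]] := Zp_quotient charkp pth (VP v Vv).
    by move=> n; apply/eqP => vn; apply: nnil; exists n.
  exists (SubgroupScheme fh fs), v; split=> //; right; exact: gs_iso_refl.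
have ex : exists j, v ^+ (p ^ j) == 0.
  have [n vn] := nil; exists n; apply/eqP.
  have le : (n <= p ^ n)%N by rewrite ltnW // ltn_expl // prime_gt1 // (pcharf_prime charkp).
  by rewrite -(subnK le) exprD vn mulr0.
case: (ex_minnP ex) => -[|m]; first by rewrite expr1 (negPf nv).
move=> /eqP vm m_min; pose w := v ^+ (p ^ m).
have Vw : V w by rewrite /w; elim: (m) => [|i IH]; rewrite ?expr1 // expnSr exprM; apply: Vp.
have nw : w != 0 by apply/negP => /m_min; rewrite ltnn.
have wp : w ^+ p = 0 by rewrite /w -exprM -expnSr.
have [r [f [r0 fh fs fw]]] := Ga_quotient charkp U_unip mulC pth Ugen PE (VP w Vw) nw wp.
exists (SubgroupScheme fh fs), w; split=> //; left; exists r; split=> //.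
exact: gs_iso_refl.
Qed.

(** Indexed access, since subgroup schemes carry no boolean equality; the default
    value X0 is immaterial. *)
Definition factors (s : seq (subgroupScheme U)) : Prop :=
  forall X0 i, (i < size s)%N -> elementary_factor charkp (sub_gs (nth X0 s i)).

(** Let B be maximal among the products of group algebras of elementary
    subgroup schemes. If B <> A, some nonzero tangent vector vanishes on B, and
    it is a primitive element v. The primitive elements that vanish on B
    are closed under p-th powers, as the action of primitive elements preserves
    B; so [elementary_quotient] gives an elementary X and such a w that does not
    vanish on kX. But kX B = B by maximality. *)
Lemma elementary_cover : exists2 s, factors s & prod_span s = fullv.
Proof.
have Q1 : exists s, factors s /\ 1%VS = prod_span s by exists [::].
have [_ [_ [s [sF ->]] mB]] :=
  @maximal_vspace _ _ (fun B => exists s, factors s /\ B = prod_span s) _ Q1.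
exists s => //; set B := prod_span s in mB *.
have B1 : 1 \in B by exact: prod_span1.
apply: NNPP => nB.
have /subvPn[x xJ nx] : ~~ (J <= (B :&: J) + J * J)%VS.
  apply/negP => JB; apply: nB.
  apply: (subspace_full (gaug1 U) (@gaugM k U) (unipotent_local U_unip) B1 _ JB).
  by apply/prodvP => a b; rewrite memv_cap => /andP[aB _] bB; exact: prod_spanM.
have JJ : (J * J <= J)%VS.
  by apply/prodvP => a b _ bJ; exact: (aug_mull (@gaugM k U)).
have nxB : x \notin (B + J * J)%VS.
  apply: contra nx => /memv_addP[b bB [q qJ xE]]; rewrite xE memv_add //.
  rewrite memv_cap bB -[b](addrK q) -xE memvB //; exact: (subvP JJ).
have [f [fd fx fB]] := point_der_ex (gaug1 U) B1 nxB.
have [v vP fE] := point_der_primitive fd.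
pose V (v : U) := primitive v /\ forall b, b \in B -> gapp b v = 0.
have p0 : (0 < p)%N by rewrite prime_gt0 // (pcharf_prime charkp).
have [||||X [w [XF [wP wB] nw]]] := @elementary_quotient V v.
- by move=> ? [].
- move=> w [wP wB]; split; first exact: primitive_pow.
  move=> b bB; rewrite -[p]prednK // exprSr -gactE; apply: wB.
  elim: (p.-1) => [|m IH]; first by rewrite gact1.
  by rewrite exprSr gactM prod_span_act.
- by split=> // b bB; rewrite -fE fB.
- by apply: contra_eq_neq fx => /= v0; rewrite fE v0 linear0 eq_sym oner_eq0.
have XsB : prod_span (X :: s) = B.
  apply: mB.
    by exists (X :: s); split=> // X0 [|i] //=; rewrite ltnS; apply: sF.
  by apply/subvP => b bB; rewrite -[b]mul1r memv_mul // sub_span1.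
case/eqP: nw; apply: gapp_sep => b; rewrite -gpullE; apply: wB.
rewrite -XsB -[gpull _ _]mulr1; apply: memv_mul; last exact: B1.
by apply/mem_pull; exists b.
Qed.

Lemma prim_generated_elementary : J != 0%VS -> elementary_abelian_gs charkp U.
Proof.
move=> nJ; split; first exact/abelian_gs_mulC.
have [[|X0 s] sF sfull] := elementary_cover.
  case/eqP: nJ; apply/eqP; rewrite -subv0; apply/subvP => a.
  have : a \in prod_span [::] by rewrite sfull memvf.
  move=> /vlineP[c ->]; rewrite memv_ker linearZ /= gaug1 [_ *: 1]mulr1 => /eqP ->.
  by rewrite scale0r mem0v.
exists (size s), (fun i => nth X0 (X0 :: s) i).
have -> : [seq nth X0 (X0 :: s) i | i : 'I_(size s).+1 <- enum 'I_(size s).+1] = X0 :: s.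
  by rewrite (map_comp (nth X0 (X0 :: s)) val) val_enum_ord -[RHS](mkseq_nth X0).
split; first exact/prod_ideal0P.
by move=> i; apply: sF.
Qed.

End Sufficient.

Theorem proposition2p3 (k : closedFieldType) (p : nat) (p_ge3 : (3 <= p)%N)
    (charkp : p \in [pchar k]) (U : finGroupScheme k) (U_unip : unipotent_gs U) :
  simple_lie (HH1 (groupAlg U)) <-> elementary_abelian_gs charkp U.
Proof.
have loc := unipotent_local U_unip; have [P PE] := prim_space U.
split=> [sU|Uel].
  have mulC := unipotent_simple_mulC U_unip sU.
  have nJ := simple_aug_neq0 (gaug1 U) sU.
  have dsU : dsimple (groupAlg U).
    exact: (simple_dsimple (gaug1 U) (@gaugM k U) loc (@gaug_translation k U) mulC sU).
  have Jp := dsimple_pth_power mulC charkp dsU.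
  apply: prim_generated_elementary => //; last exact: (dsimple_prim_generated U_unip mulC PE dsU).
  move=> a; have := Jp _ (aug_sub (gaug1 U) a).
  have chA : p \in [pchar (groupAlg U)] by rewrite pchar_lalg.
  rewrite -(pFrobenius_autE chA) pFrobenius_autB_comm; last exact: mulC.
  by rewrite !pFrobenius_autE exprZn expr1n => /eqP; rewrite subr_eq0 => /eqP.
have [mulC pth] := elementary_abelian_pth Uel.
have nJ := elementary_abelian_aug_neq0 Uel.
apply: (dsimple_simple (gaug1 U) (@gaugM k U) loc (@gaug_translation k U) mulC) => //.
  by rewrite -(dvdn_pcharf charkp); apply/negP => /(dvdn_leq (isT : 0 < 2)%N); rewrite leqNgt p_ge3.
apply: (pth_power_dsimple U_unip mulC PE charkp) => a; rewrite memv_ker => /eqP a0.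
have p0 : (0 < p)%N by apply: leq_trans p_ge3.
by rewrite pth a0 expr0n eqn0Ngt p0 scale0r.
Qed.
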